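(* Fix $T>0$. Starting from (DIC) or (LEM) initial conditions with profile $\gamma$, there is a constant $c_1=c_1(\gamma)<\infty$ such that $\limsup_{a\to v_T}\frac{\sqrt T}{(a-v_T)^2}\mathbb J(a)\le c_1$, $\limsup_{|a|\to\infty}\frac{T}{|a|^3}\mathbb J(a)\le c_1$, $\limsup_{a\to u_T}\frac{\sqrt T}{(a-u_T)^2}\mathbb I(a)\le c_1$, $\limsup_{|a|\to\infty}\frac{T}{|a|^3}\mathbb I(a)\le c_1$. Moreover, starting from (DIC) initial conditions, there is a constant $c_2=c_2(\gamma)>0$ such that $\liminf_{a\to v_T}\frac{\sqrt T}{(a-v_T)^2}\mathbb J(a)\ge c_2$, $\liminf_{|a|\to\infty}\frac{T}{|a|^3}\mathbb J(a)\ge c_2$, $\liminf_{a\to u_T}\frac{\sqrt T}{(a-u_T)^2}\mathbb I(a)\ge c_2$, $\liminf_{|a|\to\infty}\frac{T}{|a|^3}\mathbb I(a)\ge c_2$.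
   Context: Profiles: $M_1$ is the set of measurable $\gamma:\mathbb R\to[0,1]$ with the vague topology. For $0<\rho_*,\rho^*<1$, $M_1(\rho_*,\rho^* )$ is the set of $\gamma\in M_1$ with $\gamma(x)=\rho_*$ for $x\le x_*$ and $\gamma(x)=\rho^*$ for $x\ge x^*$, for some $x_*\le x^*$. (LEM) profile: $\gamma\in M_1(\rho_*,\rho^* )$ piecewise continuous with $0<\gamma<1$. (DIC) profile: $\gamma\in M_1(\rho_*,\rho^* )$ piecewise continuous. $\sigma_t(y)=(2\pi t)^{-1/2}e^{-y^2/(2t)}$; $v_T=\int_0^\infty[\sigma_T*\gamma-\gamma]dx$, and $u_T$ is the unique real with $\int_0^{u_T}\sigma_T*\gamma\,dx=v_T$. A density is $\mu\in D([0,T];M_1)$. $l(\mu;G)=\int G(T,\cdot)\mu_T-\int G(0,\cdot)\mu_0-\int_0^T\int\mu_t(\partial_t+\frac12\partial_x^2)G$ for $G\in C^{1,2}_K([0,T]\times\mathbb R)$; $I_0(\mu)=\sup_G\{l(\mu;G)-\frac12\int_0^T\int\mu(1-\mu)G_x^2\}$; $h(\mu_0;\gamma)=\int[\mu_0\log(\mu_0/\gamma)+(1-\mu_0)\log((1-\mu_0)/(1-\gamma))]dx$. $I_\gamma=I^{LE}_\gamma=I_0+h(\mu_0;\gamma)$ in the (LEM) case; $I_\gamma=I^{DC}_\gamma$ equals $I_0(\mu)$ if $\mu_0=\gamma$ and $\infty$ otherwise in the (DIC) case. $\mathbb J(a)=\inf\{I_\gamma(\mu):I_\gamma(\mu)<\infty,\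 \int_0^\infty(\mu_T-\mu_0)dx=a\}$, $\mathbb I(a)=\inf\{I_\gamma(\mu):I_\gamma(\mu)<\infty,\ \int_0^\infty(\mu_T-\mu_0)dx=\int_0^a\mu_Tdx\}$, where $\int_0^\infty:=\lim_{L\to\infty}\int_0^L$ (which exists when $I_\gamma(\mu)<\infty$). These are the large deviation rate functions of the scaled current $J_{-1,0}(N^2T)/N$ across the bond $(-1,0)$ and scaled tagged particle position $X_{N^2T}/N$ in one-dimensional nearest-neighbor symmetric simple exclusion. *)

(* Defs.v *)
From HB Require Import structures.
From mathcomp Require Import all_boot all_order all_algebra.
From mathcomp Require Import all_classical all_reals all_analysis.
Set Implicit Arguments. Unset Strict Implicit. Unset Printing Implicit Defensive.
Import Order.TTheory GRing.Theory Num.Theory numFieldNormedType.Exports.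
Local Open Scope classical_set_scope.
Local Open Scope ring_scope.

Section SEP_LDP.
Context {R : realType}.

Definition Rint (D : set R) (f : R -> R) : R :=
  Rintegral (@lebesgue_measure R) D f.

Definition oint (f : R -> R) (a b : R) : R :=
  if a <= b then Rint `[a, b] f else - Rint `[b, a] f.

Definition int0inf_eq (f : R -> R) (a : R) : Prop :=
  (fun L => Rint `[0, L] f) @ +oo --> a.

Definition M1 (g : R -> R) : Prop :=
  measurable_fun setT g /\ forall x, 0 <= g x <= 1.

Definition M1rho (rl rr : R) (g : R -> R) : Prop :=
  M1 g /\ exists xl xr : R, xl <= xr /\
    (forall x, x <= xl -> g x = rl) /\ (forall x, xr <= x -> g x = rr).

Definition piecewise_continuous (g : R -> R) : Prop :=
  exists s : seq R,
    (forall x, x \notin s -> {for x, continuous g}) /\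
    (forall x, x \in s -> cvg (g @ x^'-) /\ cvg (g @ x^'+)).

Inductive init_cond := LEM | DIC.

Definition profile (md : init_cond) (rl rr : R) (g : R -> R) : Prop :=
  match md with
  | DIC => M1rho rl rr g /\ piecewise_continuous g
  | LEM => M1rho rl rr g /\ piecewise_continuous g /\ forall x, 0 < g x < 1
  end.

Definition sigma (t y : R) : R :=
  (Num.sqrt (2 * pi * t))^-1 * expR (- (y ^+ 2) / (2 * t)).

Definition heat (t : R) (g : R -> R) (x : R) : R :=
  Rint setT (fun y => sigma t (x - y) * g y).

Definition vT (T : R) (g : R -> R) : R :=
  lim ((fun L => Rint `[0, L] (fun x => heat T g x - g x)) @ +oo).

Definition CK (f : R -> R) : Prop :=
  continuous f /\ exists M : R, forall x, M < `|x| -> f x = 0.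

Definition dt (G : R -> R -> R) (t x : R) : R := derive1 (fun s => G s x) t.
Definition dx (G : R -> R -> R) (t x : R) : R := derive1 (fun y => G t y) x.

(* C^{1,2} with compact support (G is given on R x R; only its restriction
   to [0,T] x R is used) *)
Definition C12K (G : R -> R -> R) : Prop :=
  (forall t x, derivable (fun s => G s x) t 1 /\
               derivable (fun y => G t y) x 1 /\
               derivable (fun y => dx G t y) x 1) /\
  continuous (fun p : R * R => G p.1 p.2) /\
  continuous (fun p : R * R => dt G p.1 p.2) /\
  continuous (fun p : R * R => dx G p.1 p.2) /\
  continuous (fun p : R * R => dx (dx G) p.1 p.2) /\
  exists M : R, forall t x, M < `|t| \/ M < `|x| -> G t x = 0.

Definition vague_cvg (F : set_system R) (mu : R -> R -> R) (m : R -> R) : Prop :=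
  forall f, CK f ->
    (fun s => Rint setT (fun x => f x * mu s x)) @ F
      --> Rint setT (fun x => f x * m x).

Definition density (T : R) (mu : R -> R -> R) : Prop :=
  (forall t x, 0 <= mu t x <= 1) /\
  measurable_fun setT (fun p : R * R => mu p.1 p.2) /\
  (forall t, 0 <= t < T -> vague_cvg t^'+ mu (mu t)) /\
  (forall t, 0 < t <= T -> exists nu, M1 nu /\ vague_cvg t^'- mu nu).

Definition lfun (T : R) (mu : R -> R -> R) (G : R -> R -> R) : R :=
  Rint setT (fun x => G T x * mu T x) - Rint setT (fun x => G 0 x * mu 0 x)
  - Rint `[0, T] (fun t => Rint setT
        (fun x => mu t x * (dt G t x + 2^-1 * dx (dx G) t x))).

Definition quadfun (T : R) (mu : R -> R -> R) (G : R -> R -> R) : R :=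
  Rint `[0, T] (fun t => Rint setT
        (fun x => mu t x * (1 - mu t x) * (dx G t x) ^+ 2)).

Definition I0 (T : R) (mu : R -> R -> R) : \bar R :=
  ereal_sup [set (lfun T mu G - 2^-1 * quadfun T mu G)%:E | G in C12K].

Definition bern_ent (m g : R) : R :=
  (if m == 0 then 0 else m * ln (m / g)) +
  (if m == 1 then 0 else (1 - m) * ln ((1 - m) / (1 - g))).

Definition hent (m0 g : R -> R) : \bar R :=
  (\int[@lebesgue_measure R]_(x in setT) (bern_ent (m0 x) (g x))%:E)%E.

Definition Igam (md : init_cond) (T : R) (g : R -> R) (mu : R -> R -> R) : \bar R :=
  match md with
  | LEM => (I0 T mu + hent (mu 0%R) g)%E
  | DIC => if `[< {ae @lebesgue_measure R, forall x, mu 0 x = g x} >]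
           then I0 T mu else +oo%E
  end.

(* rate function of the current *)
Definition Jrate (md : init_cond) (T : R) (g : R -> R) (a : R) : \bar R :=
  ereal_inf [set Igam md T g mu | mu in
    [set mu | density T mu /\ (Igam md T g mu < +oo)%E /\
              int0inf_eq (fun x => mu T x - mu 0 x) a]].

(* rate function of the tagged particle *)
Definition Irate (md : init_cond) (T : R) (g : R -> R) (a : R) : \bar R :=
  ereal_inf [set Igam md T g mu | mu in
    [set mu | density T mu /\ (Igam md T g mu < +oo)%E /\
              int0inf_eq (fun x => mu T x - mu 0 x) (oint (mu T) 0 a)]].

Definition abs_infty : set_system R :=
  [set P | exists M : R, forall a, M < `|a| -> P a].

End SEP_LDP.

(* Main.v *)
Require Import Defs.
From HB Require Import structures.
From mathcomp Require Import all_boot all_order all_algebra.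
From mathcomp Require Import all_classical all_reals all_analysis.
From mathcomp Require Import measurable_realfun ring lra.
Import Order.TTheory GRing.Theory Num.Theory numFieldNormedType.Exports.
Local Open Scope classical_set_scope.
Local Open Scope ring_scope.
Set Implicit Arguments. Unset Strict Implicit. Unset Printing Implicit Defensive.
Local Notation Rint := Defs.Rint.

(* Upper bounds.  Let [rho] be the heat flow started from the profile.  The path
   [rho t x + theta t * phi' x], where [phi x = eps * exp (- x^2 / (2 L^2))] and [theta] increases from 0 at [T / 2]
   to 1 at [T], moves [eps] units of mass across the origin and keeps the mobility bounded below as long as
   [|eps| / L] is small.  It is driven by an explicit flux, so completing the square in the variational formula bounds
   its cost by a multiple of [eps^2 (L + L^-3)].  Taking [L = 1] gives the quadratic behaviour near the typical value
   and [L] proportional to [|a|] the cubic growth.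

   Lower bounds.  A test function in the variational formula is integrated against the excess mass [q] to the right of
   a point [b], which is 0 for the current and [a] for the tagged particle.  For large [q], a plateau starting at [b]
   with edges of width [|q| / 48] and height of order [q^2 / T] yields a multiple of [|q|^3 / T].  For small [q], one
   uses a multiple of the backward heat flow of the half line [x >= b], truncated far away: it is annihilated by the
   heat operator, so that only the difference of [mu] and [rho] at time [T] is seen, and its quadratic cost is finite;
   optimizing over the multiple yields a multiple of [q^2]. *)

(** * Integrals *)

(** Under (DIC) the profile may take the values 0 and 1, where the mobility [mu (1 - mu)] vanishes
    and a flux cannot be paid for. This is why the perturbation waits until [T / 2]: by then the
    heat flow lies in some [[d, 1 - d]] uniformly in space. The density is changed by the derivative
    of a Gaussian of height [eps], so the current changes by exactly [eps], and the implicit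
    constraint of the tagged particle becomes linear in [eps].

    In the lower bounds [mu] has no regularity, and the mass beyond [b] is only a conditional limit,
    while test functions need compact support. A plateau with edges of width [w] misjudges the mass
    by the order of [w], so [w] is at most of order [q]; diffusion across the edges then costs
    [lam T / w] against a gain [lam q], which is affordable only when [q^2] exceeds a multiple of
    [T]. For smaller [q] the near edge is replaced by the backward heat flow, which has no diffusion
    error, and the far edge is made wide; summation by parts shows that its width does not harm the
    mass. *)

Section Measure_toolkit.
Context d (X : measurableType d) (R : realType).
Variable mu : {measure set X -> \bar R}.

(** The integral of a nonnegative function is a supremum over the simple functions below it, so
    monotonicity holds without measurability. *)
Lemma ge0_integral_le_nomeas (D : set X) (f1 f2 : X -> \bar R) :
  (forall x, D x -> (0 <= f1 x)%E) -> (forall x, D x -> (f1 x <= f2 x)%E) ->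
  (\int[mu]_(x in D) f1 x <= \int[mu]_(x in D) f2 x)%E.
Proof.
move=> f10 f12.
have f20 x : D x -> (0 <= f2 x)%E by move=> Dx; exact: le_trans (f10 _ Dx) (f12 _ Dx).
rewrite !ge0_integralE//; apply: ereal_sup_le => _ /= [h hf <-]; exists h => // x.
apply: le_trans (hf x) _; rewrite /patch; case: ifPn => // /set_mem Dx.
exact: f12.
Qed.

(* No measurability of [f]: the lower integral is monotone anyway. *)
Lemma Rintegral_le_dom (D : set X) (f b : X -> R) :
  measurable D -> mu.-integrable D (EFin \o b) ->
  (forall x, D x -> `|f x| <= b x) ->
  `|Rintegral mu D f| <= Rintegral mu D b.
Proof.
move=> mD ib fb.
have bfin : (\int[mu]_(x in D) (b x)%:E)%E \is a fin_num by exact: integrable_fin_num.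
rewrite /Rintegral integralE.
set p := (X in (X - _)%E); set m := (X in (_ - X)%E).
have p0 : (0 <= p)%E by apply: integral_ge0 => x _; exact: funepos_ge0.
have m0 : (0 <= m)%E by apply: integral_ge0 => x _; exact: funeneg_ge0.
have pb : (p <= \int[mu]_(x in D) (b x)%:E)%E.
  apply: ge0_integral_le_nomeas => x Dx; first exact: funepos_ge0.
  rewrite funeposE /maxe; case: ifP => _; rewrite lee_fin.
    by rewrite (le_trans _ (fb _ Dx)).
  by rewrite (le_trans _ (fb _ Dx))// ler_norm.
have mb : (m <= \int[mu]_(x in D) (b x)%:E)%E.
  apply: ge0_integral_le_nomeas => x Dx; first exact: funeneg_ge0.
  rewrite funenegE /maxe; case: ifP => _; rewrite lee_fin.
    by rewrite (le_trans _ (fb _ Dx)).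
  by rewrite (le_trans _ (fb _ Dx))// ler_normr lexx orbT.
move: bfin pb mb p0 m0.
case: (\int[mu]_(x in D) (b x)%:E)%E => [B| |] //= _.
case: p => [p| |] //; case: m => [m| |] //=.
rewrite !lee_fin => pB mB p0 m0.
by rewrite ler_norml; apply/andP; split; lra.
Qed.

Lemma EFin_Rintegral (D : set X) (f : X -> R) : measurable D ->
  mu.-integrable D (EFin \o f) ->
  (Rintegral mu D f)%:E = (\int[mu]_(x in D) (f x)%:E)%E.
Proof. by move=> mD fi; rewrite /Rintegral fineK// (integrable_fin_num mD fi). Qed.

Lemma integrable_dom (D : set X) (f b : X -> R) :
  measurable D -> measurable_fun D f -> mu.-integrable D (EFin \o b) ->
  (forall x, D x -> `|f x| <= b x) -> mu.-integrable D (EFin \o f).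
Proof.
move=> mD mf ib fb; apply: le_integrable ib => //.
  exact/measurable_EFinP.
move=> x Dx /=; rewrite lee_fin (le_trans (fb _ Dx))// ler_norm //.
Qed.

Lemma Rintegral_cvg_dom (D : set X) (f_ : nat -> X -> R) (f b : X -> R) :
  measurable D -> (forall n, measurable_fun D (f_ n)) -> measurable_fun D f ->
  mu.-integrable D (EFin \o b) ->
  {ae mu, forall x, D x -> f_ ^~ x @ \oo --> f x} ->
  (forall n x, D x -> `|f_ n x| <= b x) ->
  (fun n => Rintegral mu D (f_ n)) @ \oo --> Rintegral mu D f.
Proof.
move=> mD mf_ mf ib cf fb.
have H := @dominated_convergence _ X R mu D mD (fun n => EFin \o f_ n) (EFin \o f) (EFin \o b).
have [] := H.
- by move=> n; exact/measurable_EFinP.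
- exact/measurable_EFinP.
- by apply: filterS cf => x cx Dx; apply: cvg_EFin; [apply: filterE|exact: cx].
- exact: ib.
- by apply: aeW => x n Dx /=; rewrite lee_fin fb.
move=> fi _ cv.
have E : (\int[mu]_(x in D) (EFin \o f) x)%E = (Rintegral mu D f)%:E.
  by rewrite EFin_Rintegral.
by rewrite E in cv; exact: fine_cvg cv.
Qed.

End Measure_toolkit.

Section Fubini_toolkit.
Context d1 d2 (X : measurableType d1) (Y : measurableType d2) (R : realType).
Variable m1 : {sigma_finite_measure set X -> \bar R}%R.
Variable m2 : {sigma_finite_measure set Y -> \bar R}%R.

(** Tonelli for [|f|]. The majorant [b] is integrated only along sections; joint measurability is
    required of [f] alone, and the integrals of [b] enter through the integrable bound [B]. *)
Lemma integrable_prod_dom (f b : X -> Y -> R) (B : X -> R) :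
  measurable_fun setT (fun p : X * Y => f p.1 p.2) ->
  (forall x y, `|f x y| <= b x y) ->
  (forall x, m2.-integrable setT (EFin \o b x)) ->
  (forall x, Rintegral m2 setT (b x) <= B x) ->
  m1.-integrable setT (EFin \o B) ->
  (m1 \x m2)%E.-integrable setT (fun p : X * Y => (f p.1 p.2)%:E).
Proof.
move=> mf fb ib bB iB; apply/integrable12ltyP; first exact/measurable_EFinP.
apply: (@le_lt_trans _ _ (\int[m1]_x (B x)%:E)%E).
  apply: ge0_integral_le_nomeas => x _.
    by apply: integral_ge0 => y _; exact: abse_ge0.
  apply: (@le_trans _ _ (\int[m2]_y (b x y)%:E)%E).
    by apply: ge0_integral_le_nomeas => y _ //=; rewrite lee_fin.
  have <- : (Rintegral m2 setT (b x))%:E = (\int[m2]_y (b x y)%:E)%E.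
    exact: EFin_Rintegral.
  by rewrite lee_fin bB.
by rewrite -EFin_Rintegral// ltry.
Qed.

(** Fubini gives integrability of almost every section. Asking it of every section identifies the
    real-valued inner integral with [fubini_F] everywhere, so no exceptional null set has to be
    carried along. *)
Lemma Rintegral_prod1 (f : X -> Y -> R) :
  (m1 \x m2)%E.-integrable setT (fun p : X * Y => (f p.1 p.2)%:E) ->
  (forall x, m2.-integrable setT (EFin \o f x)) ->
  m1.-integrable setT (EFin \o (fun x => Rintegral m2 setT (f x))) /\
  Rintegral m1 setT (fun x => Rintegral m2 setT (f x)) =
  Rintegral (m1 \x m2)%E setT (fun p => f p.1 p.2).
Proof.
move=> fi f2.
have E : EFin \o (fun x => Rintegral m2 setT (f x)) =
   fubini_F m2 (fun p : X * Y => (f p.1 p.2)%:E).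
  by apply/funext => x; rewrite /fubini_F/= EFin_Rintegral.
split; first by rewrite E; exact: integrable_fubini_F.
by rewrite {1 3}/Rintegral; congr fine; rewrite -integral12_prod_meas1 // -E.
Qed.

Lemma Rintegral_prod2 (f : X -> Y -> R) :
  (m1 \x m2)%E.-integrable setT (fun p : X * Y => (f p.1 p.2)%:E) ->
  (forall y, m1.-integrable setT (EFin \o (f ^~ y))) ->
  Rintegral m2 setT (fun y => Rintegral m1 setT (f ^~ y)) =
  Rintegral (m1 \x m2)%E setT (fun p => f p.1 p.2).
Proof.
move=> fi f2.
have E : EFin \o (fun y => Rintegral m1 setT (f ^~ y)) =
   fubini_G m1 (fun p : X * Y => (f p.1 p.2)%:E).
  by apply/funext => y; rewrite /fubini_G/= EFin_Rintegral.
by rewrite {1 3}/Rintegral; congr fine; rewrite -integral21_prod_meas1 // -E.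
Qed.

Lemma integrable_prod2 (f : X -> Y -> R) :
  (m1 \x m2)%E.-integrable setT (fun p : X * Y => (f p.1 p.2)%:E) ->
  (forall y, m1.-integrable setT (EFin \o (f ^~ y))) ->
  m2.-integrable setT (EFin \o (fun y => Rintegral m1 setT (f ^~ y))).
Proof.
move=> fi f2.
have E : EFin \o (fun y => Rintegral m1 setT (f ^~ y)) =
   fubini_G m1 (fun p : X * Y => (f p.1 p.2)%:E).
  by apply/funext => y; rewrite /fubini_G/= EFin_Rintegral.
apply/integrableP; split; first by rewrite E; exact: (measurable_fubini_G fi).
have := (@integrable21ltyP _ _ _ _ _ m1 m2 _ (measurable_int _ fi)).1 fi.
apply: le_lt_trans; apply: ge0_integral_le_nomeas => y _; first exact: abse_ge0.
rewrite E /fubini_G/=; apply: le_abse_integral => //.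
exact: (measurable_int _ (f2 y)).
Qed.

Lemma Rintegral_swap (f b : X -> Y -> R) (B : X -> R) :
  measurable_fun setT (fun p : X * Y => f p.1 p.2) ->
  (forall x y, `|f x y| <= b x y) ->
  (forall x, m2.-integrable setT (EFin \o b x)) ->
  (forall x, Rintegral m2 setT (b x) <= B x) ->
  m1.-integrable setT (EFin \o B) ->
  (forall y, m1.-integrable setT (EFin \o (f ^~ y))) ->
  m1.-integrable setT (EFin \o (fun x => Rintegral m2 setT (f x))) /\
  Rintegral m1 setT (fun x => Rintegral m2 setT (f x)) =
  Rintegral m2 setT (fun y => Rintegral m1 setT (f ^~ y)).
Proof.
move=> mf fb ib bB iB i1.
have fi := integrable_prod_dom mf fb ib bB iB.
have f2 x : m2.-integrable setT (EFin \o f x).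
  apply: (integrable_dom measurableT _ (ib x)) => //.
  exact: (measurableT_comp mf (pair1_measurable x)).
have [? E] := Rintegral_prod1 fi f2.
by split => //; rewrite E Rintegral_prod2.
Qed.

End Fubini_toolkit.

Section Product_sigma_finite.
Context d1 d2 (X : measurableType d1) (Y : measurableType d2) (R : realType).
Variable m1 : {sigma_finite_measure set X -> \bar R}%R.
Variable m2 : {sigma_finite_measure set Y -> \bar R}%R.

(* An alias of [m1 \x m2], on which the sigma-finite structure is found by unification. *)
Definition prodm : set (X * Y) -> \bar R := (m1 \x m2)%E.

(** Needed in [heat_weak_eps], where Fubini exchanges the time-space plane with the starting point
    of the heat kernel. *)
Lemma prodm_sigma_finite : sigma_finite setT prodm.
Proof.
have /sigma_finiteP[A [TA ndA Afin]] := sigma_finiteT m1.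
have /sigma_finiteP[B [TB ndB Bfin]] := sigma_finiteT m2.
exists (fun n => A n `*` B n) => [|n].
  apply/seteqP; split => // -[x y] _.
  have [i _ Ai] : (\bigcup_i A i) x by rewrite -TA.
  have [j _ Bj] : (\bigcup_i B i) y by rewrite -TB.
  exists (maxn i j) => //; split => /=.
    by move: x Ai; apply/subsetPset/ndA; rewrite leq_maxl.
  by move: y Bj; apply/subsetPset/ndB; rewrite leq_maxr.
have [[mA fA] [mB fB]] := (Afin n, Bfin n); split; first exact: measurableX.
by rewrite /prodm product_measure1E// lte_mul_pinfty// ge0_fin_numE.
Qed.

HB.instance Definition _ := Measure.on prodm.
HB.instance Definition _ := @Measure_isSigmaFinite.Build _ _ _ prodm prodm_sigma_finite.

End Product_sigma_finite.

Section Real_integrals.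
Context {R : realType}.
Implicit Types f b : R -> R.
Local Notation leb := (@lebesgue_measure R).
Local Notation intg D f := (leb.-integrable D (EFin \o f)).

Local Notation mset D := ((measurable : set (set (measurableTypeR R))) D).

Lemma Rint_le_dom (D : set R) f b :
  mset D -> intg D b -> (forall x, D x -> `|f x| <= b x) ->
  `|Rint D f| <= Rint D b.
Proof. by move=> mD ib fb; apply: (Rintegral_le_dom mD ib fb). Qed.

Lemma intg_dom (D : set R) f b :
  mset D -> measurable_fun D f -> intg D b -> (forall x, D x -> `|f x| <= b x) ->
  intg D f.
Proof.
move=> mD mf ib fb.
by apply: (@integrable_dom _ (measurableTypeR R) R leb D f b mD _ ib fb); exact: mf.
Qed.

Lemma intg_meas (D : set R) f : intg D f -> measurable_fun D f.
Proof. by move=> /integrableP[/measurable_EFinP mf _]; exact: mf. Qed.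

Lemma Rint_cvg_dom (D : set R) (f_ : nat -> R -> R) f b :
  mset D -> (forall n, measurable_fun D (f_ n)) -> measurable_fun D f ->
  intg D b ->
  {ae leb, forall x, D x -> f_ ^~ x @ \oo --> f x} ->
  (forall n x, D x -> `|f_ n x| <= b x) ->
  (fun n => Rint D (f_ n)) @ \oo --> Rint D f.
Proof.
move=> mD mf_ mf ib cf fb.
apply: (@Rintegral_cvg_dom _ (measurableTypeR R) R leb D f_ f b mD _ _ ib cf fb).
- by move=> n; exact: mf_.
- exact: mf.
Qed.

Lemma Rint_swap (f b : R -> R -> R) (B : R -> R) :
  measurable_fun setT (fun p : R * R => f p.1 p.2) ->
  (forall x y, `|f x y| <= b x y) ->
  (forall x, intg setT (b x)) ->
  (forall x, Rint setT (b x) <= B x) ->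
  intg setT B ->
  (forall y, intg setT (f ^~ y)) ->
  intg setT (fun x => Rint setT (f x)) /\
  Rint setT (fun x => Rint setT (f x)) = Rint setT (fun y => Rint setT (f ^~ y)).
Proof.
move=> mf fb ib bB iB i1.
apply: (@Rintegral_swap _ _ (measurableTypeR R) (measurableTypeR R) R leb leb f b B _ fb ib bB iB i1).
exact: mf.
Qed.

Lemma Rint_swap_intg (f b : R -> R -> R) (B : R -> R) :
  measurable_fun setT (fun p : R * R => f p.1 p.2) ->
  (forall x y, `|f x y| <= b x y) ->
  (forall x, intg setT (b x)) ->
  (forall x, Rint setT (b x) <= B x) ->
  intg setT B ->
  (forall y, intg setT (f ^~ y)) ->
  intg setT (fun y => Rint setT (f ^~ y)).
Proof.
move=> mf fb ib bB iB i1.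
apply: (@integrable_prod2 _ _ (measurableTypeR R) (measurableTypeR R) R leb leb f _ i1).
apply: (@integrable_prod_dom _ _ (measurableTypeR R) (measurableTypeR R) R leb leb f b B _ fb ib bB iB).
exact: mf.
Qed.

Lemma intg_indic (D : set R) (a b c : R) :
  mset D -> intg D (fun x => c * \1_(`[a, b] : set R) x).
Proof.
move=> mD.
have : leb.-integrable setT (fun x => c%:E * (\1_(`[a, b] : set R) x)%:E)%E.
  apply: integrableZl => //.
  apply/integrableP; split; first by apply/measurable_EFinP; exact: measurable_indic.
  under eq_integral do rewrite gee0_abs ?lee_fin //.
  by rewrite integral_indic//= setIT lebesgue_measure_itv /=; case: ifP => // _; rewrite ltry.
move=> /integrableS; apply => //.
Qed.

Lemma Rint_indic (a b c : R) : a <= b ->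
  Rint setT (fun x => c * \1_(`[a, b] : set R) x) = c * (b - a).
Proof.
move=> ab; rewrite /Rint RintegralZl //; last first.
  by have := @intg_indic setT a b 1 measurableT; under [X in EFin \o X]eq_fun do rewrite mul1r.
congr (_ * _); rewrite /Rintegral integral_indic//= setIT lebesgue_measure_itv /= lte_fin.
case: ltP => // ba; rewrite /=; lra.
Qed.

Lemma intg_box f (a b c : R) :
  measurable_fun setT f -> (forall x, `|f x| <= c * \1_(`[a, b] : set R) x) ->
  intg setT f.
Proof.
move=> mf fb; apply: (intg_dom measurableT mf (intg_indic a b c measurableT)).
by move=> x _; exact: fb.
Qed.

Lemma Rint_box f (a b c : R) : a <= b ->
  (forall x, `|f x| <= c * \1_(`[a, b] : set R) x) ->
  `|Rint setT f| <= c * (b - a).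
Proof.
move=> ab fb; rewrite -Rint_indic//; apply: Rint_le_dom => //.
exact: intg_indic.
Qed.

Lemma Rint_time (T c : R) f : 0 <= T ->
  (forall x, 0 <= x <= T -> `|f x| <= c) -> `|Rint `[0, T] f| <= c * T.
Proof.
move=> T0 fb.
have E : Rint `[0, T] (cst c) = c * T.
  rewrite /Rint Rintegral_cst //= lebesgue_measure_itv /= lte_fin.
  by case: ltP => //= T0'; [rewrite subr0|have -> : T = 0 by lra].
rewrite -E; apply: Rint_le_dom => //=.
  by apply: (@continuous_compact_integrable R (cst c)); [exact: segment_compact|
    move=> x; exact: cvg_cst].
Qed.

Lemma is_derive_cont f (x l : R) : is_derive x 1 f l -> {for x, continuous f}.
Proof.
by move=> df; apply: differentiable_continuous; apply/derivable1_diffP; case: df.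
Qed.

Lemma continuous_within (a b : R) f :
  (forall x, a <= x <= b -> {for x, continuous f}) -> {within `[a, b], continuous f}.
Proof.
by move=> cf; apply: continuous_in_subspaceT => x; rewrite inE/= in_itv/=; exact: cf.
Qed.

Lemma intg_cont (a b : R) f :
  (forall x, a <= x <= b -> {for x, continuous f}) -> intg `[a, b] f.
Proof.
move=> cf; apply: (@continuous_compact_integrable R f); first exact: segment_compact.
exact: continuous_within.
Qed.

Lemma Rint_FTC f (F : R -> R) (a b : R) : a <= b ->
  (forall x : R, a <= x <= b -> {for x, continuous f}) ->
  (forall x : R, a <= x <= b -> is_derive x 1 F (f x)) -> Rint `[a, b] f = F b - F a.
Proof.
rewrite le_eqVlt => /predU1P[<-|ab] cf dF.
  by rewrite set_itv1 /Defs.Rint Rintegral_set1 subrr.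
have cF x : a <= x <= b -> {for x, continuous F}.
  by move=> xab; exact: is_derive_cont (dF x xab).
rewrite /Defs.Rint /Rintegral (continuous_FTC2 (F := F) ab) //.
- exact: continuous_within.
- split.
  + by move=> x /[!in_itv]/= /andP[? ?]; case: (dF x) => //; rewrite !ltW.
  + by apply: cvg_at_right_filter; apply: cF; rewrite lexx ltW.
  + by apply: cvg_at_left_filter; apply: cF; rewrite lexx ltW.
- by move=> x /[!in_itv]/= /andP[? ?]; rewrite derive1E; case: (dF x) => //; rewrite !ltW.
Qed.

Lemma Rint_supp f (a b : R) :
  (forall x, ~ (a <= x <= b) -> f x = 0) -> Rint setT f = Rint `[a, b] f.
Proof.
move=> f0; rewrite /Rint [RHS]Rintegral_mkcond; congr Rintegral.
apply/funext => x; rewrite patchE; case: ifPn => // /negP xab.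
by apply: f0 => h; apply: xab; rewrite inE/= in_itv.
Qed.

Lemma continuous_Rmeas f : continuous f -> measurable_fun setT f.
Proof. by move=> cf; exact: continuous_measurable_fun. Qed.

End Real_integrals.

(** * Measurability in the plane *)

Section Plane.
Context {R : realType}.

(** The plane carries the product sigma-algebra, so an open set is exhibited as the countable union
    of the squares with rational centre and radius [1 / (n + 1)] that it contains. *)
Lemma open_plane_measurable (U : set (R * R)) : open U -> measurable U.
Proof.
move=> oU.
pose box (k : rat * rat * nat) : set (R * R) :=
  ball (ratr k.1.1 : R) (k.2.+1%:R^-1) `*` ball (ratr k.1.2 : R) (k.2.+1%:R^-1).
pose F (i : nat) : set (R * R) :=
  match unpickle i with
  | Some k => if `[< box k `<=` U >] then box k else set0
  | None => set0 end.
have -> : U = \bigcup_i F i.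
  apply/seteqP; split => [[x y] Uxy|[x y] [i _]]; last first.
    rewrite /F; case: unpickle => // k; case: asboolP => // kU; exact: kU.
  have /nbhs_ballP[e /= e0 eU] : nbhs (x, y) U by exact: open_nbhs_nbhs.
  (* Two points of a square of radius [dl] differ by less than [2 dl] in each coordinate; with
     [dl < e / 2] any such square containing [(x, y)] stays inside the ball of radius [e]. *)
  have [n ne] : exists n : nat, n.+1%:R^-1 < e / 2.
    have [n _ /(_ n (leqnn n)) /= h] := near_infty_natSinv_lt (PosNum (divr_gt0 e0 (ltr0n R 2))).
    by exists n.
  have [dl dlE] : exists dl : R, dl = n.+1%:R^-1 by eexists.
  have n0 : 0 < dl by rewrite dlE invr_gt0.
  rewrite -dlE in ne.
  have rl (z : R) : exists q : rat, (ratr q - dl < z) /\ (z < ratr q + dl).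
    have zz : z - dl < z + dl by lra.
    have [q] := rat_in_itvoo zz.
    by rewrite in_itv/= => /andP[h1 h2]; exists q; split; lra.
  have [q1 [h1 h2]] := rl x; have [q2 [h3 h4]] := rl y.
  exists (pickle (q1, q2, n)); [exact: I|rewrite /F pickleK; case: asboolP => [_|]].
    by split; rewrite /ball/= -dlE ltr_distl; apply/andP; split; lra.
  case=> -[u v] [] /=; rewrite /ball/= -dlE !ltr_distl => /andP[a1 a2] /andP[b1 b2].
  by apply: eU; split; rewrite /ball/= ltr_distl; apply/andP; split; lra.
apply: bigcupT_measurable => i; rewrite /F; case: unpickle => // k; case: asboolP => // _.
by apply: measurableX; exact: measurable_ball.
Qed.

Lemma continuous_plane_measurable (f : R * R -> R) :
  continuous f -> measurable_fun setT f.
Proof.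
move=> /continuousP cf; apply: (measurability _ (RGenOpens.measurableE R)).
move=> _ [_ [a [b ->] <-]]; rewrite setTI; apply: open_plane_measurable.
by apply: cf; exact: interval_open.
Qed.

End Plane.

(** * Integration by parts and uniform bounds for test functions *)

Section Real_calculus.
Context {R : realType}.
Implicit Types f : R -> R.
Local Notation leb := (@lebesgue_measure R).
Local Notation intg D f := (leb.-integrable D (EFin \o f)).

Lemma is_derive_mul (f g : R -> R) (x a b : R) :
  is_derive x 1 f a -> is_derive x 1 g b ->
  is_derive x 1 (fun y => f y * g y) (a * g x + f x * b).
Proof.
move=> df dg; have := is_deriveM df dg; rewrite /GRing.scale/=.
by move=> h; apply: is_derive_eq; rewrite /GRing.scale/=; ring.
Qed.

Lemma Rint_parts (u v u' v' : R -> R) (M : R) : 0 <= M ->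
  (forall x : R, is_derive x 1 u (u' x)) -> (forall x : R, is_derive x 1 v (v' x)) ->
  continuous u' -> continuous v' ->
  (forall x, M < `|x| -> v x = 0 /\ v' x = 0) ->
  Rint setT (fun x => u' x * v x) = - Rint setT (fun x => u x * v' x).
Proof.
move=> M0 du dv cu' cv' v0.
have cu : continuous u by move=> x; exact: is_derive_cont (du x).
have cv : continuous v by move=> x; exact: is_derive_cont (dv x).
(* [v] vanishes strictly beyond [M]; the margin 1 makes it vanish at the endpoints of the interval
   of integration too. *)
have out (x : R) : ~ (- (M + 1) <= x <= M + 1) -> v x = 0 /\ v' x = 0.
  move=> h; apply: v0; rewrite ltNge; apply/negP => hx; apply: h.
  by move: hx; rewrite ler_norml => /andP[? ?]; apply/andP; split; lra.
rewrite (@Rint_supp _ _ (- (M + 1)) (M + 1)); last by move=> x /out[-> _]; rewrite mulr0.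
rewrite [in RHS](@Rint_supp _ _ (- (M + 1)) (M + 1)); last by move=> x /out[_ ->]; rewrite mulr0.
have c1 : continuous (fun x => u' x * v x) by move=> x; apply: cvgM; [exact: cu'|exact: cv].
have c2 : continuous (fun x => u x * v' x) by move=> x; apply: cvgM; [exact: cu|exact: cv'].
apply/eqP; rewrite -addr_eq0 -RintegralD //=; last 2 first.
- by apply: intg_cont => x _; exact: c1.
- by apply: intg_cont => x _; exact: c2.
apply/eqP.
have MM : - (M + 1) <= M + 1 by lra.
apply: (etrans (@Rint_FTC _ _ (fun x => u x * v x) _ _ MM _ _)).
- by move=> x _; apply: cvgD; [exact: c1|exact: c2].
- by move=> x _; exact: is_derive_mul.
have [-> _] := v0 (M + 1) ltac:(rewrite ger0_norm; lra).
have [-> _] := v0 (- (M + 1)) ltac:(rewrite normrN ger0_norm; lra).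
by rewrite !mulr0 subrr.
Qed.

Lemma plane_bounded (f : R * R -> R) (A : R) : continuous f ->
  exists2 C, 0 <= C & forall t x, `|t| <= A -> `|x| <= A -> `|f (t, x)| <= C.
Proof.
move=> cf.
have cK : compact ((`[- A, A] : set R) `*` (`[- A, A] : set R)).
  by apply: compact_setX; exact: segment_compact.
have cfK : compact (f @` ((`[- A, A] : set R) `*` (`[- A, A] : set R))).
  by apply: continuous_compact => //; exact: continuous_subspaceT.
have [M [Mr bM]] := compact_bounded cfK.
exists (`|M| + 1); first by rewrite addr_ge0.
move=> t x tA xA; apply: bM.
  by rewrite (le_lt_trans (ler_norm _))// ltrDl.
exists (t, x) => //; split => /=; rewrite in_itv/=.
  by move: tA; rewrite ler_norml.
by move: xA; rewrite ler_norml.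
Qed.

Lemma near_norm_gt (M x : R) : M < `|x| -> \near x, M < `|x|.
Proof.
have h : (fun y : R => `|y|) @ x --> `|x| by apply: norm_continuous.
by move=> Mx; exact: (cvgr_gt _ h _ Mx).
Qed.

Lemma is_derive_zero (f : R -> R) (M x l : R) : (forall y, M < `|y| -> f y = 0) ->
  M < `|x| -> is_derive x 1 f l -> l = 0.
Proof.
move=> f0 Mx df.
have d0 : is_derive x 1 f 0.
  have h : is_derive x 1 (cst 0 : R -> R) 0 by exact: is_derive_cst.
  apply: near_eq_is_derive h.
  by apply: filterS (near_norm_gt Mx) => y My /=; rewrite f0.
by case: df => _ <-; case: d0 => _ <-.
Qed.

(** [C12K] says only that [G] itself vanishes far away. The derivatives vanish there as well because
    the far region is open, and compactness then bounds all of them by one constant. *)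
Lemma C12K_data (G : R -> R -> R) : C12K G -> exists M C : R,
  [/\ 0 <= M, 0 <= C,
   (forall t x : R, [/\ is_derive t 1 (G ^~ x) (dt G t x), is_derive x 1 (G t) (dx G t x) &
      is_derive x 1 (dx G t) (dx (dx G) t x)]),
   (forall t x : R, M < `|x| -> [/\ G t x = 0, dt G t x = 0, dx G t x = 0 & dx (dx G) t x = 0]) &
   (forall t x : R, [/\ `|G t x| <= C, `|dt G t x| <= C, `|dx G t x| <= C & `|dx (dx G) t x| <= C])].
Proof.
move=> [dG [cG [ct [cx [cxx [M0 M0G]]]]]].
have der (t x : R) : [/\ is_derive t 1 (G ^~ x) (dt G t x), is_derive x 1 (G t) (dx G t x) &
      is_derive x 1 (dx G t) (dx (dx G) t x)].
  have [d1 [d2 d3]] := dG t x.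
  have E1 : 'D_1 (G ^~ x) t = dt G t x by rewrite /dt derive1E.
  have E2 : 'D_1 (G t) x = dx G t x by rewrite /dx derive1E.
  have E3 : 'D_1 (dx G t) x = dx (dx G) t x by rewrite [RHS]/dx derive1E.
  by split; [exact: (DeriveDef d1 E1)|exact: (DeriveDef d2 E2)|exact: (DeriveDef d3 E3)].
pose M := `|M0|.
have MG t x : M < `|t| \/ M < `|x| -> G t x = 0.
  by move=> [h|h]; apply: M0G; [left|right]; exact: le_lt_trans (ler_norm _) h.
have zx (t x : R) : M < `|x| -> [/\ G t x = 0, dt G t x = 0, dx G t x = 0 & dx (dx G) t x = 0].
  move=> Mx; have [e1 e2 e3] := der t x; split.
  - by apply: MG; right.
  - have -> : dt G t x = 0; last by [].
    have <- : 'D_1 (G ^~ x) t = dt G t x by case: e1.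
    have -> : G ^~ x = cst 0 by apply/funext => s; apply: MG; right.
    exact: derive_cst.
  - by apply: (is_derive_zero _ Mx e2) => y My; apply: MG; right.
  - apply: (is_derive_zero _ Mx e3) => y My; have [_ e2' _] := der t y.
    by apply: (is_derive_zero _ My e2') => z Mz; apply: MG; right.
have zt (t x : R) : M < `|t| -> [/\ G t x = 0, dt G t x = 0, dx G t x = 0 & dx (dx G) t x = 0].
  move=> Mt.
  have Gt : G t = cst 0 by apply/funext => y; apply: MG; left.
  have dGt : dx G t = cst 0 by apply/funext => y; rewrite /dx derive1E Gt; exact: derive_cst.
  have [e1 e2 e3] := der t x; split.
  - by apply: MG; left.
  - by apply: (is_derive_zero _ Mt e1) => y My; apply: MG; left.
  - by rewrite dGt.
  - by rewrite /dx derive1E -/(dx G t) dGt derive_cst.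
have bd (f : R -> R -> R) : continuous (fun p : R * R => f p.1 p.2) ->
    (forall t x, M < `|t| \/ M < `|x| -> f t x = 0) ->
    exists2 C, 0 <= C & forall t x, `|f t x| <= C.
  move=> cf f0; have [C C0 fC] := plane_bounded M cf.
  exists C => // t x; have [tM|tM] := leP `|t| M; last by rewrite f0 ?normr0//; left.
  have [xM|xM] := leP `|x| M; last by rewrite f0 ?normr0//; right.
  exact: fC.
have [C1 C10 b1] := bd _ cG MG.
have [C2 C20 b2] : exists2 C, 0 <= C & forall t x, `|dt G t x| <= C.
  by apply: bd => // t x [/zt|/zx]; [move=> /(_ x)[]|move=> /(_ t)[]].
have [C3 C30 b3] : exists2 C, 0 <= C & forall t x, `|dx G t x| <= C.
  by apply: bd => // t x [/zt|/zx]; [move=> /(_ x)[]|move=> /(_ t)[]].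
have [C4 C40 b4] : exists2 C, 0 <= C & forall t x, `|dx (dx G) t x| <= C.
  by apply: bd => // t x [/zt|/zx]; [move=> /(_ x)[]|move=> /(_ t)[]].
exists M, (C1 + C2 + C3 + C4); split; [exact: normr_ge0|lra|exact: der|exact: zx|].
move=> t x; have := b1 t x; have := b2 t x; have := b3 t x; have := b4 t x.
by move=> h4 h3 h2 h1; split; lra.
Qed.

End Real_calculus.

(** * Weak form of an equation with a flux, at positive times *)

Section Weak_form.
Context {R : realType}.
Implicit Types f : R -> R.
Local Notation leb := (@lebesgue_measure R).
Local Notation intg D f := (leb.-integrable D (EFin \o f)).

Local Notation mset D := ((measurable : set (set (measurableTypeR R))) D).

Lemma intgZ (D : set R) (c : R) f : mset D -> intg D f -> intg D (fun x => c * f x).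
Proof. by move=> mD fi; have := integrableZl mD c fi. Qed.

Lemma intgD (D : set R) f g : mset D -> intg D f -> intg D g -> intg D (fun x => f x + g x).
Proof. by move=> mD fi gi; have := integrableD mD fi gi. Qed.

Lemma intgB (D : set R) f g : mset D -> intg D f -> intg D g -> intg D (fun x => f x - g x).
Proof. by move=> mD fi gi; have := integrableB mD fi gi. Qed.

Lemma RintD (D : set R) f g : mset D -> intg D f -> intg D g ->
  Rint D (fun x => f x + g x) = Rint D f + Rint D g.
Proof. by move=> mD fi gi; rewrite /Defs.Rint RintegralD. Qed.

Lemma RintB (D : set R) f g : mset D -> intg D f -> intg D g ->
  Rint D (fun x => f x - g x) = Rint D f - Rint D g.
Proof. by move=> mD fi gi; rewrite /Defs.Rint RintegralB. Qed.

Lemma RintZ (D : set R) (c : R) f : mset D -> intg D f ->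
  Rint D (fun x => c * f x) = c * Rint D f.
Proof. by move=> mD fi; rewrite /Defs.Rint RintegralZl. Qed.

Lemma Rint_mkind (D : set R) f : Rint D f = Rint setT (fun x => f x * \1_D x).
Proof.
rewrite /Defs.Rint Rintegral_mkcond; congr Rintegral; apply/funext => x.
by rewrite patchE indicE; case: ifP => _; rewrite ?mulr1 ?mulr0.
Qed.

Lemma Rint_eq (D : set R) f g : (forall x, D x -> f x = g x) -> Rint D f = Rint D g.
Proof. by move=> fg; apply: eq_Rintegral => x /set_mem; exact: fg. Qed.

Lemma supp_indic (M x : R) : ~ M < `|x| -> \1_(`[- M, M] : set R) x = 1 :> R.
Proof.
move=> /negP; rewrite -leNgt ler_norml => h.
by rewrite indicE mem_set//= in_itv.
Qed.

Lemma csupp_box f (M : R) : continuous f -> (forall x, M < `|x| -> f x = 0) ->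
  exists2 C, 0 <= C & forall x, `|f x| <= C * \1_(`[- M, M] : set R) x.
Proof.
move=> cf f0.
have c2 : continuous (fun p : R * R => f p.2).
  by move=> p; apply: (continuous_comp (f := snd)); [exact: cvg_snd|exact: cf].
have [C C0 fC] := plane_bounded `|M| c2.
exists C => // x; have [xM|/negP xM] := boolP (M < `|x|).
  by rewrite f0// normr0 mulr_ge0// indicE.
rewrite supp_indic// mulr1; apply: (fC 0); first by rewrite normr0.
by move/negP: xM; rewrite -leNgt => h; exact: le_trans h (ler_norm _).
Qed.

Lemma intg_csupp f (M : R) : continuous f -> (forall x, M < `|x| -> f x = 0) ->
  intg setT f.
Proof.
move=> cf f0; have [C _ fC] := csupp_box cf f0.
exact: (intg_box (continuous_Rmeas cf) fC).
Qed.

Lemma pair_cont (X : topologicalType) (f g : X -> R) (x : X) :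
  {for x, continuous f} -> {for x, continuous g} ->
  {for x, continuous (fun y => (f y, g y))}.
Proof. by move=> cf cg; exact: (cvg_pair cf cg). Qed.

Lemma plane_section1 (f : R * R -> R) (t x : R) :
  {for (t, x), continuous f} -> {for x, continuous (fun y => f (t, y))}.
Proof.
move=> cf; apply: (continuous_comp (f := fun y => (t, y))); last exact: cf.
by apply: pair_cont; [exact: cvg_cst|exact: cvg_id].
Qed.

Lemma plane_section2 (f : R * R -> R) (t x : R) :
  {for (t, x), continuous f} -> {for t, continuous (fun s => f (s, x))}.
Proof.
move=> cf; apply: (continuous_comp (f := fun s => (s, x))); last exact: cf.
by apply: pair_cont; [exact: cvg_id|exact: cvg_cst].
Qed.

(* [F] is the flux of [p]: the pair solves [p_t = p_xx / 2 - F_x]. *)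
Lemma weak_form_gen (p pt px pxx F Fx G Gt Gx Gxx : R -> R -> R) (M e T : R) :
  (forall t x : R, 0 < t -> is_derive t 1 (p ^~ x) (pt t x)) ->
  (forall t x : R, 0 < t -> is_derive x 1 (p t) (px t x)) ->
  (forall t x : R, 0 < t -> is_derive x 1 (px t) (pxx t x)) ->
  (forall t x : R, 0 < t -> is_derive x 1 (F t) (Fx t x)) ->
  (forall t x : R, 0 < t -> {for (t, x), continuous (fun q : R * R => p q.1 q.2)}) ->
  (forall t x : R, 0 < t -> {for (t, x), continuous (fun q : R * R => pt q.1 q.2)}) ->
  (forall t, 0 < t -> continuous (pxx t)) ->
  (forall t, 0 < t -> continuous (Fx t)) ->
  (forall t x, 0 < t -> pt t x = 2^-1 * pxx t x - Fx t x) ->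
  (forall t x : R, is_derive t 1 (G ^~ x) (Gt t x)) ->
  (forall t x : R, is_derive x 1 (G t) (Gx t x)) ->
  (forall t x : R, is_derive x 1 (Gx t) (Gxx t x)) ->
  continuous (fun q : R * R => G q.1 q.2) -> continuous (fun q : R * R => Gt q.1 q.2) ->
  continuous (fun q : R * R => Gx q.1 q.2) -> continuous (fun q : R * R => Gxx q.1 q.2) ->
  (forall t x, M < `|x| -> [/\ G t x = 0, Gt t x = 0, Gx t x = 0 & Gxx t x = 0]) ->
  0 <= M -> 0 < e -> e <= T ->
  Rint setT (fun x => p T x * G T x) - Rint setT (fun x => p e x * G e x) =
  Rint `[e, T] (fun t => Rint setT (fun x => p t x * (Gt t x + 2^-1 * Gxx t x) + F t x * Gx t x)).
Proof.
move=> dp1 dp2 dp3 dF cp cpt cpxx cFx pde dG1 dG2 dG3 cG cGt cGx cGxx zx M0 e0 eT.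
have T0 : 0 < T by exact: lt_le_trans eT.
(* [k] is the time derivative of [p G]. The data are regular only for positive times, so the time is
   clipped from below at [e] to make [k] continuous on the whole plane. *)
pose k (q : R * R) := pt (Num.max e q.1) q.2 * G q.1 q.2 + p (Num.max e q.1) q.2 * Gt q.1 q.2.
have cmax : continuous (fun q : R * R => (Num.max e q.1, q.2)).
  move=> q; apply: (@pair_cont _ (fun q : R * R => Num.max e q.1) (fun q : R * R => q.2)); last exact: cvg_snd.
  apply: (continuous_comp (f := fst) (g := fun s : R => Num.max e s)); first exact: cvg_fst.
  by apply: continuous_max; [exact: cst_continuous|move=> ?; exact: cvg_id].
have ck : continuous k.
  move=> q.
  have m0 : 0 < Num.max e q.1 by rewrite lt_max e0.
  apply: cvgD; apply: cvgM.
  - apply: (continuous_comp (f := fun q : R * R => (Num.max e q.1, q.2))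
      (g := fun q : R * R => pt q.1 q.2)); first exact: cmax.
    exact: cpt.
  - exact: cG.
  - apply: (continuous_comp (f := fun q : R * R => (Num.max e q.1, q.2))
      (g := fun q : R * R => p q.1 q.2)); first exact: cmax.
    exact: cp.
  - exact: cGt.
have kz t x : M < `|x| -> k (t, x) = 0.
  by move=> Mx; rewrite /k/=; have [-> -> _ _] := zx t x Mx; rewrite !mulr0 addr0.
have [C' C'0 kC] := plane_bounded (M + T) ck.
(* The indicator turns the time integral into one over the whole line, so that [Rint_swap] applies;
   each order of integration gives one side of the claim. *)
pose f (x t : R) := k (t, x) * \1_(`[e, T] : set R) t.
have bf x t : `|f x t| <= (C' * \1_(`[- M, M] : set R) x) * \1_(`[e, T] : set R) t.
  rewrite /f normrM (@ger0_norm _ (\1_(`[e, T] : set R) t)); last by rewrite indicE.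
  have [tT|tT] := boolP (e <= t <= T); last first.
    have -> : \1_(`[e, T] : set R) t = 0 :> R.
      by rewrite indicE memNset//= in_itv/=; exact/negP.
    by rewrite !mulr0.
  apply: ler_wpM2r; first by rewrite indicE.
  have [xM|/negP xM] := boolP (M < `|x|).
    by rewrite kz// normr0 mulr_ge0// indicE.
  rewrite supp_indic// mulr1; apply: kC.
    by rewrite ger0_norm; move/andP: tT => [? ?]; lra.
  by move/negP: xM; rewrite -leNgt => h; lra.
have mf : measurable_fun setT (fun q : R * R => f q.1 q.2).
  apply: measurable_funM.
    apply: continuous_plane_measurable => q.
    apply: (continuous_comp (f := fun q : R * R => (q.2, q.1))); last exact: ck.
    by apply: (@pair_cont _ (fun q : R * R => q.2) (fun q : R * R => q.1)); [exact: cvg_snd|exact: cvg_fst].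
  have m1 : measurable_fun setT (\1_(`[e, T] : set R) : R -> R) by exact: measurable_indic.
  exact: (measurableT_comp m1 measurable_snd).
have [] := @Rint_swap _ f _ (fun x => C' * (T - e) * \1_(`[- M, M] : set R) x) mf bf.
- by move=> x; exact: intg_indic.
- move=> x; rewrite Rint_indic//; by rewrite le_eqVlt; apply/orP; left; apply/eqP; ring.
- exact: intg_indic.
- move=> t; apply: (@intg_box _ _ (- M) M C').
    exact: (measurableT_comp mf (pair2_measurable t)).
  move=> x; apply: le_trans (bf x t) _; rewrite -[leRHS]mulr1.
  apply: ler_wpM2l; first by rewrite mulr_ge0// indicE.
  by rewrite indicE; case: (_ \in _).
move=> _.
have kE t x : e <= t -> k (t, x) = pt t x * G t x + p t x * Gt t x.
  by move=> et; rewrite /k/= max_r.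
(* With time inside, the integrand is the derivative of [p G], which gives the two boundary
   terms. *)
have -> : (fun x => Rint setT (f x)) = (fun x => p T x * G T x - p e x * G e x).
  apply/funext => x; rewrite -Rint_mkind.
  have dk (t : R) : e <= t <= T -> is_derive t 1 (fun s => p s x * G s x) (k (t, x)).
    move=> /andP[et _]; rewrite kE//; have t0 : 0 < t by exact: lt_le_trans et.
    exact: (is_derive_mul (dp1 t x t0) (dG1 t x)).
  apply: (@Rint_FTC _ _ (fun s => p s x * G s x) _ _ eT _ dk).
  move=> t _; apply: (plane_section2 (f := k)); exact: ck.
have cpx t : 0 < t -> continuous (p t) by move=> t0 x; exact: is_derive_cont (dp2 t x t0).
have cpxx' t : 0 < t -> continuous (px t) by move=> t0 x; exact: is_derive_cont (dp3 t x t0).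
have cF t : 0 < t -> continuous (F t) by move=> t0 x; exact: is_derive_cont (dF t x t0).
have sG t : continuous (G t).
  by move=> x; apply: (@plane_section1 (fun q => G q.1 q.2) t x (cG (t, x))).
have sGt t : continuous (Gt t).
  by move=> x; apply: (@plane_section1 (fun q => Gt q.1 q.2) t x (cGt (t, x))).
have sGx t : continuous (Gx t).
  by move=> x; apply: (@plane_section1 (fun q => Gx q.1 q.2) t x (cGx (t, x))).
have sGxx t : continuous (Gxx t).
  by move=> x; apply: (@plane_section1 (fun q => Gxx q.1 q.2) t x (cGxx (t, x))).
have iM (u v : R -> R) : continuous u -> continuous v -> (forall x, M < `|x| -> v x = 0) ->
    intg setT (fun x => u x * v x).
  move=> cu cv v0; apply: (@intg_csupp _ M) => [x|x /v0 ->]; last by rewrite mulr0.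
  by apply: cvgM; [exact: cu|exact: cv].
have zG t x : M < `|x| -> G t x = 0 by move=> /(zx t) [].
have zGt t x : M < `|x| -> Gt t x = 0 by move=> /(zx t) [].
have zGx t x : M < `|x| -> Gx t x = 0 by move=> /(zx t) [].
have zGxx t x : M < `|x| -> Gxx t x = 0 by move=> /(zx t) [].
rewrite RintB//; last 2 first.
- by apply: iM; [exact: cpx|exact: sG|exact: zG].
- by apply: iM; [exact: cpx|exact: sG|exact: zG].
move=> ->.
rewrite [RHS]Rint_mkind; apply: Rint_eq => t _.
have [tT|tT] := boolP (e <= t <= T); last first.
  have i0 : \1_(`[e, T] : set R) t = 0 :> R by rewrite indicE memNset//= in_itv/=; exact/negP.
  rewrite i0 mulr0; rewrite (@Rint_eq _ _ (cst 0)); last by move=> x _; rewrite /f i0 mulr0.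
  by rewrite /Defs.Rint Rintegral_cst// mul0r.
have i1 : \1_(`[e, T] : set R) t = 1 :> R by rewrite indicE mem_set//= in_itv/=.
move/andP: tT => [et tT]; have t0 : 0 < t by exact: lt_le_trans et.
rewrite i1 mulr1.
(* With space inside, the equation replaces [pt], and the space derivatives move to [G]: two
   integrations by parts for [pxx], one for [Fx]. *)
rewrite (@Rint_eq _ _ (fun x => (2^-1 * (pxx t x * G t x) + p t x * Gt t x) - Fx t x * G t x)); last first.
  by move=> x _; rewrite /f i1 mulr1 kE// pde//; ring.
have I1 : intg setT (fun x => pxx t x * G t x) by apply: iM; [exact: cpxx|exact: sG|exact: zG].
have I2 : intg setT (fun x => p t x * Gt t x) by apply: iM; [exact: cpx|exact: sGt|exact: zGt].
have I3 : intg setT (fun x => Fx t x * G t x) by apply: iM; [exact: cFx|exact: sG|exact: zG].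
have I4 : intg setT (fun x => p t x * Gxx t x) by apply: iM; [exact: cpx|exact: sGxx|exact: zGxx].
have I5 : intg setT (fun x => F t x * Gx t x) by apply: iM; [exact: cF|exact: sGx|exact: zGx].
have I1' : intg setT (fun x => 2^-1 * (pxx t x * G t x)).
  exact: intgZ.
have I4' : intg setT (fun x => 2^-1 * (p t x * Gxx t x)).
  exact: intgZ.
have I12 : intg setT (fun x => 2^-1 * (pxx t x * G t x) + p t x * Gt t x).
  exact: (intgD measurableT I1' I2).
have I24 : intg setT (fun x => 2^-1 * (p t x * Gxx t x) + p t x * Gt t x).
  exact: (intgD measurableT I4' I2).
rewrite (RintB measurableT I12 I3) (RintD measurableT I1' I2) (RintZ _ measurableT I1).
rewrite (@Rint_eq _ (fun x => p t x * (Gt t x + 2^-1 * Gxx t x) + F t x * Gx t x)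
  (fun x => (2^-1 * (p t x * Gxx t x) + p t x * Gt t x) + F t x * Gx t x)); last first.
  by move=> x _; ring.
rewrite (RintD measurableT I24 I5) (RintD measurableT I4' I2) (RintZ _ measurableT I4).
have P1 : Rint setT (fun x => pxx t x * G t x) = - Rint setT (fun x => px t x * Gx t x).
  apply: (@Rint_parts R (px t) (G t) (pxx t) (Gx t) M M0).
  - by move=> x; exact: dp3.
  - exact: cpxx.
  - exact: sGx.
  - by move=> x Mx; rewrite zG// zGx.
have P2 : Rint setT (fun x => px t x * Gx t x) = - Rint setT (fun x => p t x * Gxx t x).
  apply: (@Rint_parts R (p t) (Gx t) (px t) (Gxx t) M M0).
  - by move=> x; exact: dp2.
  - exact: cpxx'.
  - exact: sGxx.
  - by move=> x Mx; rewrite zGx// zGxx.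
have P3 : Rint setT (fun x => Fx t x * G t x) = - Rint setT (fun x => F t x * Gx t x).
  apply: (@Rint_parts R (F t) (G t) (Fx t) (Gx t) M M0).
  - by move=> x; exact: dF.
  - exact: cFx.
  - exact: sGx.
  - by move=> x Mx; rewrite zG// zGx.
rewrite P1 P2 P3; ring.
Qed.

(** The backward heat operator applied to [G], convertible with the expression that occurs in
    [lfun]. *)
Definition hh (G : R -> R -> R) (t x : R) : R := dt G t x + 2^-1 * dx (dx G) t x.

Lemma weak_form (p pt px pxx F Fx G : R -> R -> R) (e T : R) :
  (forall t x : R, 0 < t -> is_derive t 1 (p ^~ x) (pt t x)) ->
  (forall t x : R, 0 < t -> is_derive x 1 (p t) (px t x)) ->
  (forall t x : R, 0 < t -> is_derive x 1 (px t) (pxx t x)) ->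
  (forall t x : R, 0 < t -> is_derive x 1 (F t) (Fx t x)) ->
  (forall t x : R, 0 < t -> {for (t, x), continuous (fun q : R * R => p q.1 q.2)}) ->
  (forall t x : R, 0 < t -> {for (t, x), continuous (fun q : R * R => pt q.1 q.2)}) ->
  (forall t, 0 < t -> continuous (pxx t)) ->
  (forall t, 0 < t -> continuous (Fx t)) ->
  (forall t x, 0 < t -> pt t x = 2^-1 * pxx t x - Fx t x) ->
  C12K G -> 0 < e -> e <= T ->
  Rint setT (fun x => p T x * G T x) - Rint setT (fun x => p e x * G e x) =
  Rint `[e, T] (fun t => Rint setT (fun x => p t x * hh G t x + F t x * dx G t x)).
Proof.
move=> dp1 dp2 dp3 dF cp cpt cpxx cFx pde CG e0 eT.
have [M [C [M0 _ der zx _]]] := C12K_data CG.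
have [_ [cG [cGt [cGx [cGxx _]]]]] := CG.
apply: (@weak_form_gen p pt px pxx F Fx G (dt G) (dx G) (dx (dx G)) M e T
  dp1 dp2 dp3 dF cp cpt cpxx cFx pde _ _ _ cG cGt cGx cGxx zx M0 e0 eT).
- by move=> t x; have [] := der t x.
- by move=> t x; have [] := der t x.
- by move=> t x; have [] := der t x.
Qed.

End Weak_form.

(** * The heat flow *)

Section Heat_kernel.
Context {R : realType}.
Implicit Types f g : R -> R.
Local Notation leb := (@lebesgue_measure R).
Local Notation intg D f := (leb.-integrable D (EFin \o f)).
Local Notation mset D := ((measurable : set (set (measurableTypeR R))) D).

Lemma sigma_ge0 (t y : R) : 0 <= sigma t y.
Proof. by rewrite /sigma mulr_ge0// ?invr_ge0 ?sqrtr_ge0// expR_ge0. Qed.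

Lemma sigma_sym (t x y : R) : sigma t (x - y) = sigma t (y - x).
Proof. by rewrite /sigma -sqrrN opprB. Qed.

Lemma norm_cst_gt0 (t : R) : 0 < t -> 0 < 2 * pi * t.
Proof. by move=> t0; rewrite !mulr_gt0// pi_gt0. Qed.

Lemma sigma_normal (t x y : R) : 0 < t -> sigma t (x - y) = normal_pdf x (Num.sqrt t) y.
Proof.
move=> t0; rewrite normal_pdfE ?gt_eqF ?sqrtr_gt0// /sigma /normal_peak /normal_fun.
rewrite sqr_sqrtr ?ltW//; congr (_^-1 * expR _).
  by congr Num.sqrt; rewrite -mulr_natl; ring.
by rewrite -(mulr_natl t 2); congr (_ / _); ring.
Qed.

Lemma intg_sigma (t x : R) : 0 < t -> intg setT (fun y => sigma t (x - y)).
Proof.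
move=> t0; have := integrable_normal_pdf x (Num.sqrt t).
by congr (_.-integrable _ _); apply/funext => y /=; rewrite sigma_normal.
Qed.

Lemma Rint_sigma (t x : R) : 0 < t -> Rint setT (fun y => sigma t (x - y)) = 1.
Proof.
move=> t0; rewrite /Defs.Rint /Rintegral.
under eq_integral do rewrite sigma_normal//.
by rewrite integral_normal_pdf.
Qed.

Lemma intg_sigma' (t y : R) : 0 < t -> intg setT (fun x => sigma t (x - y)).
Proof.
by move=> t0; under eq_fun do rewrite sigma_sym; exact: intg_sigma.
Qed.

Lemma Rint_sigma' (t y : R) : 0 < t -> Rint setT (fun x => sigma t (x - y)) = 1.
Proof.
by move=> t0; under eq_fun do rewrite sigma_sym; exact: Rint_sigma.
Qed.

Lemma sigma_dx (t y : R) : 0 < t -> is_derive y 1 (sigma t) (- (y / t) * sigma t y).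
Proof.
move=> t0; rewrite /sigma; apply: is_derive_eq; rewrite /GRing.scale/=.
have tn : t != 0 by rewrite gt_eqF.
have sn : Num.sqrt (2 * pi * t) != 0 by rewrite gt_eqF// sqrtr_gt0 norm_cst_gt0.
by field; rewrite ?tn ?sn.
Qed.

Lemma sigma_dxx (t y : R) : 0 < t ->
  is_derive y 1 (fun y => - (y / t) * sigma t y) ((y ^+ 2 / t ^+ 2 - t^-1) * sigma t y).
Proof.
move=> t0; have h := sigma_dx y t0.
have h2 : is_derive y 1 (fun y => - (y / t)) (- t^-1).
  by apply: is_derive_eq; rewrite /GRing.scale/=; ring.
apply: is_derive_eq (is_derive_mul h2 h) _; by field; rewrite gt_eqF.
Qed.

Lemma sigma_dt (t y : R) : 0 < t ->
  is_derive t 1 (fun s => sigma s y) (2^-1 * ((y ^+ 2 / t ^+ 2 - t^-1) * sigma t y)).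
Proof.
move=> t0; have c0 := norm_cst_gt0 t0.
have s0 : Num.sqrt (2 * pi * t) != 0 by rewrite gt_eqF// sqrtr_gt0.
have h1 : is_derive t 1 (fun s => 2 * pi * s) (2 * pi).
  by apply: is_derive_eq; rewrite /GRing.scale/=; ring.
have h2 : is_derive t 1 (fun s => Num.sqrt (2 * pi * s)) ((2 * Num.sqrt (2 * pi * t))^-1 * (2 * pi)).
  exact: (is_derive1_comp (is_derive1_sqrt c0) h1).
have h3 := @is_deriveV R (fun s => Num.sqrt (2 * pi * s)) t _ 1 s0 h2.
have t2 : (2 * t) != 0 by rewrite gt_eqF// mulr_gt0.
have h4 : is_derive t 1 (fun s : R => 2 * s) 2.
  by apply: is_derive_eq; rewrite /GRing.scale/=; ring.
have h5 := @is_deriveV R (fun s => 2 * s) t _ 1 t2 h4.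
have h6 : is_derive t 1 (fun s => - (y ^+ 2) / (2 * s)) (- (y ^+ 2) * (- (2 * t) ^- 2 * 2)).
  have := @is_deriveZ R R R (fun s => (2 * s)^-1) (- (y ^+ 2)) t 1 _ h5; rewrite /GRing.scale/= => h; exact: h.
have h7 := @is_derive1_comp R expR (fun s => - (y ^+ 2) / (2 * s)) t _ _ (is_derive_expR _) h6.
have h8 := @is_derive_mul R (fun s => (Num.sqrt (2 * pi * s))^-1) (fun s => expR (- (y ^+ 2) / (2 * s))) t _ _ h3 h7.
apply: is_derive_eq h8 _; rewrite /GRing.scale/= /sigma.
have E : Num.sqrt (2 * pi * t) ^+ 2 = 2 * pi * t by rewrite sqr_sqrtr// ltW.
have pi0 : (pi : R) != 0 by rewrite gt_eqF// pi_gt0.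
have tn : t != 0 by rewrite gt_eqF.
set s := Num.sqrt (2 * pi * t) in s0 E *.
(* Eliminating [2 * pi] in favour of the square root [s] leaves a rational identity in [s] and
   [t]. *)
have pE : 2 * pi = s ^+ 2 / t by rewrite E; field.
by rewrite pE; field; rewrite ?tn ?s0.
Qed.

Lemma sigma_cont (t y : R) : 0 < t -> {for (t, y), continuous (fun q : R * R => sigma q.1 q.2)}.
Proof.
move=> t0.
have c1 : {for (t, y), continuous (fun q : R * R => q.1)} by exact: cvg_fst.
have c2 : {for (t, y), continuous (fun q : R * R => q.2)} by exact: cvg_snd.
apply: cvgM.
  apply: cvgV; first by rewrite gt_eqF// sqrtr_gt0 norm_cst_gt0.
  apply: (continuous_comp (f := fun q : R * R => 2 * pi * q.1) (g := Num.sqrt)); last exact: sqrt_continuous.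
  by apply: cvgM; [exact: cvg_cst|exact: c1].
apply: (continuous_comp (f := fun q : R * R => - (q.2 ^+ 2) / (2 * q.1)) (g := expR)); last exact: continuous_expR.
apply: cvgM; first by apply: cvgN; apply: cvgM; exact: c2.
apply: cvgV; first by rewrite gt_eqF// mulr_gt0.
by apply: cvgM; [exact: cvg_cst|exact: c1].
Qed.

(** Inverses are written as real powers with exponent -1, which are measurable. These agree with
    inverses on nonnegative numbers only, hence the clipping at 0; it is harmless because for
    [t <= 0] the square root and its inverse are 0 and both sides vanish. *)
Lemma measurable_sigma : measurable_fun setT (fun q : R * R => sigma q.1 q.2).
Proof.
have -> : (fun q : R * R => sigma q.1 q.2) =
  (fun q => (Num.sqrt (2 * pi * q.1) `^ (-1)) * expR (- (q.2 ^+ 2) * (Num.max 0 (2 * q.1)) `^ (-1))).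
  apply/funext => -[t y] /=; rewrite /sigma powR_inv1 ?sqrtr_ge0//.
  rewrite powR_inv1 ?le_max ?lexx//.
  have [t0|t0] := leP t 0; last by rewrite max_r// mulr_ge0// ltW.
  have -> : Num.sqrt (2 * pi * t) = 0.
    by rewrite ler0_sqrtr// mulr_ge0_le0// mulr_ge0// pi_ge0.
  by rewrite invr0 !mul0r.
have mp : measurable_fun setT (fun x : R => x `^ (-1)) by exact: measurable_powR.
apply: measurable_funM.
  apply: (measurableT_comp mp).
  apply: continuous_plane_measurable => q.
  apply: (continuous_comp (f := fun q : R * R => 2 * pi * q.1) (g := Num.sqrt)); last exact: sqrt_continuous.
  by apply: cvgM; [exact: cvg_cst|exact: cvg_fst].
apply: (measurableT_comp (f := expR)); first exact: measurable_expR.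
apply: measurable_funM.
  apply: continuous_plane_measurable => q.
  by apply: cvgN; apply: cvgM; exact: cvg_snd.
apply: (measurableT_comp mp); apply: measurable_maxr; first exact: measurable_cst.
apply: measurable_funM; first exact: measurable_cst.
exact: measurable_fst.
Qed.

(** Half of the Gaussian exponent is kept as decay and the other half is the kernel at time [2 t];
    the normalizations differ by the factor [sqrt 2 <= 2]. *)
Lemma sigma_split (t z : R) : 0 < t -> sigma t z <= 2 * (expR (- (z ^+ 2) / (4 * t)) * sigma (2 * t) z).
Proof.
move=> t0; rewrite /sigma.
have -> : expR (- z ^+ 2 / (2 * t)) = expR (- z ^+ 2 / (4 * t)) * expR (- z ^+ 2 / (2 * (2 * t))).
  by rewrite -expRD; congr expR; field; rewrite gt_eqF.
set E1 := expR _; set E2 := expR _.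
have -> : 2 * (E1 * ((Num.sqrt (2 * pi * (2 * t)))^-1 * E2)) =
  (2 * (Num.sqrt (2 * pi * (2 * t)))^-1) * (E1 * E2) by ring.
apply: ler_wpM2r; first by rewrite mulr_ge0// expR_ge0.
have c0 := norm_cst_gt0 t0.
have c1 : 0 < 2 * pi * (2 * t) by apply: norm_cst_gt0; rewrite mulr_gt0.
rewrite -[leLHS]mul1r ler_pdivrMr ?sqrtr_gt0// mulrAC ler_pdivlMr ?sqrtr_gt0// mul1r.
have s4 : Num.sqrt 4 = 2 :> R by rewrite (_ : 4 = 2 ^+ 2) ?sqrtr_sqr ?ger0_norm//; ring.
have -> : 2 * Num.sqrt (2 * pi * t) = Num.sqrt (4 * (2 * pi * t)) by rewrite (@sqrtrM _ 4)// s4.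
by rewrite ler_sqrt; lra.
Qed.

(** With [w = z^2 / (4 t)], the decay factor of [sigma_split] absorbs [z^2] because
    [w exp (- w) <= 1]. *)
Lemma sigma_second_moment (t z : R) : 0 < t -> z ^+ 2 * sigma t z <= 8 * t * sigma (2 * t) z.
Proof.
move=> t0; have := sigma_split z t0; have s0 := sigma_ge0 (2 * t) z.
set w := z ^+ 2 / (4 * t).
have -> : - z ^+ 2 / (4 * t) = - w by rewrite mulNr.
have zw : z ^+ 2 = 4 * t * w by rewrite /w; field; rewrite gt_eqF.
have w0 : 0 <= w by rewrite divr_ge0 ?sqr_ge0// mulr_ge0// ltW.
have ew : w * expR (- w) <= 1.
  by rewrite expRN ler_pdivrMr ?expR_gt0// mul1r; have := expR_ge1Dx w; lra.
move=> h; apply: (@le_trans _ _ (z ^+ 2 * (2 * (expR (- w) * sigma (2 * t) z)))).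
  by apply: ler_wpM2l => //; exact: sqr_ge0.
rewrite zw; have -> : 4 * t * w * (2 * (expR (- w) * sigma (2 * t) z)) =
  (8 * t * sigma (2 * t) z) * (w * expR (- w)) by ring.
by rewrite -[leRHS]mulr1; apply: ler_wpM2l => //; rewrite !mulr_ge0// ltW.
Qed.

(* Gaussian tail: [(x - y)^2 >= (x - b)^2 + (b - y)^2] when [b] separates [x] and [y]. *)
Lemma sigma_tail (t x y b : R) : 0 < t -> 0 <= (x - b) * (b - y) ->
  sigma t (x - y) <= expR (- ((x - b) ^+ 2) / (2 * t)) * sigma t (b - y).
Proof.
move=> t0 h; rewrite /sigma mulrCA; apply: ler_wpM2l.
  by rewrite invr_ge0 sqrtr_ge0.
rewrite -expRD ler_expR -mulrDl; apply: ler_wpM2r; first by rewrite invr_ge0 mulr_ge0// ltW.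
have -> : (x - y) ^+ 2 = (x - b) ^+ 2 + (b - y) ^+ 2 + 2 * ((x - b) * (b - y)) by ring.
lra.
Qed.

Lemma sigma_expR (t z : R) : 0 < t ->
  expR (- (z ^+ 2) / (2 * t)) = Num.sqrt (2 * pi * t) * sigma t z.
Proof.
by move=> t0; rewrite /sigma mulrA divff ?mul1r// gt_eqF// sqrtr_gt0 norm_cst_gt0.
Qed.

(** The kernel started at [y] solves the heat equation with zero flux; [e > 0] stays away from its
    singularity at time 0. *)
Lemma sigma_weak (G : R -> R -> R) (y e T : R) : C12K G -> 0 < e -> e <= T ->
  Rint setT (fun x => sigma T (x - y) * G T x) - Rint setT (fun x => sigma e (x - y) * G e x) =
  Rint `[e, T] (fun t => Rint setT (fun x => sigma t (x - y) * hh G t x)).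
Proof.
move=> CG e0 eT.
have sh (f : R -> R) (x l : R) : is_derive (x - y) 1 f l -> is_derive x 1 (fun x => f (x - y)) l.
  move=> h; have h2 : is_derive x 1 (fun x => x - y) 1.
    by apply: is_derive_eq; rewrite subr0.
  by have := @is_derive1_comp R f (fun x => x - y) x l 1 h h2; rewrite mulr1.
have shc (f : R -> R -> R) : (forall t x : R, 0 < t -> {for (t, x), continuous (fun q : R * R => f q.1 q.2)}) ->
    forall t x : R, 0 < t -> {for (t, x), continuous (fun q : R * R => f q.1 (q.2 - y))}.
  move=> cf t x t0.
  apply: (continuous_comp (f := fun q : R * R => (q.1, q.2 - y)) (g := fun q : R * R => f q.1 q.2)); last exact: cf.
  apply: (@pair_cont _ _ (fun q : R * R => q.1) (fun q : R * R => q.2 - y)); first exact: cvg_fst.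
  by apply: cvgB; [exact: cvg_snd|exact: cvg_cst].
pose D2 t z := (z ^+ 2 / t ^+ 2 - t^-1) * sigma t z : R.
have cD2 (t x : R) : 0 < t -> {for (t, x), continuous (fun q : R * R => D2 q.1 q.2)}.
  move=> t0; apply: cvgM; last exact: sigma_cont.
  have c1 : {for (t, x), continuous (fun q : R * R => q.1)} by exact: cvg_fst.
  have c2 : {for (t, x), continuous (fun q : R * R => q.2)} by exact: cvg_snd.
  apply: cvgB; last by apply: cvgV; [rewrite gt_eqF|exact: c1].
  apply: cvgM; first by apply: cvgM; exact: c2.
  apply: cvgV; first by rewrite gt_eqF// exprn_gt0.
  by apply: cvgM; exact: c1.
have d1 (t x : R) : 0 < t -> is_derive t 1 (fun s => sigma s (x - y)) (2^-1 * D2 t (x - y)).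
  by move=> t0; exact: sigma_dt.
have d2 (t x : R) : 0 < t -> is_derive x 1 (fun x => sigma t (x - y)) (- ((x - y) / t) * sigma t (x - y)).
  by move=> t0; apply: sh; exact: sigma_dx.
have d3 (t x : R) : 0 < t -> is_derive x 1 (fun x => - ((x - y) / t) * sigma t (x - y)) (D2 t (x - y)).
  by move=> t0; apply: (sh (fun z => - (z / t) * sigma t z)); exact: sigma_dxx.
have d4 (t x : R) : 0 < t -> is_derive x 1 ((fun _ _ => 0 : R) t : R -> R) 0.
  by move=> t0; exact: is_derive_cst.
have cs : forall t x : R, 0 < t -> {for (t, x), continuous (fun q : R * R => sigma q.1 (q.2 - y))}.
  by apply: (shc sigma) => t x t0; exact: sigma_cont.
have cs2 : forall t x : R, 0 < t -> {for (t, x), continuous (fun q : R * R => 2^-1 * D2 q.1 (q.2 - y))}.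
  apply: (shc (fun t z => 2^-1 * D2 t z)) => t x t0.
  by apply: cvgM; [exact: cvg_cst|exact: cD2].
have cs3 (t : R) : 0 < t -> continuous (fun x => D2 t (x - y)).
  move=> t0 x; exact: (plane_section1 (shc _ cD2 t x t0)).
have W := @weak_form R (fun t x => sigma t (x - y)) (fun t x => 2^-1 * D2 t (x - y))
  (fun t x => - ((x - y) / t) * sigma t (x - y)) (fun t x => D2 t (x - y))
  (fun _ _ => 0) (fun _ _ => 0) G e T d1 d2 d3 d4 cs cs2 cs3 _ _ CG e0 eT.
apply: etrans (W _ _) _.
- by move=> t t0 x; exact: cvg_cst.
- by move=> t x t0; rewrite subr0.
- apply: Rint_eq => t _; apply: Rint_eq => x _; by rewrite mul0r addr0.
Qed.

End Heat_kernel.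

Section Heat_flow.
Context {R : realType}.
Implicit Types f g : R -> R.
Local Notation leb := (@lebesgue_measure R).
Local Notation intg D f := (leb.-integrable D (EFin \o f)).
Local Notation mset D := ((measurable : set (set (measurableTypeR R))) D).

(** The flow including its initial value: [heat 0 g] is not [g] but 0, since the normalization of
    [sigma 0] is the inverse of 0. *)
Definition rho g (t x : R) : R := if t <= 0 then g x else heat t g x.

Lemma measurable_sigma_sub (t x : R) : measurable_fun setT (fun y : R => sigma t (x - y)).
Proof.
have h : measurable_fun setT (fun y : R => (t, x - y)).
  apply: measurable_fun_pair; first exact: measurable_cst.
  by apply: measurable_funB; [exact: measurable_cst|exact: measurable_id].
exact: (measurableT_comp measurable_sigma h).
Qed.

Lemma intg_sigma_mul f (t x c : R) : 0 < t -> measurable_fun setT f ->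
  (forall y, `|f y| <= c) -> intg setT (fun y => sigma t (x - y) * f y).
Proof.
move=> t0 mf fc.
apply: (@intg_dom _ _ _ (fun y => c * sigma t (x - y))) => //.
- by apply: measurable_funM => //; exact: measurable_sigma_sub.
- exact: intgZ (intg_sigma x t0).
- move=> y _; rewrite normrM (ger0_norm (sigma_ge0 _ _)) mulrC.
  by apply: ler_wpM2r; [exact: sigma_ge0|exact: fc].
Qed.

Lemma Rint_sigma_le f (t x c : R) : 0 < t -> (forall y, `|f y| <= c) ->
  `|Rint setT (fun y => sigma t (x - y) * f y)| <= c.
Proof.
move=> t0 fc.
have -> : c = Rint setT (fun y => c * sigma t (x - y)).
  by rewrite (RintZ _ measurableT (intg_sigma x t0)) Rint_sigma// mulr1.
apply: Rint_le_dom => //; first exact: intgZ (intg_sigma x t0).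
move=> y _; rewrite normrM (ger0_norm (sigma_ge0 _ _)) mulrC.
by apply: ler_wpM2r; [exact: sigma_ge0|exact: fc].
Qed.

Lemma M1_norm g : M1 g -> forall y, `|g y| <= 1.
Proof. by move=> [_ g01] y; have /andP[? ?] := g01 y; rewrite ger0_norm. Qed.

Lemma heat_subc g (t x c : R) : 0 < t -> M1 g ->
  heat t g x - c = Rint setT (fun y => sigma t (x - y) * (g y - c)).
Proof.
move=> t0 Mg.
have I1 := intg_sigma_mul x t0 Mg.1 (M1_norm Mg).
have I2 : intg setT (fun y => c * sigma t (x - y)) by exact: intgZ (intg_sigma x t0).
rewrite (@Rint_eq _ _ _ (fun y => sigma t (x - y) * g y - c * sigma t (x - y))); last first.
  by move=> y _; ring.
by rewrite (RintB measurableT I1 I2) (RintZ _ measurableT (intg_sigma x t0)) Rint_sigma// mulr1.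
Qed.

Lemma heat01 g (t x : R) : 0 < t -> M1 g -> 0 <= heat t g x <= 1.
Proof.
move=> t0 Mg; apply/andP; split.
  apply: Rintegral_ge0 => y _; rewrite mulr_ge0 ?sigma_ge0//.
  by have /andP[] := Mg.2 y.
have := @Rint_sigma_le g t x 1 t0 (M1_norm Mg).
by apply: le_trans; exact: ler_norm.
Qed.

Lemma rho01 g (t x : R) : M1 g -> 0 <= rho g t x <= 1.
Proof.
move=> Mg; rewrite /rho; have [_|t0] := leP t 0; first exact: Mg.2.
exact: heat01.
Qed.

(** The integrand is nonnegative and measurable in all three variables, so Tonelli makes the partial
    integral measurable in time and space jointly. *)
Lemma measurable_heat g : M1 g -> measurable_fun setT (fun q : R * R => heat q.1 g q.2).
Proof.
move=> [mg g01].
pose F (z : (R * R) * R) : \bar R := (sigma z.1.1 (z.1.2 - z.2) * g z.2)%:E.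
have F0 z : (0 <= F z)%E.
  by rewrite lee_fin mulr_ge0 ?sigma_ge0//; have /andP[] := g01 z.2.
have mF : measurable_fun setT F.
  apply/measurable_EFinP; apply: measurable_funM; last first.
    exact: (measurableT_comp mg measurable_snd).
  have h : measurable_fun setT (fun z : (R * R) * R => (z.1.1, z.1.2 - z.2)).
    apply: measurable_fun_pair.
      exact: (measurableT_comp measurable_fst measurable_fst).
    apply: measurable_funB; last exact: measurable_snd.
    exact: (measurableT_comp measurable_snd measurable_fst).
  exact: (measurableT_comp measurable_sigma h).
have h : measurable_fun setT (fubini_F leb F).
  by apply: measurable_fun_fubini_tonelli_F.
apply: (measurableT_comp (f := fine)) h; exact: fine_measurable.
Qed.

Lemma measurable_rho g : M1 g -> measurable_fun setT (fun q : R * R => rho g q.1 q.2).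
Proof.
move=> Mg; apply: measurable_fun_ifT.
- apply: measurable_fun_ler; first exact: measurable_fst.
  exact: measurable_cst.
- exact: (measurableT_comp Mg.1 measurable_snd).
- exact: measurable_heat.
Qed.

Lemma measurable_heat_sec g (t : R) : M1 g -> measurable_fun setT (heat t g).
Proof.
move=> Mg; exact: (measurableT_comp (measurable_heat Mg) (pair1_measurable t)).
Qed.

Lemma M1_heat g (t : R) : 0 < t -> M1 g -> M1 (heat t g).
Proof. by move=> t0 Mg; split; [exact: measurable_heat_sec|move=> x; exact: heat01]. Qed.

Lemma M1_compl g : M1 g -> M1 (fun x => 1 - g x).
Proof.
move=> [mg g01]; split.
  by apply: measurable_funB => //; exact: measurable_cst.
by move=> x; have /andP[? ?] := g01 x; apply/andP; split; lra.
Qed.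

Lemma heat_compl g (t x : R) : 0 < t -> M1 g -> heat t (fun x => 1 - g x) x = 1 - heat t g x.
Proof.
move=> t0 Mg; have h1 := heat_subc x 1 t0 Mg.
have I1 := intg_sigma_mul x t0 Mg.1 (M1_norm Mg).
rewrite /heat (@Rint_eq _ _ _ (fun y => sigma t (x - y) - sigma t (x - y) * g y)); last first.
  by move=> y _; ring.
by rewrite (RintB measurableT (intg_sigma x t0) I1) Rint_sigma.
Qed.

Lemma sigma_lower (t0 T A : R) : 0 < t0 -> t0 <= T -> 0 <= A ->
  exists2 s, 0 < s & forall t z, t0 <= t <= T -> `|z| <= A -> s <= sigma t z.
Proof.
move=> t00 tT A0.
(* The normalization is smallest at the latest time, the exponential at the earliest time and the
   largest distance. *)
exists ((Num.sqrt (2 * pi * T))^-1 * expR (- (A ^+ 2) / (2 * t0))).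
  by rewrite mulr_gt0 ?expR_gt0// invr_gt0 sqrtr_gt0 norm_cst_gt0//; lra.
move=> t z /andP[h1 h2] zA; have t0' : 0 < t by lra.
rewrite /sigma; apply: ler_pM; rewrite ?expR_ge0 ?invr_ge0 ?sqrtr_ge0//.
  rewrite lef_pV2 ?posrE ?sqrtr_gt0 ?norm_cst_gt0//; last by lra.
  rewrite ler_sqrt ?(ltW (norm_cst_gt0 _))//; last by lra.
  by apply: ler_wpM2l => //; rewrite mulr_ge0// pi_ge0.
rewrite ler_expR !mulNr lerN2.
have zz : z ^+ 2 <= A ^+ 2 by rewrite -[leLHS]real_normK ?num_real// lerXn2r ?nnegrE.
apply: ler_pM => //; first exact: sqr_ge0.
  by rewrite invr_ge0; lra.
by rewrite lef_pV2 ?posrE; lra.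
Qed.

Lemma heat_lower_aux f (s r A t x a : R) : 0 < t -> 0 <= s -> 0 <= r -> M1 f ->
  (forall y, a <= y <= a + 1 -> r <= f y /\ s <= sigma t (x - y)) ->
  s * r <= heat t f x.
Proof.
move=> t0 s0 r0 Mf h.
have -> : s * r = Rint setT (fun y => (s * r) * \1_(`[a, a + 1] : set R) y).
  rewrite Rint_indic; last lra.
  by have -> : a + 1 - a = 1; [lra|rewrite mulr1].
apply: le_Rintegral => //.
- exact: intg_indic.
- exact: intg_sigma_mul t0 Mf.1 (M1_norm Mf).
- move=> y _; have f0 : 0 <= f y by have /andP[] := Mf.2 y.
  have [/h[h1 h2]|ya] := boolP (a <= y <= a + 1).
    by rewrite indicE; case: (_ \in _); rewrite ?mulr1 ?mulr0 ?mulr_ge0 ?sigma_ge0// ler_pM.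
  have -> : \1_(`[a, a + 1] : set R) y = 0 :> R.
    by rewrite indicE memNset//= in_itv/=; exact/negP.
  by rewrite mulr0 mulr_ge0// sigma_ge0.
Qed.

(** Every [x] has, within distance [xr - xl + 1], a unit interval on which [f >= r]: one ending at
    [x] if [x <= xl], otherwise one beyond [xr]. The kernel is bounded below on that distance,
    uniformly in the time. *)
Lemma heat_lower (T xl xr r : R) : 0 < T -> xl <= xr -> 0 < r ->
  exists2 s, 0 < s & forall f, M1 f -> (forall x, x <= xl -> r <= f x) ->
    (forall x, xr <= x -> r <= f x) ->
    forall t x, T / 2 <= t <= T -> s <= heat t f x.
Proof.
move=> T0 lr r0.
have [s s0 hs] := @sigma_lower (T / 2) T (xr - xl + 1) ltac:(lra) ltac:(lra) ltac:(lra).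
exists (s * r); first by rewrite mulr_gt0.
move=> f Mf fl fr t x tT; have t0 : 0 < t by move/andP: tT => [? _]; lra.
have [xx|xx] := leP x xl.
  apply: (@heat_lower_aux f s r 0 t x (x - 1)) => //; [exact: ltW|exact: ltW|].
  move=> y /andP[y1 y2]; split; first by apply: fl; lra.
  by apply: hs => //; rewrite ler_norml; apply/andP; split; lra.
apply: (@heat_lower_aux f s r 0 t x (x + (xr - xl))) => //; [exact: ltW|exact: ltW|].
move=> y /andP[y1 y2]; split; first by apply: fr; lra.
by apply: hs => //; rewrite ler_norml; apply/andP; split; lra.
Qed.

(** The upper bound is the lower bound for [1 - g], whose values at both ends are also positive. *)
Lemma heat_bounds g (T rl rr : R) : 0 < T -> 0 < rl < 1 -> 0 < rr < 1 -> M1rho rl rr g ->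
  exists2 d, 0 < d & forall t x, T / 2 <= t <= T -> d <= heat t g x <= 1 - d.
Proof.
move=> T0 /andP[rl0 rl1] /andP[rr0 rr1] [Mg [xl [xr [lr [gl gr]]]]].
pose r := Num.min (Num.min rl rr) (Num.min (1 - rl) (1 - rr)).
have r0 : 0 < r by rewrite !lt_min rl0 rr0 !subr_gt0 rl1 rr1.
have [hr1 hr2 hr3 hr4] : [/\ r <= rl, r <= rr, r <= 1 - rl & r <= 1 - rr].
  by split; rewrite !ge_min lexx ?orbT.
have [s s0 hs] := heat_lower T0 lr r0.
exists s => // t x tT; have t0 : 0 < t by move/andP: tT => [? _]; lra.
have h1 := hs g Mg (fun x xx => _) (fun x xx => _) t x tT.
apply/andP; split.
  by apply: hs => // y yx; [rewrite gl|rewrite gr].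
have := hs _ (M1_compl Mg) _ _ t x tT; rewrite heat_compl// => h.
have : s <= 1 - heat t g x by apply: h => y yx; [rewrite gl|rewrite gr].
lra.
Qed.

(** Only starting points to the left of [xr] contribute to the difference, and they are separated
    from [x] by [xr]. *)
Lemma heat_tail g (t x xr rr : R) : 0 < t -> M1 g -> 0 <= rr <= 1 ->
  (forall y, xr <= y -> g y = rr) -> xr <= x ->
  `|heat t g x - rr| <= expR (- ((x - xr) ^+ 2) / (2 * t)).
Proof.
move=> t0 Mg /andP[r0 r1] gr xx; rewrite (heat_subc _ _ t0 Mg).
set E := expR _.
have -> : E = Rint setT (fun y => E * sigma t (xr - y)).
  by rewrite (RintZ _ measurableT (intg_sigma xr t0)) Rint_sigma// mulr1.
apply: Rint_le_dom => //; first exact: intgZ (intg_sigma xr t0).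
move=> y _; have [xy|yx] := leP xr y.
  by rewrite gr// subrr mulr0 normr0 mulr_ge0 ?expR_ge0 ?sigma_ge0.
rewrite normrM (ger0_norm (sigma_ge0 _ _)).
apply: (@le_trans _ _ (sigma t (x - y))); last first.
  by apply: sigma_tail => //; rewrite mulr_ge0//; lra.
rewrite -[leRHS]mulr1; apply: ler_wpM2l; first exact: sigma_ge0.
by have /andP[? ?] := Mg.2 y; rewrite ler_norml; apply/andP; split; lra.
Qed.

(** An integrable majorant for all times close to [t], for continuity under the integral sign in
    [heat_time_cont]. *)
Lemma sigma_window (s t z : R) : 0 < t -> t / 2 < s < 2 * t -> sigma s z <= 2 * sigma (2 * t) z.
Proof.
move=> t0 /andP[h1 h2]; have s0 : 0 < s by lra.
have t20 : 0 < 2 * t by lra.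
have E : 2 * sigma (2 * t) z =
    (2 * (Num.sqrt (2 * pi * (2 * t)))^-1) * expR (- (z ^+ 2) / (2 * (2 * t))).
  exact: mulrA.
rewrite E /sigma; apply: ler_pM; rewrite ?expR_ge0 ?invr_ge0 ?sqrtr_ge0//.
  have c0 := norm_cst_gt0 s0; have c1 := norm_cst_gt0 t20.
  rewrite -[leLHS]mul1r ler_pdivrMr ?sqrtr_gt0// mulrAC ler_pdivlMr ?sqrtr_gt0// mul1r.
  have s4 : Num.sqrt 4 = 2 :> R by rewrite (_ : 4 = 2 ^+ 2) ?sqrtr_sqr ?ger0_norm//; ring.
  have -> : 2 * Num.sqrt (2 * pi * s) = Num.sqrt (4 * (2 * pi * s)) by rewrite (@sqrtrM _ 4)// s4.
  rewrite ler_sqrt; last by rewrite mulr_ge0// ltW.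
  have : 0 <= pi * (2 * s - t) :> R by rewrite mulr_ge0 ?pi_ge0//; lra.
  have : 0 <= 2 * pi * (2 * (2 * t)) by lra.
  lra.
rewrite ler_expR !mulNr lerN2; apply: ler_wpM2l; first exact: sqr_ge0.
by rewrite lef_pV2 ?posrE; lra.
Qed.

Lemma heat_time_cont g (t x : R) : 0 < t -> M1 g -> {for t, continuous (fun s => heat s g x)}.
Proof.
move=> t0 Mg.
have H := @continuity_under_integral R _ (measurableTypeR R) leb
  (fun s y => sigma s (x - y) * g y) setT measurableT (t / 2) (2 * t).
apply: (H _ _ (fun y => 2 * sigma (2 * t) (x - y))); last by rewrite inE/= in_itv/=; apply/andP; split; lra.
- move=> s /=; rewrite in_itv/= => /andP[s1 _].
  by apply: intg_sigma_mul (M1_norm Mg); [lra|exact: Mg.1].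
- apply: aeW => y _ s; rewrite inE/= in_itv/= => /andP[s1 _].
  apply: cvgM; last exact: cvg_cst.
  apply: (plane_section2 (f := fun q : R * R => sigma q.1 q.2)); apply: sigma_cont; lra.
- by apply: intgZ => //; apply: intg_sigma; lra.
- move=> s /=; rewrite in_itv/= => st; apply: aeW => y _.
  rewrite normrM (ger0_norm (sigma_ge0 _ _)).
  apply: (@le_trans _ _ (sigma s (x - y))); last exact: sigma_window.
  by rewrite -[leRHS]mulr1; apply: ler_wpM2l; [exact: sigma_ge0|exact: M1_norm].
Qed.

(** Chebyshev: closer than [d] the oscillation of [g] is at most [e]; farther away
    [1 <= (x - y)^2 / d^2], and [sigma_second_moment] bounds the mass. *)
Lemma heat_init g (t x e d : R) : 0 < t -> 0 < d -> 0 < e -> M1 g ->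
  (forall y, `|x - y| < d -> `|g y - g x| <= e) ->
  `|heat t g x - g x| <= e + 8 * t / d ^+ 2.
Proof.
move=> t0 d0 e0 Mg ge; rewrite (heat_subc _ _ t0 Mg).
have t20 : 0 < 2 * t by lra.
have I1 : intg setT (fun y => e * sigma t (x - y)) by exact: intgZ (intg_sigma x t0).
have I2 : intg setT (fun y => (8 * t / d ^+ 2) * sigma (2 * t) (x - y)) by exact: intgZ (intg_sigma x t20).
have -> : e + 8 * t / d ^+ 2 =
   Rint setT (fun y => e * sigma t (x - y) + (8 * t / d ^+ 2) * sigma (2 * t) (x - y)).
  rewrite (RintD measurableT I1 I2) (RintZ _ measurableT (intg_sigma x t0)).
  by rewrite (RintZ _ measurableT (intg_sigma x t20)) !Rint_sigma// !mulr1.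
have c0 : 0 <= 8 * t / d ^+ 2 by rewrite divr_ge0 ?sqr_ge0//; lra.
apply: Rint_le_dom => //; first exact: intgD.
move=> y _; have s1 := sigma_ge0 t (x - y); have s2 := sigma_ge0 (2 * t) (x - y).
rewrite normrM (ger0_norm s1).
have [xy|xy] := ltP `|x - y| d.
  apply: (@le_trans _ _ (e * sigma t (x - y))); last by rewrite lerDl mulr_ge0.
  by rewrite mulrC; apply: ler_wpM2r => //; exact: ge.
apply: (@le_trans _ _ ((8 * t / d ^+ 2) * sigma (2 * t) (x - y))); last by rewrite lerDr mulr_ge0// ltW.
apply: (@le_trans _ _ (sigma t (x - y))).
  rewrite -[leRHS]mulr1; apply: ler_wpM2l => //.
  have /andP[? ?] := Mg.2 y; have /andP[? ?] := Mg.2 x.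
  by rewrite ler_norml; apply/andP; split; lra.
have h := sigma_second_moment (x - y) t0.
have dz : d ^+ 2 <= (x - y) ^+ 2.
  by rewrite -[leRHS]real_normK ?num_real// lerXn2r ?nnegrE// ltW.
rewrite mulrAC ler_pdivlMr ?exprn_gt0// mulrC; apply: le_trans h.
exact: ler_wpM2r.
Qed.

Lemma rho_time_cont g (t x : R) : M1 g -> 0 <= t -> {for x, continuous g} ->
  {for t, continuous (fun s => rho g s x)}.
Proof.
move=> Mg; rewrite le_eqVlt => /predU1P[<-|t0] cg; last first.
  have hc := @heat_time_cont g t x t0 Mg.
  rewrite /prop_for /continuous_at /rho leNgt t0 /=.
  apply: cvg_trans hc; apply: near_eq_cvg.
  have : \near t, 0 < t by exact: lt_nbhsr.
  by apply: filterS => s s0; rewrite leNgt s0.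
rewrite /prop_for /continuous_at {2}/rho lexx.
apply/cvgrPdist_le => e e0.
have /cvgrPdist_lt /(_ (e / 2)) := cg.
move=> /(_ ltac:(lra)) /nbhs_ballP[d /= d0 dg].
have d20 : 0 < d ^+ 2 by rewrite exprn_gt0.
have c0 : 0 < e / 2 * d ^+ 2 / 8 by rewrite !mulr_gt0//; lra.
(* This radius makes the second term [8 s / d^2] of [heat_init] at most [e / 2]. *)
apply/nbhs_ballP; exists (e / 2 * d ^+ 2 / 8) => //= s; rewrite /ball/= sub0r normrN => sb.
rewrite /rho; have [s0|s0] := leP s 0; first by rewrite subrr normr0 ltW.
rewrite distrC; apply: (le_trans (@heat_init g s x (e / 2) d s0 d0 _ Mg _)).
- lra.
- by move=> y xy; rewrite distrC ltW//; apply: dg.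
- have : 8 * s / d ^+ 2 <= e / 2.
    rewrite ler_pdivrMr//; move: sb; rewrite gtr0_norm//; lra.
  lra.
Qed.

End Heat_flow.

(** * Limits and duality for the heat flow *)

Section Heat_weak.
Context {R : realType}.
Implicit Types f g : R -> R.
Local Notation leb := (@lebesgue_measure R).
Local Notation intg D f := (leb.-integrable D (EFin \o f)).
Local Notation mset D := ((measurable : set (set (measurableTypeR R))) D).

Lemma ae_notin_seq (s : seq R) : {ae leb, forall x, x \notin s}.
Proof.
have cs : countable ([set x | x \in s] : set R) by apply: finite_set_countable; exact: finite_seq.
have ms : mset [set x | x \in s] by exact: countable_measurable.
exists [set x | x \in s]; split => //; first exact: countable_lebesgue_measure0.
by move=> x /= /negP; rewrite negbK.
Qed.

Lemma piecewise_continuous_ae g : piecewise_continuous g ->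
  {ae leb, forall x, {for x, continuous g}}.
Proof.
move=> [s [cs _]]; have [N [mN N0 sN]] := ae_notin_seq s.
exists N; split => // x /= nx; apply: sN => /= xs; apply: nx; exact: cs.
Qed.

Lemma Rint0_cvg (f b : R -> R) : measurable_fun setT f -> intg setT b ->
  (forall x, 0 <= x -> `|f x| <= b x) ->
  (fun L => Rint `[0, L] f) @ +oo --> Rint `[0, +oo[ f.
Proof.
move=> mf ib fb; apply/cvg_pinftyP => u uoo.
rewrite [X in _ --> X]Rint_mkind.
under eq_fun do rewrite Rint_mkind.
have ind01 (A : set R) x : `|\1_A x| <= 1 :> R.
  by rewrite indicE; case: (_ \in _); rewrite ?normr1 ?normr0.
apply: (@Rint_cvg_dom _ _ _ _ (fun x => `|b x|)) => //.
- move=> n; apply: measurable_funM => //; exact: measurable_indic.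
- apply: measurable_funM => //; exact: measurable_indic.
- by have := integrable_norm ib.
- apply: aeW => x _; apply: cvgM; first exact: cvg_cst.
  apply: cvg_near_cst; move/cvgryPge : uoo => /(_ x); apply: filterS => n xn.
  rewrite !indicE; congr (_%:R); congr nat_of_bool.
  apply/idP/idP; rewrite !inE/= !in_itv/= ?andbT; first by case/andP.
  by move=> ->.
- move=> n x _; rewrite normrM.
  have [x0|x0] := leP 0 x.
    apply: (@le_trans _ _ `|f x|).
      by rewrite -[leRHS]mulr1; apply: ler_wpM2l.
    by rewrite (le_trans (fb _ x0))// ler_norm.
  rewrite [X in _ * X](_ : _ = 0) ?mulr0//.
  by rewrite indicE memNset ?normr0//= in_itv/= leNgt x0.
Qed.

(** [vT] is a [lim], meaningful only once convergence is known. The majorant is 1 up to [xr] and the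
    Gaussian tail of the flow beyond. *)
Lemma vT_cvg g (T rl rr : R) : 0 < T -> 0 < rr < 1 -> M1rho rl rr g ->
  (fun L => Rint `[0, L] (fun x => heat T g x - g x)) @ +oo --> vT T g.
Proof.
move=> T0 /andP[r0 r1] [Mg [xl [xr [lr [gl gr]]]]].
pose b x := 1 * \1_(`[- `|xr|, `|xr|] : set R) x + Num.sqrt (2 * pi * T) * sigma T (x - xr).
have mf : measurable_fun setT (fun x => heat T g x - g x).
  by apply: measurable_funB; [exact: measurable_heat_sec|exact: Mg.1].
have ib : intg setT b.
  apply: intgD => //; first exact: intg_indic.
  by apply: intgZ => //; exact: intg_sigma'.
have fb x : 0 <= x -> `|heat T g x - g x| <= b x.
  move=> x0; rewrite /b -sigma_expR//.
  have e0 : 0 <= expR (- (x - xr) ^+ 2 / (2 * T)) by exact: expR_ge0.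
  have [xx|xx] := leP xr x.
    rewrite [g x]gr//; apply: le_trans (heat_tail _ _ _ gr xx) _ => //.
      by rewrite !ltW.
    by rewrite lerDr mul1r indicE.
  have -> : \1_(`[- `|xr|, `|xr|] : set R) x = 1 :> R.
    rewrite indicE mem_set//= in_itv/=; have := ler_norm xr.
    by move=> h; apply/andP; split; lra.
  rewrite mul1r; apply: (@le_trans _ _ 1); last by rewrite lerDl.
  have /andP[? ?] := Mg.2 x; have /andP[? ?] := heat01 x T0 Mg.
  by rewrite ler_norml; apply/andP; split; lra.
have h := Rint0_cvg mf ib fb.
by rewrite /vT (cvg_lim _ h).
Qed.

(** Fubini moves the kernel from the profile to the compactly supported function, where [sigma_weak]
    applies for each starting point [y]. *)
Lemma heat_dual g f (t a b C : R) : 0 < t -> M1 g -> measurable_fun setT f ->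
  (forall x, `|f x| <= C * \1_(`[a, b] : set R) x) ->
  Rint setT (fun x => heat t g x * f x) =
  Rint setT (fun y => g y * Rint setT (fun x => sigma t (x - y) * f x)) /\
  intg setT (fun y => g y * Rint setT (fun x => sigma t (x - y) * f x)).
Proof.
move=> t0 Mg mf fC.
have fC1 x : `|f x| <= `|C|.
  apply: le_trans (fC x) _; rewrite indicE; case: (_ \in _); rewrite ?mulr1 ?mulr0//.
  exact: ler_norm.
pose F x y := f x * (sigma t (x - y) * g y).
have ms : measurable_fun setT (fun q : R * R => sigma t (q.1 - q.2)).
  have h : measurable_fun setT (fun q : R * R => (t, q.1 - q.2)).
    apply: measurable_fun_pair; first exact: measurable_cst.
    by apply: measurable_funB; [exact: measurable_fst|exact: measurable_snd].
  exact: (measurableT_comp measurable_sigma h).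
have mF : measurable_fun setT (fun q : R * R => F q.1 q.2).
  apply: measurable_funM; first exact: (measurableT_comp mf measurable_fst).
  apply: measurable_funM => //; exact: (measurableT_comp Mg.1 measurable_snd).
have C1 x : 0 <= C * \1_(`[a, b] : set R) x by exact: le_trans (fC x).
have FB x y : `|F x y| <= (C * \1_(`[a, b] : set R) x) * sigma t (x - y).
  rewrite /F normrM; apply: ler_pM => //.
  rewrite normrM (ger0_norm (sigma_ge0 _ _)) -[leRHS]mulr1.
  by apply: ler_wpM2l; [exact: sigma_ge0|exact: M1_norm].
have isf (y : R) : intg setT (fun x => sigma t (x - y) * f x).
  have h := intg_sigma_mul y t0 mf fC1.
  by under eq_fun do rewrite sigma_sym.
have e1 (y : R) : (fun y => g y * Rint setT (fun x => sigma t (x - y) * f x)) y = Rint setT (F ^~ y).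
  rewrite /= -(RintZ _ measurableT (isf y)); apply: Rint_eq => x _; rewrite /F; ring.
have h1 x : intg setT (fun y => (C * \1_(`[a, b] : set R) x) * sigma t (x - y)).
  exact: intgZ (intg_sigma x t0).
have h2 x : Rint setT (fun y => (C * \1_(`[a, b] : set R) x) * sigma t (x - y)) <= C * \1_(`[a, b] : set R) x.
  by rewrite (RintZ _ measurableT (intg_sigma x t0)) Rint_sigma// mulr1.
have h3 : intg setT (fun x => C * \1_(`[a, b] : set R) x) by exact: intg_indic.
have h4 y : intg setT (F ^~ y).
  have h := intgZ (g y) measurableT (isf y).
  rewrite (_ : F ^~ y = (fun x => g y * (sigma t (x - y) * f x)))//.
  by apply/funext => x; rewrite /F; ring.
have [_ E] := @Rint_swap _ F _ (fun x => C * \1_(`[a, b] : set R) x) mF FB h1 h2 h3 h4.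
have I := @Rint_swap_intg _ F _ (fun x => C * \1_(`[a, b] : set R) x) mF FB h1 h2 h3 h4.
rewrite (funext e1); split => //; rewrite -E; apply: Rint_eq => x _.
by rewrite /F (RintZ _ measurableT (intg_sigma_mul x t0 Mg.1 (M1_norm Mg))) mulrC.
Qed.

(* The [t]-integrand of [lfun] is integrable, which linearity of [lfun] in [mu] needs. *)
Lemma lfun_time_intg (mu k : R -> R -> R) (a b M C D : R) : 0 <= M -> a <= b ->
  measurable_fun setT (fun q : R * R => mu q.1 q.2) -> (forall t x, a <= t <= b -> `|mu t x| <= D) ->
  measurable_fun setT (fun q : R * R => k q.1 q.2) ->
  (forall t x, `|k t x| <= C * \1_(`[- M, M] : set R) x) ->
  [/\ (leb \x leb)%E.-integrable setT
    (fun q : R * R => (\1_(`[a, b] : set R) q.1 * (mu q.1 q.2 * k q.1 q.2))%:E),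
  intg `[a, b] (fun t => Rint setT (fun x => mu t x * k t x)) &
  Rintegral (leb \x leb)%E setT
    (fun q : R * R => \1_(`[a, b] : set R) q.1 * (mu q.1 q.2 * k q.1 q.2)) =
  Rint `[a, b] (fun t => Rint setT (fun x => mu t x * k t x))].
Proof.
move=> M0 ab mmu mu1 mk kC.
pose F t x := \1_(`[a, b] : set R) t * (mu t x * k t x).
have m1 : measurable_fun setT (\1_(`[a, b] : set R) : R -> R) by exact: measurable_indic.
have mF : measurable_fun setT (fun q : R * R => F q.1 q.2).
  apply: measurable_funM; first exact: (measurableT_comp m1 measurable_fst).
  exact: measurable_funM.
have FB t x : `|F t x| <= \1_(`[a, b] : set R) t * (D * (C * \1_(`[- M, M] : set R) x)).
  rewrite /F normrM (@ger0_norm _ (\1_(`[a, b] : set R) t)); last by rewrite indicE.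
  have [tab|tab] := boolP (a <= t <= b); last first.
    have -> : \1_(`[a, b] : set R) t = 0 :> R by rewrite indicE memNset//= in_itv/=; exact/negP.
    by rewrite !mul0r.
  apply: ler_wpM2l; first by rewrite indicE.
  by rewrite normrM; apply: ler_pM => //; exact: mu1.
have iB t : intg setT (fun x => \1_(`[a, b] : set R) t * (D * (C * \1_(`[- M, M] : set R) x))).
  by apply: intgZ => //; apply: intgZ => //; exact: intg_indic.
have ip := @integrable_prod_dom _ _ (measurableTypeR R) (measurableTypeR R) R leb leb F
  _ (fun t => (D * (C * (M + M))) * \1_(`[a, b] : set R) t) mF FB iB.
have {}ip : (leb \x leb)%E.-integrable setT (fun q : R * R => (F q.1 q.2)%:E).
  apply: ip; last exact: intg_indic.
  move=> t; rewrite -[leLHS]/(Rint _ _) (RintZ _ measurableT (intgZ _ measurableT (intg_indic _ _ _ measurableT))) (RintZ _ measurableT (intg_indic _ _ _ measurableT)) Rint_indic; last lra.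
  by rewrite opprK mulrC.
have iF t : intg setT (F t).
  apply: (intg_dom measurableT _ (iB t)) => [|x _]; last exact: FB.
  exact: (measurableT_comp mF (pair1_measurable t)).
have [I E] := @Rintegral_prod1 _ _ (measurableTypeR R) (measurableTypeR R) R leb leb F ip iF.
have FE t : a <= t <= b -> Rint setT (F t) = Rint setT (fun x => mu t x * k t x).
  move=> tab; apply: Rint_eq => x _; rewrite /F.
  by have -> : \1_(`[a, b] : set R) t = 1 :> R; [rewrite indicE mem_set//= in_itv|rewrite mul1r].
split; first exact: ip.
  have I' : intg `[a, b] (fun t => Rint setT (F t)) by exact: integrableS I.
  move: I'; apply: eq_integrable => // t; rewrite inE/= in_itv/= => tab /=; congr EFin.
  exact: FE.
rewrite -[LHS]/(Rintegral (leb \x leb)%E setT (fun q : R * R => F q.1 q.2)) -E Rint_mkind.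
apply: Rint_eq => t _.
have [tab|tab] := boolP (a <= t <= b).
  by rewrite -[LHS]/(Rint _ _) FE// indicE mem_set ?mulr1//= in_itv.
have i0 : \1_(`[a, b] : set R) t = 0 :> R by rewrite indicE memNset//= in_itv/=; exact/negP.
rewrite i0 mulr0 -[LHS]/(Rint _ _) (@Rint_eq _ _ _ (cst 0)); last by move=> x _; rewrite /F i0 mul0r.
by rewrite /Defs.Rint Rintegral_cst// mul0r.
Qed.

End Heat_weak.

(** * The heat flow as a weak solution *)

Section Heat_solution.
Context {R : realType}.
Implicit Types f g : R -> R.
Local Notation leb := (@lebesgue_measure R).
Local Notation intg D f := (leb.-integrable D (EFin \o f)).
Local Notation mset D := ((measurable : set (set (measurableTypeR R))) D).

Lemma box_of_supp (k : R -> R) (M C : R) : (forall x, `|k x| <= C) ->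
  (forall x, M < `|x| -> k x = 0) -> forall x, `|k x| <= C * \1_(`[- M, M] : set R) x.
Proof.
move=> kC k0 x; have [xM|/negP xM] := boolP (M < `|x|).
  by rewrite k0// normr0 mulr_ge0// ?indicE//; exact: le_trans (kC x).
by rewrite supp_indic// mulr1.
Qed.

Lemma hh_data (G : R -> R -> R) : C12K G -> exists M C : R,
  [/\ 0 <= M, 0 <= C,
    measurable_fun setT (fun q : R * R => hh G q.1 q.2),
    (forall t x, `|hh G t x| <= C * \1_(`[- M, M] : set R) x) &
    (forall t x, `|G t x| <= C * \1_(`[- M, M] : set R) x)].
Proof.
move=> CG; have [M [C [M0 C0 der zx bd]]] := C12K_data CG.
have [_ [cG [cGt [cGx [cGxx _]]]]] := CG.
have hC t x : `|hh G t x| <= 2 * C.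
  have [_ b1 _ b2] := bd t x; rewrite /hh; apply: (le_trans (ler_normD _ _)).
  by rewrite normrM ger0_norm//; lra.
exists M, (2 * C); split => //; first lra.
- apply: continuous_plane_measurable => q.
  by apply: cvgD; [exact: cGt|apply: cvgM; [exact: cvg_cst|exact: cGxx]].
- move=> t; apply: box_of_supp => // x Mx.
  by rewrite /hh; have [_ -> _ ->] := zx t x Mx; rewrite mulr0 addr0.
- move=> t; apply: box_of_supp => x; last by case/(zx t).
  by have [b1 _ _ _] := bd t x; lra.
Qed.

Lemma C12K_sec (G : R -> R -> R) (t : R) : C12K G -> continuous (G t).
Proof.
by move=> [_ [cG _]] x; apply: (@plane_section1 _ (fun q => G q.1 q.2) t x (cG (t, x))).
Qed.

Lemma sigma_upper (e t z : R) : 0 < e -> e <= t -> `|sigma t z| <= (Num.sqrt (2 * pi * e))^-1.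
Proof.
move=> e0 et; have t0 : 0 < t by exact: lt_le_trans et.
rewrite (ger0_norm (sigma_ge0 _ _)) /sigma -[leRHS]mulr1.
apply: ler_pM; rewrite ?expR_ge0 ?invr_ge0 ?sqrtr_ge0//.
  rewrite lef_pV2 ?posrE ?sqrtr_gt0 ?norm_cst_gt0// ler_sqrt ?(ltW (norm_cst_gt0 _))//.
  by apply: ler_wpM2l => //; rewrite mulr_ge0// pi_ge0.
rewrite -[leRHS]expR0 ler_expR mulNr oppr_le0 divr_ge0 ?sqr_ge0//; lra.
Qed.

(** The superposition of [sigma_weak] over the starting points [y] with weight [g y]; the work lies
    in exchanging the integral over [y] with those over time and space. *)
Lemma heat_weak_eps g (G : R -> R -> R) (e T : R) : M1 g -> C12K G -> 0 < e -> e <= T ->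
  Rint setT (fun x => heat T g x * G T x) - Rint setT (fun x => heat e g x * G e x) =
  Rint `[e, T] (fun t => Rint setT (fun x => heat t g x * hh G t x)).
Proof.
move=> Mg CG e0 eT; have T0 : 0 < T by exact: lt_le_trans eT.
have [M [C [M0 C0 mh hC GC]]] := hh_data CG.
pose H (t x : R) := heat t g x.
have mH : measurable_fun setT (fun q : R * R => H q.1 q.2) by exact: measurable_heat.
have H1 t x : e <= t <= T -> `|H t x| <= 1.
  move=> /andP[et _]; have /andP[? ?] := heat01 x (lt_le_trans e0 et) Mg.
  by rewrite ger0_norm.
have [ipH _ EH] := lfun_time_intg M0 eT mH H1 mh hC.
pose S := (Num.sqrt (2 * pi * e))^-1.
have ms (y : R) : measurable_fun setT (fun q : R * R => sigma q.1 (q.2 - y)).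
  have h : measurable_fun setT (fun q : R * R => (q.1, q.2 - y)).
    apply: measurable_fun_pair; first exact: measurable_fst.
    by apply: measurable_funB; [exact: measurable_snd|exact: measurable_cst].
  exact: (measurableT_comp measurable_sigma h).
have s1 y t x : e <= t <= T -> `|sigma t (x - y)| <= S.
  by move=> /andP[et _]; exact: sigma_upper.
have Hs y := lfun_time_intg M0 eT (ms y) (@s1 y) mh hC.
have [ip1 _ _] := lfun_time_intg (mu := fun _ _ => 1) M0 eT (measurable_cst (1 : R)) (D := 1)
  ltac:(by move=> *; rewrite normr1) mh hC.
pose J (q : R * R) : R := \1_(`[e, T] : set R) q.1.
pose F (q : R * R) (y : R) : R := (J q * (sigma q.1 (q.2 - y) * hh G q.1 q.2)) * g y.
pose B (q : R * R) : R := `|J q * (1 * hh G q.1 q.2)|.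
(* Clipping the time at [e] keeps the kernel of the majorant integrable with mass 1 at every point
   of the plane; where the clipping changes anything, the factor [J] inside [B] is 0. *)
pose b (q : R * R) (y : R) : R := B q * sigma (Num.max e q.1) (q.2 - y).
have m1 : measurable_fun setT (\1_(`[e, T] : set R) : R -> R) by exact: measurable_indic.
have mJ : measurable_fun setT J by exact: (measurableT_comp m1 measurable_fst).
have max0 (t : R) : 0 < Num.max e t by rewrite lt_max e0.
have mF : measurable_fun setT (fun z : (R * R) * R => F z.1 z.2).
  apply: measurable_funM; last exact: (measurableT_comp Mg.1 measurable_snd).
  apply: measurable_funM; first exact: (measurableT_comp mJ measurable_fst).
  apply: measurable_funM; last exact: (measurableT_comp mh measurable_fst).
  have h : measurable_fun setT (fun z : (R * R) * R => (z.1.1, z.1.2 - z.2)).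
    apply: measurable_fun_pair.
      exact: (measurableT_comp measurable_fst measurable_fst).
    apply: measurable_funB; last exact: measurable_snd.
    exact: (measurableT_comp measurable_snd measurable_fst).
  exact: (measurableT_comp measurable_sigma h).
have J0 t x : ~~ (e <= t <= T) -> J (t, x) = 0.
  by move=> tab; rewrite /J indicE memNset//= in_itv/=; exact/negP.
have J1 t x : e <= t <= T -> J (t, x) = 1.
  by move=> tab; rewrite /J indicE mem_set//= in_itv/=.
have Fb q y : `|F q y| <= b q y.
  case: q => t x; rewrite /F /b /B.
  have [tab|tab] := boolP (e <= t <= T); last first.
    by rewrite J0// !mul0r normr0 mul0r.
  rewrite J1//= !mul1r normrM (normrM (sigma t (x - y))) (ger0_norm (sigma_ge0 t (x - y))).
  rewrite max_r; last by case/andP: tab.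
  rewrite mulrAC [X in _ <= X]mulrC; apply: ler_wpM2r => //.
  by rewrite -[leRHS]mulr1; apply: ler_wpM2l; [exact: sigma_ge0|exact: M1_norm].
have ib q : intg setT (b q) by apply: intgZ => //; exact: intg_sigma.
have bB q : Rint setT (b q) <= B q.
  by rewrite (RintZ _ measurableT (intg_sigma _ (max0 _))) Rint_sigma// mulr1.
have iB : (leb \x leb)%E.-integrable setT (EFin \o B).
  by have := integrable_norm ip1.
have iF y : (leb \x leb)%E.-integrable setT (EFin \o (F ^~ y)).
  have [h _ _] := Hs y; have := integrableZr measurableT (g y) h.
  by apply: eq_integrable.
have [_ E] := @Rintegral_swap _ _ (measurableTypeR R * measurableTypeR R)%type (measurableTypeR R) R (prodm leb leb) leb F b B mF Fb ib bB iB iF.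
rewrite -[RHS]EH.
have -> : Rintegral (leb \x leb)%E setT (fun q : R * R => \1_(`[e, T] : set R) q.1 * (H q.1 q.2 * hh G q.1 q.2)) =
  Rintegral (leb \x leb)%E setT (fun q => Rintegral leb setT (F q)).
  congr Rintegral; apply/funext => -[t x] /=.
  have [tab|tab] := boolP (e <= t <= T); last first.
    rewrite -/(J (t, x)) J0// mul0r -[RHS]/(Rint _ _) (@Rint_eq _ _ _ (cst 0)).
      by rewrite /Defs.Rint Rintegral_cst// mul0r.
    by move=> y _; rewrite /F J0// !mul0r.
  rewrite -/(J (t, x)) J1// mul1r -[RHS]/(Rint _ _).
  have t0 : 0 < t by case/andP: tab => et _; exact: lt_le_trans et.
  rewrite mulrC /H /heat -(RintZ _ measurableT (intg_sigma_mul x t0 Mg.1 (M1_norm Mg))).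
  by apply: Rint_eq => y _; rewrite /F J1//=; ring.
rewrite E.
have RE y : Rintegral (leb \x leb)%E setT (F ^~ y) =
    g y * Rint setT (fun x => sigma T (x - y) * G T x) - g y * Rint setT (fun x => sigma e (x - y) * G e x).
  have [h _ h2] := Hs y.
  rewrite -mulrBr (sigma_weak y CG e0 eT) -h2 mulrC -RintegralZr//.
transitivity (Rint setT (fun y => g y * Rint setT (fun x => sigma T (x - y) * G T x) -
    g y * Rint setT (fun x => sigma e (x - y) * G e x))); last first.
  by symmetry; apply: (@Rint_eq _ setT) => y _; exact: RE.
have mG t : measurable_fun setT (G t) by apply: continuous_Rmeas; exact: C12K_sec.
have [-> I1] := heat_dual T0 Mg (mG T) (GC T).
have [-> I2] := heat_dual e0 Mg (mG e) (GC e).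
by rewrite (RintB measurableT I1 I2).
Qed.

Lemma measurable_hh_rho g (T : R) (G : R -> R -> R) : M1 g -> C12K G -> 0 <= T ->
  intg `[0, T] (fun t => Rint setT (fun x => rho g t x * hh G t x)).
Proof.
move=> Mg CG T0; have [M [C [M0 C0 mh hC GC]]] := hh_data CG.
have r1 t x : 0 <= t <= T -> `|rho g t x| <= 1.
  by move=> _; have /andP[? ?] := rho01 t x Mg; rewrite ger0_norm.
by have [] := lfun_time_intg M0 T0 (measurable_rho Mg) r1 mh hC.
Qed.

(* The weak formulation on [[e, T]] passes to the limit [e -> 0] because [rho g e] tends to [g] almost everywhere. *)
Lemma lfun_rho g (T : R) (G : R -> R -> R) : 0 < T -> M1 g -> piecewise_continuous g ->
  C12K G -> lfun T (rho g) G = 0.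
Proof.
move=> T0 Mg pg CG; have [M [C [M0 C0 mh hC GC]]] := hh_data CG.
pose e (n : nat) : R := T * n.+1%:R^-1.
have inv1 n : 0 < (n.+1%:R^-1 : R) <= 1.
  by rewrite invr_gt0 ltr0n/= invf_le1 ?ltr0n// ler1n.
have e0 n : 0 < e n by rewrite /e mulr_gt0//; case/andP: (inv1 n).
have eT n : e n <= T by rewrite /e ler_piMr ?(ltW T0)//; case/andP: (inv1 n).
have ecv : e @ \oo --> (0 : R).
  rewrite -[X in _ --> X](mulr0 T); apply: cvgM; first exact: cvg_cst.
  exact: cvg_harmonic.
have mG t : measurable_fun setT (G t) by apply: continuous_Rmeas; exact: C12K_sec.
have rE n x : rho g (e n) x = heat (e n) g x by rewrite /rho leNgt e0.
pose W t := Rint setT (fun x => rho g t x * hh G t x).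
have r1 t x : `|rho g t x| <= 1 by have /andP[? ?] := rho01 t x Mg; rewrite ger0_norm.
have iW : intg `[0, T] W by apply: measurable_hh_rho => //; exact: ltW.
have cA : (fun n => Rint setT (fun x => rho g (e n) x * G (e n) x)) @ \oo -->
    Rint setT (fun x => rho g 0 x * G 0 x).
  apply: (@Rint_cvg_dom _ _ _ _ (fun x => C * \1_(`[- M, M] : set R) x)) => //.
  - move=> n; apply: measurable_funM => //.
    exact: (measurableT_comp (measurable_rho Mg) (pair1_measurable (e n))).
  - apply: measurable_funM => //.
    exact: (measurableT_comp (measurable_rho Mg) (pair1_measurable (0 : R))).
  - exact: intg_indic.
  - have [N [mN N0 sN]] := piecewise_continuous_ae pg.
    exists N; split => // x /= nx; apply: sN => /= cx; apply: nx => _.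
    apply: cvgM.
      exact: (cvg_comp _ _ ecv (rho_time_cont Mg (lexx 0) cx)).
    have [_ [cG _]] := CG.
    have h : {for 0, continuous (fun t => G t x)}.
      exact: (@plane_section2 _ (fun q => G q.1 q.2) 0 x (cG (0, x))).
    exact: (cvg_comp _ _ ecv h).
  - by move=> n x _; rewrite normrM -[leRHS]mul1r; apply: ler_pM.
have cB : (fun n => Rint `[e n, T] W) @ \oo --> Rint `[0, T] W.
  have E n : Rint `[e n, T] W = Rint `[0, T] (fun t => W t * \1_(`[e n, T] : set R) t).
    rewrite Rint_mkind [RHS]Rint_mkind; apply: Rint_eq => t _.
    rewrite -mulrA; congr (_ * _); rewrite !indicE.
    have [h|h] := boolP (t \in `[e n, T]%classic); last by rewrite mul0r.
    rewrite mul1r mem_set//; move: h; rewrite inE/= !in_itv/= => /andP[h1 h2].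
    by rewrite h2 andbT (le_trans _ h1)// ltW.
  under eq_fun do rewrite E.
  have mW := intg_meas iW.
  apply: (@Rint_cvg_dom _ _ _ _ (fun t => `|W t|)) => //.
  - move=> n; apply: measurable_funM => //; exact: measurable_indic.
  - by have := integrable_norm iW.
  - have [N [mN N0 sN]] := ae_notin_seq [:: (0 : R)].
    exists N; split => // t /= nt; apply: sN => /= tn; apply: nt; rewrite in_itv/= => /andP[t0 tT].
    have tp : 0 < t by rewrite lt_neqAle t0 andbT eq_sym; move: tn; rewrite inE.
    rewrite -[X in _ --> X](mulr1 (W t)); apply: cvgM; first exact: cvg_cst.
    apply: cvg_near_cst.
    have /cvgrPdist_lt /(_ _ tp) := ecv; apply: filterS => n; rewrite sub0r normrN => /(le_lt_trans (ler_norm _)) en.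
    by rewrite indicE mem_set//= in_itv/= tT ltW.
  - move=> n t _; rewrite normrM -[leRHS]mulr1; apply: ler_wpM2l => //.
    by rewrite indicE; case: (_ \in _); rewrite ?normr1 ?normr0.
have EE n : Rint setT (fun x => rho g T x * G T x) - Rint setT (fun x => rho g (e n) x * G (e n) x) =
    Rint `[e n, T] W.
  have := heat_weak_eps Mg CG (e0 n) (eT n).
  have -> : (fun x => rho g T x * G T x) = (fun x => heat T g x * G T x).
    by apply/funext => x; rewrite /rho leNgt T0.
  have -> : (fun x => rho g (e n) x * G (e n) x) = (fun x => heat (e n) g x * G (e n) x).
    by apply/funext => x; rewrite rE.
  move=> ->; apply: Rint_eq => t; rewrite /= in_itv/= => /andP[h _]; apply: Rint_eq => x _.
  by rewrite /rho leNgt (lt_le_trans (e0 n) h).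
have cL : (fun n => Rint setT (fun x => rho g T x * G T x) - Rint setT (fun x => rho g (e n) x * G (e n) x)) @ \oo -->
    Rint setT (fun x => rho g T x * G T x) - Rint setT (fun x => rho g 0 x * G 0 x).
  by apply: cvgB; [exact: cvg_cst|exact: cA].
have U : Rint setT (fun x => rho g T x * G T x) - Rint setT (fun x => rho g 0 x * G 0 x) = Rint `[0, T] W.
  rewrite (funext EE) in cL.
  exact: (cvg_unique _ cL cB).
rewrite /lfun -/(W).
have c1 t : Rint setT (fun x => G t x * rho g t x) = Rint setT (fun x => rho g t x * G t x).
  by apply: Rint_eq => x _; rewrite mulrC.
by rewrite !c1 U subrr.
Qed.

End Heat_solution.

(** * Upper bounds *)

Section Perturbation.
Context {R : realType}.
Implicit Types f g : R -> R.
Local Notation leb := (@lebesgue_measure R).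
Local Notation intg D f := (leb.-integrable D (EFin \o f)).
Local Notation mset D := ((measurable : set (set (measurableTypeR R))) D).

Definition gE (L x : R) : R := expR (- (x ^+ 2) / (2 * L ^+ 2)).
(** [phi1], [phi2], [phi3] are the successive derivatives of [phi0]. The density is perturbed by
    [phi1], whose mass on [[0, z]] is [phi0 z - eps] and hence tends to [- eps]. *)
Definition phi0 (eps L x : R) : R := eps * gE L x.
Definition phi1 (eps L x : R) : R := - (x / L ^+ 2) * phi0 eps L x.
Definition phi2 (eps L x : R) : R := (x ^+ 2 / L ^+ 4 - (L ^+ 2)^-1) * phi0 eps L x.
Definition phi3 (eps L x : R) : R := (3 * x / L ^+ 4 - x ^+ 3 / L ^+ 6) * phi0 eps L x.

Lemma phi0_d (eps L x : R) : 0 < L -> is_derive x 1 (phi0 eps L) (phi1 eps L x).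
Proof.
move=> L0; have Ln : L != 0 by rewrite gt_eqF.
rewrite /phi1 /phi0 /gE; apply: is_derive_eq; rewrite /GRing.scale/=.
by field; rewrite ?Ln.
Qed.

Lemma phi1_d (eps L x : R) : 0 < L -> is_derive x 1 (phi1 eps L) (phi2 eps L x).
Proof.
move=> L0; have Ln : L != 0 by rewrite gt_eqF.
have h0 := phi0_d eps x L0.
have h1 : is_derive x 1 (fun y => - (y / L ^+ 2)) (- (L ^+ 2)^-1).
  by apply: is_derive_eq; rewrite /GRing.scale/=; ring.
apply: is_derive_eq (is_derive_mul h1 h0) _.
by rewrite /phi2 /phi1; field; rewrite ?Ln.
Qed.

Lemma phi2_d (eps L x : R) : 0 < L -> is_derive x 1 (phi2 eps L) (phi3 eps L x).
Proof.
move=> L0; have Ln : L != 0 by rewrite gt_eqF.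
have h0 := phi0_d eps x L0.
have h1 : is_derive x 1 (fun y => y ^+ 2 / L ^+ 4 - (L ^+ 2)^-1) (2 * x / L ^+ 4).
  by apply: is_derive_eq; rewrite /GRing.scale/=; ring.
apply: is_derive_eq (is_derive_mul h1 h0) _.
by rewrite /phi3 /phi1; field; rewrite ?Ln.
Qed.

Lemma phi3_cont (eps L : R) : 0 < L -> continuous (phi3 eps L).
Proof.
move=> L0 x; apply: cvgM; last exact: is_derive_cont (phi0_d eps x L0).
have h1 : is_derive x 1 (fun y => 3 * y / L ^+ 4 - y ^+ 3 / L ^+ 6) (3 / L ^+ 4 - 3 * x ^+ 2 / L ^+ 6).
  by apply: is_derive_eq; rewrite /GRing.scale/=; ring.
exact: is_derive_cont h1.
Qed.

Lemma phi0_cont (eps L : R) : 0 < L -> continuous (phi0 eps L).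
Proof. by move=> L0 x; exact: is_derive_cont (phi0_d eps x L0). Qed.
Lemma phi1_cont (eps L : R) : 0 < L -> continuous (phi1 eps L).
Proof. by move=> L0 x; exact: is_derive_cont (phi1_d eps x L0). Qed.
Lemma phi2_cont (eps L : R) : 0 < L -> continuous (phi2 eps L).
Proof. by move=> L0 x; exact: is_derive_cont (phi2_d eps x L0). Qed.

Lemma gE01 (L x : R) : 0 < L -> 0 < gE L x <= 1.
Proof.
move=> L0; rewrite /gE expR_gt0/= -[leRHS]expR0 ler_expR mulNr oppr_le0.
by rewrite divr_ge0 ?sqr_ge0// mulr_ge0// sqr_ge0.
Qed.

Lemma gE_sigma (L x : R) : 0 < L ->
  gE L x = Num.sqrt (2 * pi * L ^+ 2) * sigma (L ^+ 2) (x - 0).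
Proof. by move=> L0; rewrite subr0 -sigma_expR// exprn_gt0. Qed.

Lemma gE_int (L : R) : 0 < L ->
  intg setT (gE L) /\ Rint setT (gE L) = Num.sqrt (2 * pi * L ^+ 2).
Proof.
move=> L0; have s0 : 0 < L ^+ 2 by rewrite exprn_gt0.
have -> : gE L = (fun x => Num.sqrt (2 * pi * L ^+ 2) * sigma (L ^+ 2) (x - 0)).
  by apply/funext => x; exact: gE_sigma.
split; first by apply: intgZ => //; exact: intg_sigma'.
by rewrite (RintZ _ measurableT (intg_sigma' 0 s0)) Rint_sigma'// mulr1.
Qed.

(** With [u = |x| / L] this is [u exp (- u^2 / 2) <= 1], which follows from [u <= 1 + u^2 / 2]. *)
Lemma phi1_bound (eps L x : R) : 0 < L -> `|phi1 eps L x| <= `|eps| / L.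
Proof.
move=> L0; have Ln : L != 0 by rewrite gt_eqF.
have /andP[E0 E1] := gE01 x L0.
pose u := `|x| / L; have u0 : 0 <= u by rewrite divr_ge0// ltW.
have xu : x ^+ 2 / (2 * L ^+ 2) = u ^+ 2 / 2.
  rewrite /u -[x ^+ 2]real_normK ?num_real//; by field; rewrite ?Ln.
have ue : u * gE L x <= 1.
  rewrite /gE mulNr xu expRN ler_pdivrMr ?expR_gt0// mul1r.
  have := expR_ge1Dx (u ^+ 2 / 2); have := sqr_ge0 (u - 1); nra.
have -> : `|phi1 eps L x| = (`|eps| / L) * (u * gE L x).
  rewrite /phi1 /phi0 !normrM normrN normrM normfV (gtr0_norm E0).
  rewrite (@ger0_norm _ (L ^+ 2)) ?sqr_ge0// /u; by field; rewrite ?Ln.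
by rewrite -[leRHS]mulr1; apply: ler_wpM2l => //; rewrite divr_ge0// ltW.
Qed.

Lemma phi0_sq (eps L x : R) : 0 < L -> phi0 eps L x ^+ 2 <= eps ^+ 2 * gE L x.
Proof.
move=> L0; have /andP[E0 E1] := gE01 x L0.
rewrite /phi0 exprMn; apply: ler_wpM2l; first exact: sqr_ge0.
by rewrite expr2 -[leRHS]mulr1; apply: ler_wpM2l => //; exact: ltW.
Qed.

(** With [w = x^2 / L^2] the square contains [(w - 1)^2] and two Gaussian factors. One of them is
    [exp (w / 4)^-2] and absorbs [(w - 1)^2 <= 16 (1 + w / 4)^2]; the other is kept for
    integrability in [x]. *)
Lemma phi2_sq (eps L x : R) : 0 < L -> phi2 eps L x ^+ 2 <= 16 * eps ^+ 2 / L ^+ 4 * gE L x.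
Proof.
move=> L0; have Ln : L != 0 by rewrite gt_eqF.
have /andP[E0 E1] := gE01 x L0.
pose w := x ^+ 2 / L ^+ 2.
have w0 : 0 <= w by rewrite divr_ge0 ?sqr_ge0.
have h : (w - 1) ^+ 2 * gE L x <= 16.
  have -> : gE L x = (expR (w / 4) ^+ 2)^-1.
    by rewrite /gE -expRM_natl -expRN; congr expR; rewrite /w; field; rewrite ?Ln.
  rewrite ler_pdivrMr ?exprn_gt0 ?expR_gt0//.
  have e1 := expR_ge1Dx (w / 4).
  have : (1 + w / 4) ^+ 2 <= expR (w / 4) ^+ 2.
    by rewrite lerXn2r ?nnegrE ?expR_ge0//; lra.
  nra.
have -> : phi2 eps L x ^+ 2 = (eps ^+ 2 / L ^+ 4 * gE L x) * ((w - 1) ^+ 2 * gE L x).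
  by rewrite /phi2 /phi0 /w; field; rewrite ?Ln.
have -> : 16 * eps ^+ 2 / L ^+ 4 * gE L x = (eps ^+ 2 / L ^+ 4 * gE L x) * 16 by ring.
apply: ler_wpM2l => //; rewrite mulr_ge0 ?(ltW E0)// divr_ge0 ?sqr_ge0//.
by rewrite exprn_ge0// ltW.
Qed.

(** For [p = theta phi1] with [theta = 2 t / T - 1], the equation [p_t = p_xx / 2 - F_x] integrates
    in [x] to [F = - theta' phi0 + theta phi2 / 2]. *)
Definition flux (T eps L t x : R) : R :=
  - (2 / T) * phi0 eps L x + 2^-1 * ((2 * t / T - 1) * phi2 eps L x).

Lemma flux_sq (T eps L t x : R) : 0 < T -> 0 < L -> T / 2 <= t <= T ->
  flux T eps L t x ^+ 2 <= (8 / T ^+ 2 + 8 / L ^+ 4) * eps ^+ 2 * gE L x.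
Proof.
move=> T0 L0 /andP[t1 t2].
have Ln : L != 0 by rewrite gt_eqF. have Tn : T != 0 by rewrite gt_eqF.
have p0 := phi0_sq eps x L0; have p2 := phi2_sq eps x L0.
set th := 2 * t / T - 1.
have th1 : th ^+ 2 <= 1.
  have h1 : 0 <= th by rewrite /th subr_ge0 ler_pdivlMr//; lra.
  have h2 : th <= 1 by rewrite /th lerBlDr ler_pdivrMr//; lra.
  nra.
rewrite /flux -/th; set A := 2 / T * phi0 eps L x; set B := th * phi2 eps L x.
have -> : - (2 / T) * phi0 eps L x + 2^-1 * B = - A + 2^-1 * B by rewrite /A; ring.
have hA : A ^+ 2 <= 4 / T ^+ 2 * (eps ^+ 2 * gE L x).
  rewrite /A exprMn; have -> : (2 / T) ^+ 2 = 4 / T ^+ 2 by field.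
  by apply: ler_wpM2l => //; rewrite divr_ge0 ?sqr_ge0.
have hB : B ^+ 2 <= 16 * eps ^+ 2 / L ^+ 4 * gE L x.
  rewrite /B exprMn; apply: le_trans p2; rewrite -[leRHS]mul1r.
  by apply: ler_wpM2r => //; exact: sqr_ge0.
have : (- A + 2^-1 * B) ^+ 2 <= 2 * A ^+ 2 + 2^-1 * B ^+ 2 by have := sqr_ge0 (A + 2^-1 * B); nra.
have -> : (8 / T ^+ 2 + 8 / L ^+ 4) * eps ^+ 2 * gE L x =
  2 * (4 / T ^+ 2 * (eps ^+ 2 * gE L x)) + 2^-1 * (16 * eps ^+ 2 / L ^+ 4 * gE L x).
  by field; rewrite ?Tn ?Ln.
lra.
Qed.

(** The weak form is started at [T / 2], where the factor [2 t / T - 1] vanishes, so only the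
    boundary term at [T] remains. *)
Lemma phi_weak (T eps L : R) (G : R -> R -> R) : 0 < T -> 0 < L -> C12K G ->
  Rint setT (fun x => phi1 eps L x * G T x) =
  Rint `[T / 2, T] (fun t => Rint setT (fun x =>
    (2 * t / T - 1) * phi1 eps L x * hh G t x + flux T eps L t x * dx G t x)).
Proof.
move=> T0 L0 CG; have Tn : T != 0 by rewrite gt_eqF.
have cth (t x : R) : {for (t, x), continuous (fun q : R * R => 2 * q.1 / T - 1)}.
  apply: cvgB; last exact: cvg_cst.
  by apply: cvgM; [apply: cvgM; [exact: cvg_cst|exact: cvg_fst]|exact: cvg_cst].
have cphi (t x : R) : {for (t, x), continuous (fun q : R * R => phi1 eps L q.2)}.
  apply: (continuous_comp (f := snd) (g := phi1 eps L)); first exact: cvg_snd.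
  exact: phi1_cont.
have d1 (t x : R) : 0 < t ->
    is_derive t 1 (fun s => (2 * s / T - 1) * phi1 eps L x) (2 / T * phi1 eps L x).
  by move=> _; apply: is_derive_eq; rewrite /GRing.scale/=; ring.
have scal (c : R) (f : R -> R) (x l : R) : is_derive x 1 f l -> is_derive x 1 (fun x => c * f x) (c * l).
  move=> h; have hc : is_derive x 1 (fun _ : R => c) 0 by exact: is_derive_cst.
  by have := is_derive_mul hc h; rewrite mul0r add0r.
have d2 (t x : R) : 0 < t ->
    is_derive x 1 (fun x => (2 * t / T - 1) * phi1 eps L x) ((2 * t / T - 1) * phi2 eps L x).
  by move=> _; apply: scal; exact: phi1_d.
have d3 (t x : R) : 0 < t ->
    is_derive x 1 (fun x => (2 * t / T - 1) * phi2 eps L x) ((2 * t / T - 1) * phi3 eps L x).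
  by move=> _; apply: scal; exact: phi2_d.
have d4 (t x : R) : 0 < t -> is_derive x 1 (flux T eps L t)
    (- (2 / T) * phi1 eps L x + 2^-1 * ((2 * t / T - 1) * phi3 eps L x)).
  move=> t0; have h1 := scal (- (2 / T)) _ _ _ (phi0_d eps x L0).
  have h2 := scal (2^-1) _ _ _ (d3 t x t0).
  exact: (is_deriveD h1 h2).
have c1 (t x : R) : 0 < t -> {for (t, x), continuous (fun q : R * R => (2 * q.1 / T - 1) * phi1 eps L q.2)}.
  by move=> _; apply: cvgM; [exact: cth|exact: cphi].
have c2 (t x : R) : 0 < t -> {for (t, x), continuous (fun q : R * R => 2 / T * phi1 eps L q.2)}.
  by move=> _; apply: cvgM; [exact: cvg_cst|exact: cphi].
have c3 (t : R) : 0 < t -> continuous (fun x => (2 * t / T - 1) * phi3 eps L x).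
  by move=> _ x; apply: cvgM; [exact: cvg_cst|exact: phi3_cont].
have c4 (t : R) : 0 < t -> continuous (fun x => - (2 / T) * phi1 eps L x + 2^-1 * ((2 * t / T - 1) * phi3 eps L x)).
  move=> t0 x; apply: cvgD; apply: cvgM; [exact: cvg_cst|exact: phi1_cont|exact: cvg_cst|exact: c3].
have h0 : 0 < T / 2 by lra.
have h1 : T / 2 <= T by lra.
have W := @weak_form R (fun t x => (2 * t / T - 1) * phi1 eps L x) (fun t x => 2 / T * phi1 eps L x)
  (fun t x => (2 * t / T - 1) * phi2 eps L x) (fun t x => (2 * t / T - 1) * phi3 eps L x)
  (flux T eps L) (fun t x => - (2 / T) * phi1 eps L x + 2^-1 * ((2 * t / T - 1) * phi3 eps L x))
  G (T / 2) T d1 d2 d3 d4 c1 c2 c3 c4 _ CG h0 h1.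
rewrite -W; last by move=> t x _; ring.
rewrite [X in _ = _ - X](_ : _ = 0).
  rewrite subr0; apply: Rint_eq => x _; have -> : 2 * T / T - 1 = 1 by field.
  by rewrite mul1r.
rewrite (@Rint_eq _ _ _ (cst 0)); first by rewrite /Defs.Rint Rintegral_cst// mul0r.
move=> x _; have -> : 2 * (T / 2) / T - 1 = 0 by field.
by rewrite !mul0r.
Qed.

End Perturbation.

(** * The perturbed path *)

Section Upper_path.
Context {R : realType}.
Implicit Types f g : R -> R.
Local Notation leb := (@lebesgue_measure R).
Local Notation intg D f := (leb.-integrable D (EFin \o f)).
Local Notation mset D := ((measurable : set (set (measurableTypeR R))) D).

(** [density] constrains the values at every real time, so the linear ramp is clipped to stay in
    [[0, 1]] on both sides. *)
Definition ramp (T t : R) : R := Num.max 0 (2 * Num.min t T / T - 1).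

(* The density is frozen after time [T]; its values there are irrelevant but must lie in [[0, 1]]. *)
Definition path g (T eps L t x : R) : R :=
  rho g (Num.min t T) x + ramp T t * phi1 eps L x.

Lemma ramp_props (T t : R) : 0 < T ->
  [/\ 0 <= ramp T t, ramp T t <= 1, (t <= T / 2 -> ramp T t = 0) &
    (T / 2 <= t <= T -> ramp T t = 2 * t / T - 1)].
Proof.
move=> T0; rewrite /ramp; split.
- by rewrite le_max lexx.
- rewrite ge_max ler01/= lerBlDr ler_pdivrMr//.
  have : Num.min t T <= T by rewrite ge_min lexx orbT.
  lra.
- move=> tT; apply/max_idPl; rewrite subr_le0 ler_pdivrMr// mul1r.
  have : Num.min t T <= t by rewrite ge_min lexx.
  lra.
- move=> /andP[t1 t2]; rewrite (min_idPl t2); apply/max_idPr.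
  by rewrite subr_ge0 ler_pdivlMr//; lra.
Qed.

Lemma rho_pos g (t x : R) : 0 < t -> rho g t x = heat t g x.
Proof. by move=> t0; rewrite /rho leNgt t0. Qed.

Lemma min_cont (T t : R) : {for t, continuous (fun s : R => Num.min s T)}.
Proof. by apply: continuous_min; [exact: cvg_id|exact: cvg_cst]. Qed.

Lemma ramp_cont (T : R) : continuous (ramp T).
Proof.
move=> t.
have h : {for t, continuous (fun s : R => 2 * Num.min s T / T - 1)}.
  apply: cvgB; last exact: cvg_cst.
  by apply: cvgM; [apply: cvgM; [exact: cvg_cst|exact: min_cont]|exact: cvg_cst].
have h0 : {for t, continuous (fun _ : R => 0 : R)} by exact: cvg_cst.
by have := continuous_max h0 h.
Qed.

(** The perturbation is at most [d / 2] and is present only after [T / 2], when the heat flow has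
    margin [d]; before that the path is the flow itself. *)
Lemma path_range g (T eps L d : R) : 0 < T -> 0 < L -> M1 g ->
  (forall t x, T / 2 <= t <= T -> d <= heat t g x <= 1 - d) -> `|eps| / L <= d / 2 ->
  (forall t x, 0 <= path g T eps L t x <= 1) /\
  (forall t x, T / 2 <= t <= T -> d / 2 <= path g T eps L t x <= 1 - d / 2).
Proof.
move=> T0 L0 Mg hd eL.
have main t x : T / 2 <= t -> d / 2 <= path g T eps L t x <= 1 - d / 2.
  move=> tT; have [r0 r1 _ _] := ramp_props t T0.
  have mT : T / 2 <= Num.min t T <= T by rewrite le_min tT ge_min lexx orbT andbT/=; lra.
  have /andP[h1 h2] := hd _ x mT.
  have m0 : 0 < Num.min t T by case/andP: mT => ? _; lra.
  have := phi1_bound eps x L0; rewrite /path rho_pos// => pb.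
  have : `|ramp T t * phi1 eps L x| <= d / 2.
    rewrite normrM (ger0_norm r0); apply: le_trans (le_trans pb eL).
    by rewrite -[leRHS]mul1r; apply: ler_wpM2r.
  by rewrite ler_norml => /andP[? ?]; apply/andP; split; lra.
have d0 : 0 <= d / 2 by apply: le_trans eL; rewrite divr_ge0// ltW.
split => t x; last by move=> /andP[tT _]; exact: main.
have [tT|tT] := leP (T / 2) t.
  by have /andP[? ?] := main t x tT; apply/andP; split; lra.
have [_ _ h _] := ramp_props t T0.
rewrite /path h ?(ltW tT)// mul0r addr0; exact: rho01.
Qed.

Lemma measurable_path g (T eps L : R) : 0 < L -> M1 g ->
  measurable_fun setT (fun q : R * R => path g T eps L q.1 q.2).
Proof.
move=> L0 Mg; apply: measurable_funD.
  have h : measurable_fun setT (fun q : R * R => (Num.min q.1 T, q.2)).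
    apply: measurable_fun_pair; last exact: measurable_snd.
    by apply: measurable_minr; [exact: measurable_fst|exact: measurable_cst].
  exact: (measurableT_comp (measurable_rho Mg) h).
apply: measurable_funM.
  have mr : measurable_fun setT (ramp T) by apply: continuous_Rmeas; exact: ramp_cont.
  exact: (measurableT_comp mr measurable_fst).
have mr : measurable_fun setT (phi1 eps L) by apply: continuous_Rmeas; exact: phi1_cont.
exact: (measurableT_comp mr measurable_snd).
Qed.

(** The path is vaguely continuous at all nonnegative times, by dominated convergence. At time 0 the
    pointwise convergence holds where [g] is continuous, hence almost everywhere. *)
Lemma path_density g (T eps L d : R) : 0 < T -> 0 < L -> M1 g -> piecewise_continuous g ->
  (forall t x, T / 2 <= t <= T -> d <= heat t g x <= 1 - d) -> `|eps| / L <= d / 2 ->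
  density T (path g T eps L).
Proof.
move=> T0 L0 Mg pg hd eL; have [p01 _] := path_range T0 L0 Mg hd eL.
have mp := measurable_path T eps L0 Mg.
have sec t : measurable_fun setT (path g T eps L t).
  exact: (measurableT_comp mp (pair1_measurable t)).
have V (t : R) (f : R -> R) : 0 <= t -> CK f ->
    (fun s => Rint setT (fun x => f x * path g T eps L s x)) @ t -->
    Rint setT (fun x => f x * path g T eps L t x).
  move=> t0 [cf [M fM]]; apply/(@cvg_nbhsP R R^o) => u ut.
  have [C C0 fC] := csupp_box cf fM.
  apply: (@Rint_cvg_dom _ _ _ _ (fun x => C * \1_(`[- M, M] : set R) x)) => //.
  - by move=> n; apply: measurable_funM => //; exact: continuous_Rmeas.
  - by apply: measurable_funM => //; exact: continuous_Rmeas.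
  - exact: intg_indic.
  - have [N [mN N0 sN]] := piecewise_continuous_ae pg.
    exists N; split => // x /= nx; apply: sN => /= cx; apply: nx => _.
    have cpx : {for t, continuous (fun s => path g T eps L s x)}.
      apply: cvgD; last by apply: cvgM; [exact: ramp_cont|exact: cvg_cst].
      apply: (continuous_comp (f := fun s => Num.min s T) (g := fun s => rho g s x)); first exact: min_cont.
      by apply: rho_time_cont => //; rewrite le_min t0 ltW.
    apply: cvgM; first exact: cvg_cst.
    exact: (cvg_comp _ _ ut cpx).
  - move=> n x _; rewrite normrM -[leRHS]mulr1; apply: ler_pM => //.
    by have /andP[? ?] := p01 (u n) x; rewrite ger0_norm.
split; first exact: p01.
split; first exact: mp.
split.
  by move=> t /andP[t0 _] f cf; apply: cvg_at_right_filter; exact: V.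
move=> t /andP[t0 _]; exists (path g T eps L t); split; first by split.
by move=> f cf; apply: cvg_at_left_filter; apply: V => //; exact: ltW.
Qed.

Lemma path0 g (T eps L x : R) : 0 < T -> path g T eps L 0 x = g x.
Proof.
move=> T0; have [_ _ h _] := ramp_props 0 T0.
by rewrite /path h ?mul0r ?addr0 ?(min_idPl (ltW T0)) /rho ?lexx//; lra.
Qed.

Lemma pathT g (T eps L x : R) : 0 < T -> path g T eps L T x = heat T g x + phi1 eps L x.
Proof.
move=> T0; have [_ _ _ h] := ramp_props T T0; have Tn : T != 0 by rewrite gt_eqF.
rewrite /path h; last by apply/andP; split; lra.
rewrite minxx /rho leNgt T0/=; congr (_ + _).
have -> : 2 * T / T - 1 = 1 by field.
by rewrite mul1r.
Qed.

Lemma Rint_phi1 (eps L a b : R) : 0 < L -> a <= b ->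
  Rint `[a, b] (phi1 eps L) = phi0 eps L b - phi0 eps L a.
Proof.
move=> L0 ab; apply: (@Rint_FTC _ _ (phi0 eps L) _ _ ab).
- by move=> x _; exact: phi1_cont.
- by move=> x _; exact: phi0_d.
Qed.

Lemma intg_bounded (f : R -> R) (a b C : R) : measurable_fun setT f ->
  (forall x, `|f x| <= C) -> intg `[a, b] f.
Proof.
move=> mf fC.
have h : intg `[a, b] (cst C) by apply: intg_cont => x _; exact: cvg_cst.
apply: (intg_dom _ _ h) => //; exact: measurable_funS mf.
Qed.

Lemma phi0_cvg (eps L : R) : 0 < L -> phi0 eps L @ +oo --> (0 : R).
Proof.
move=> L0; apply/cvgrPdist_le => e e0.
(* From [gE L x <= 2 L^2 / x^2], and from [x <= x^2] beyond 1. *)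
exists (1 + 2 * L ^+ 2 * `|eps| / e); split; first exact: num_real.
move=> x xA; rewrite sub0r normrN /phi0 normrM.
have q0 : 0 <= 2 * L ^+ 2 * `|eps| / e by rewrite divr_ge0 ?(ltW e0)// mulr_ge0// mulr_ge0// sqr_ge0.
have x1 : 1 < x by lra.
have l2 : 0 < 2 * L ^+ 2 by rewrite mulr_gt0// exprn_gt0.
have /andP[E0 E1] := gE01 x L0; rewrite (gtr0_norm E0).
have EX : gE L x <= 2 * L ^+ 2 / x ^+ 2.
  rewrite /gE mulNr expRN -[leRHS]invf_div lef_pV2 ?posrE ?expR_gt0//; last first.
    by rewrite divr_gt0// exprn_gt0//; lra.
  by have := expR_ge1Dx (x ^+ 2 / (2 * L ^+ 2)); lra.
apply: (@le_trans _ _ (`|eps| * (2 * L ^+ 2 / x ^+ 2))); first exact: ler_wpM2l.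
rewrite mulrA ler_pdivrMr; last by rewrite exprn_gt0//; lra.
have xA' : 2 * L ^+ 2 * `|eps| <= e * x.
  by rewrite mulrC -ler_pdivrMl// mulrC; lra.
have : e * x <= e * x ^+ 2 by rewrite ler_pM2l// expr2 ler_peMl//; lra.
lra.
Qed.

(** The flow contributes [vT] and the perturbation [phi0 z - phi0 0], which tends to [- eps]. *)
Lemma path_current g (T eps L rl rr : R) : 0 < T -> 0 < L -> 0 < rr < 1 -> M1rho rl rr g ->
  int0inf_eq (fun x => path g T eps L T x - path g T eps L 0 x) (vT T g - eps).
Proof.
move=> T0 L0 rr1 Hg; have Mg := Hg.1; rewrite /int0inf_eq.
have hv := vT_cvg T0 rr1 Hg.
have hp : (fun z => phi0 eps L z - eps) @ +oo --> (0 - eps).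
  by apply: cvgB; [exact: phi0_cvg|exact: cvg_cst].
have H := cvgD hv hp; rewrite sub0r in H.
have {}H := H ltac:(typeclasses eauto).
apply: (cvg_trans _ H); apply: near_eq_cvg.
exists 0; split; first exact: num_real.
move=> z /ltW z0 /=.
have p00 : phi0 eps L 0 = eps by rewrite /phi0 /gE expr0n/= oppr0 mul0r expR0 mulr1.
rewrite -[LHS]/(Rint `[0, z] (fun x => heat T g x - g x) + (phi0 eps L z - eps)).
rewrite -{2}p00 -(Rint_phi1 eps L0 z0).
have i1 : intg `[0, z] (fun x => heat T g x - g x).
  apply: (@intg_bounded _ _ _ 1).
    by apply: measurable_funB; [exact: measurable_heat_sec|exact: Mg.1].
  move=> x; have /andP[? ?] := heat01 x T0 Mg; have /andP[? ?] := Mg.2 x.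
  by rewrite ler_norml; apply/andP; split; lra.
have i2 : intg `[0, z] (phi1 eps L) by apply: intg_cont => x _; exact: phi1_cont.
have mz : mset `[0, z]%classic by exact: measurable_itv.
rewrite -[LHS](RintD mz i1 i2); apply: Rint_eq => x _.
by rewrite path0// pathT//; ring.
Qed.

Lemma oint_path g (T eps L a : R) : 0 < T -> 0 < L -> M1 g ->
  oint (path g T eps L T) 0 a = oint (heat T g) 0 a + eps * (gE L a - 1).
Proof.
move=> T0 L0 Mg.
have p0 : phi0 eps L 0 = eps by rewrite /phi0 /gE expr0n/= oppr0 mul0r expR0 mulr1.
have K (b c : R) : b <= c -> Rint `[b, c] (path g T eps L T) =
    Rint `[b, c] (heat T g) + (phi0 eps L c - phi0 eps L b).
  move=> bc; rewrite -(Rint_phi1 eps L0 bc).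
  have i1 : intg `[b, c] (heat T g).
    apply: (@intg_bounded _ _ _ 1); first exact: measurable_heat_sec.
    by move=> x; exact: M1_norm (M1_heat T0 Mg) x.
  have i2 : intg `[b, c] (phi1 eps L) by apply: intg_cont => x _; exact: phi1_cont.
  have mz : mset `[b, c]%classic by exact: measurable_itv.
  rewrite -[RHS](RintD mz i1 i2); apply: Rint_eq => x _.
  by rewrite pathT.
have E : phi0 eps L a = eps * gE L a by [].
by rewrite /oint; case: leP => [a0|/ltW a0]; rewrite K// p0 E; ring.
Qed.

(* Completing the square: [F G_x - chi G_x^2 / 2 <= F^2 / (2 m)] as soon as the mobility [chi] is at least [m]. *)
Lemma square_bound (F Gx chi m : R) : 0 < m -> m <= chi ->
  F * Gx - 2^-1 * (chi * Gx ^+ 2) <= F ^+ 2 / (2 * m).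
Proof.
move=> m0 mc; rewrite ler_pdivlMr; last by rewrite mulr_gt0.
have h1 : m * Gx ^+ 2 <= chi * Gx ^+ 2 by apply: ler_wpM2r => //; exact: sqr_ge0.
have h2 := sqr_ge0 (F - m * Gx).
have : m * (m * Gx ^+ 2) <= m * (chi * Gx ^+ 2) by rewrite ler_pM2l.
lra.
Qed.

Lemma indic_itv (a b t : R) :
  \1_(`[a, b] : set R) t = if a <= t <= b then 1 else 0 :> R.
Proof.
rewrite indicE; case: ifPn => h; first by rewrite mem_set//= in_itv.
by rewrite memNset//= in_itv/=; exact/negP.
Qed.

Lemma indic_half (T t : R) : 0 < T -> T / 2 < t ->
  \1_(`[0, T] : set R) t = \1_(`[T / 2, T] : set R) t :> R.
Proof.
by move=> T0 tT; rewrite !indic_itv (ltW tT); have -> : 0 <= t by lra.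
Qed.

Fact lfun_split_arith (a b r x y : R) : a - b - r = 0 -> a + (x + y) - b - (r + x) = y.
Proof. lra. Qed.

(** [lfun] is linear in the path and vanishes on the heat flow. For the perturbation, [phi_weak]
    cancels the terms with [hh] and leaves the flux paired with the gradient of [G]. *)
Lemma path_lfun g (T eps L : R) (G : R -> R -> R) : 0 < T -> 0 < L -> M1 g ->
  piecewise_continuous g -> C12K G ->
  intg `[T / 2, T] (fun t => Rint setT (fun x => flux T eps L t x * dx G t x)) /\
  lfun T (path g T eps L) G =
    Rint `[T / 2, T] (fun t => Rint setT (fun x => flux T eps L t x * dx G t x)).
Proof.
move=> T0 L0 Mg pg CG; have Tn : T != 0 by rewrite gt_eqF.
have [M [C [M0 C0 mh hC GC]]] := hh_data CG.
have [M' [C' [M'0 C'0 der zx bd]]] := C12K_data CG.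
have [_ [_ [_ [cGx [_ _]]]]] := CG.
have mGx : measurable_fun setT (fun q : R * R => dx G q.1 q.2) by exact: continuous_plane_measurable.
have GxC t x : `|dx G t x| <= C' * \1_(`[- M', M'] : set R) x.
  apply: box_of_supp => y; first by have [_ _ ? _] := bd t y.
  by case/(zx t).
have mfl : measurable_fun setT (fun q : R * R => flux T eps L q.1 q.2).
  apply: continuous_plane_measurable => q; apply: cvgD; apply: cvgM; try exact: cvg_cst.
    apply: (continuous_comp (f := snd) (g := phi0 eps L)); first exact: cvg_snd.
    exact: phi0_cont.
  apply: cvgM; last first.
    apply: (continuous_comp (f := snd) (g := phi2 eps L)); first exact: cvg_snd.
    exact: phi2_cont.
  apply: cvgB; last exact: cvg_cst.
  by apply: cvgM; [apply: cvgM; [exact: cvg_cst|exact: cvg_fst]|exact: cvg_cst].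
pose K := (8 / T ^+ 2 + 8 / L ^+ 4) * eps ^+ 2.
have K0 : 0 <= K.
  by rewrite mulr_ge0 ?sqr_ge0// addr_ge0// divr_ge0// exprn_ge0// ltW.
have flb t x : T / 2 <= t <= T -> `|flux T eps L t x| <= 1 + K.
  move=> tT; have h := flux_sq eps x T0 L0 tT; rewrite -/K in h.
  have /andP[E0 E1] := gE01 x L0.
  have h2 : flux T eps L t x ^+ 2 <= K.
    by apply: le_trans h _; rewrite -[leRHS]mulr1; apply: ler_wpM2l.
  have h3 := real_normK (num_real (flux T eps L t x)).
  have := sqr_ge0 (`|flux T eps L t x| - 1); nra.
have hT : T / 2 <= T by lra.
have [_ I1 _] := lfun_time_intg M'0 hT mfl flb mGx GxC.
split => //.
have mth : measurable_fun setT (fun q : R * R => ramp T q.1 * phi1 eps L q.2).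
  apply: measurable_funM.
    have mr : measurable_fun setT (ramp T) by apply: continuous_Rmeas; exact: ramp_cont.
    exact: (measurableT_comp mr measurable_fst).
  have mr : measurable_fun setT (phi1 eps L) by apply: continuous_Rmeas; exact: phi1_cont.
  exact: (measurableT_comp mr measurable_snd).
have thb t x : `|ramp T t * phi1 eps L x| <= `|eps| / L.
  have [r0 r1 _ _] := ramp_props t T0.
  rewrite normrM (ger0_norm r0); apply: le_trans (phi1_bound eps x L0).
  by rewrite -[leRHS]mul1r; apply: ler_wpM2r.
have [_ I2 _] := lfun_time_intg (a := 0) (b := T) M0 (ltW T0) mth (fun t x _ => thb t x) mh hC.
have [_ I2' _] := lfun_time_intg (a := T / 2) (b := T) M0 hT mth (fun t x _ => thb t x) mh hC.
have I3 := measurable_hh_rho Mg CG (ltW T0).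
have mG t : measurable_fun setT (G t) by apply: continuous_Rmeas; exact: C12K_sec.
have mhs t : measurable_fun setT (hh G t) by exact: (measurableT_comp mh (pair1_measurable t)).
have bm (u k : R -> R) (D : R) : measurable_fun setT u -> (forall x, `|u x| <= D) ->
    measurable_fun setT k -> (forall x, `|k x| <= C * \1_(`[- M, M] : set R) x) ->
    intg setT (fun x => u x * k x).
  move=> mu uD mk kC; apply: (@intg_box _ _ (- M) M (D * C)); first exact: measurable_funM.
  by move=> x; rewrite normrM -mulrA; apply: ler_pM.
have rs t : measurable_fun setT (rho g t).
  exact: (measurableT_comp (measurable_rho Mg) (pair1_measurable t)).
have r1 t x : `|rho g t x| <= 1 by have /andP[? ?] := rho01 t x Mg; rewrite ger0_norm.
have mphi : measurable_fun setT (phi1 eps L) by apply: continuous_Rmeas; exact: phi1_cont.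
have pb x := phi1_bound eps x L0.
have EG : Rint setT (fun x => G T x * path g T eps L T x) =
    Rint setT (fun x => G T x * rho g T x) + Rint setT (fun x => phi1 eps L x * G T x).
  rewrite (@Rint_eq _ _ _ (fun x => rho g T x * G T x + phi1 eps L x * G T x)); last first.
    by move=> x _; rewrite pathT// rho_pos//; ring.
  rewrite (RintD measurableT (bm _ _ _ (rs T) (r1 T) (mG T) (GC T)) (bm _ _ _ mphi pb (mG T) (GC T))).
  by congr (_ + _); apply: Rint_eq => x _; rewrite mulrC.
have E0 : Rint setT (fun x => G 0 x * path g T eps L 0 x) = Rint setT (fun x => G 0 x * rho g 0 x).
  by apply: Rint_eq => x _; rewrite path0// /rho lexx.
have EH : Rint `[0, T] (fun t => Rint setT (fun x => path g T eps L t x * hh G t x)) =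
    Rint `[0, T] (fun t => Rint setT (fun x => rho g t x * hh G t x)) +
    Rint `[0, T] (fun t => Rint setT (fun x => ramp T t * phi1 eps L x * hh G t x)).
  have mz : mset `[0, T]%classic by exact: measurable_itv.
  rewrite -(RintD mz I3 I2); apply: Rint_eq => t; rewrite /= in_itv/= => /andP[t0 tT].
  have mt : measurable_fun setT (fun x => ramp T t * phi1 eps L x).
    by apply: measurable_funM => //; exact: measurable_cst.
  rewrite -(RintD measurableT (bm _ _ _ (rs t) (r1 t) (mhs t) (hC t)) (bm _ _ _ mt (thb t) (mhs t) (hC t))).
  by apply: Rint_eq => x _; rewrite /path (min_idPl tT); ring.
have EC : Rint `[0, T] (fun t => Rint setT (fun x => ramp T t * phi1 eps L x * hh G t x)) =
    Rint `[T / 2, T] (fun t => Rint setT (fun x => ramp T t * phi1 eps L x * hh G t x)).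
  rewrite Rint_mkind [RHS]Rint_mkind; apply: Rint_eq => t _.
  have [tT|tT] := leP t (T / 2).
    have [_ _ r0 _] := ramp_props t T0.
    have -> : Rint setT (fun x => ramp T t * phi1 eps L x * hh G t x) = 0.
      rewrite (@Rint_eq _ _ (fun x => ramp T t * phi1 eps L x * hh G t x) (cst 0)).
        by rewrite /Defs.Rint Rintegral_cst// mul0r.
      by move=> x _; rewrite r0// !mul0r.
    by rewrite !mul0r.
  by rewrite (indic_half T0 tT).
have := lfun_rho T0 Mg pg CG; rewrite /lfun -/(hh G).
have -> : (fun t => Rint setT (fun x => path g T eps L t x * (dt G t x + 2^-1 * dx (dx G) t x))) =
  (fun t => Rint setT (fun x => path g T eps L t x * hh G t x)) by [].
have -> : (fun t => Rint setT (fun x => rho g t x * (dt G t x + 2^-1 * dx (dx G) t x))) =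
  (fun t => Rint setT (fun x => rho g t x * hh G t x)) by [].
rewrite EG E0 EH EC (phi_weak eps T0 L0 CG).
have -> : Rint `[T / 2, T] (fun t => Rint setT (fun x =>
    (2 * t / T - 1) * phi1 eps L x * hh G t x + flux T eps L t x * dx G t x)) =
  Rint `[T / 2, T] (fun t => Rint setT (fun x => ramp T t * phi1 eps L x * hh G t x)) +
  Rint `[T / 2, T] (fun t => Rint setT (fun x => flux T eps L t x * dx G t x)).
  have mz : mset `[T / 2, T]%classic by exact: measurable_itv.
  rewrite -(RintD mz I2' I1); apply: Rint_eq => t; rewrite /= in_itv/= => tT.
  have mt : measurable_fun setT (fun x => ramp T t * phi1 eps L x).
    by apply: measurable_funM => //; exact: measurable_cst.
  have mf : measurable_fun setT (flux T eps L t) by exact: (measurableT_comp mfl (pair1_measurable t)).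
  have mgx : measurable_fun setT (dx G t) by exact: (measurableT_comp mGx (pair1_measurable t)).
  have ifl : intg setT (fun x => flux T eps L t x * dx G t x).
    apply: (@intg_box _ _ (- M') M' ((1 + K) * C')); first exact: measurable_funM.
    by move=> x; rewrite normrM -mulrA; apply: ler_pM => //; exact: flb.
  rewrite -(RintD measurableT (bm _ _ _ mt (thb t) (mhs t) (hC t)) ifl).
  by apply: Rint_eq => x _; have [_ _ _ ->] := ramp_props t T0.
move=> l0; exact: (lfun_split_arith _ _ l0).
Qed.

End Upper_path.

(** * The cost of the perturbed path *)

Section Upper_bounds.
Context {R : realType}.
Implicit Types f g : R -> R.
Local Notation leb := (@lebesgue_measure R).
Local Notation intg D f := (leb.-integrable D (EFin \o f)).
Local Notation mset D := ((measurable : set (set (measurableTypeR R))) D).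

Lemma Rint_cat f (a b c C : R) : measurable_fun setT f -> (forall x, `|f x| <= C) ->
  a <= b -> b <= c -> Rint `[a, c] f = Rint `[a, b] f + Rint `[b, c] f.
Proof.
move=> mf fC ab bc.
have i1 : intg `[a, c] f by exact: intg_bounded mf fC.
have i2 : intg `]b, c] f.
  by apply: integrableS i1 => //; apply: subset_itvr; rewrite bnd_simp.
have := @Rintegral_itvB R f (BLeft a) (BRight c) b i1.
rewrite !bnd_simp => /(_ ab bc) E.
have E2 := @Rintegral_itv_obnd_cbnd R b (BRight c) f i2.
by rewrite /Defs.Rint -E2 -E addrC subrK.
Qed.

Lemma oint_add f (a b c C : R) : measurable_fun setT f -> (forall x, `|f x| <= C) ->
  oint f a b + oint f b c = oint f a c.
Proof.
move=> mf fC; have K := Rint_cat mf fC; rewrite /oint.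
case: (leP a b) => ab; case: (leP b c) => bc; case: (leP a c) => ac.
- by rewrite (K a b c).
- by lra.
- by rewrite (K a c b)// ?ltW//; lra.
- by rewrite (K c a b)// ?ltW//; lra.
- by rewrite (K b a c)// ?ltW//; lra.
- by rewrite (K b c a)// ?ltW//; lra.
- by lra.
- by rewrite (K c b a)// ?ltW//; lra.
Qed.

Lemma oint_le f (a b : R) : (forall x, `|f x| <= 1) -> `|oint f a b| <= `|b - a|.
Proof.
move=> fC.
have K (c e : R) : c <= e -> `|Rint `[c, e] f| <= e - c.
  move=> ce; rewrite Rint_mkind -[leRHS]mul1r; apply: Rint_box => // x.
  rewrite normrM; apply: ler_pM => //.
  by rewrite ger0_norm// indicE.
rewrite /oint; case: (leP a b) => [ab|/ltW ab].
  by apply: (le_trans (K a b ab)); exact: ler_norm.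
by rewrite normrN distrC; apply: (le_trans (K b a ab)); exact: ler_norm.
Qed.

Lemma oint_norm f (a b : R) m : measurable_fun setT f -> (forall x, m <= f x <= 1) -> 0 <= m ->
  m * `|b - a| <= `|oint f a b|.
Proof.
move=> mf fm m0.
have f1 x : `|f x| <= 1 by have /andP[? ?] := fm x; rewrite ger0_norm//; lra.
have K (c e : R) : c <= e -> m * (e - c) <= Rint `[c, e] f.
  move=> ce; rewrite -Rint_indic//.
  have -> : (fun x => m * \1_(`[c, e] : set R) x) = (fun x => (cst m) x * \1_(`[c, e] : set R) x) by [].
  rewrite -(Rint_mkind `[c, e]%classic (cst m)); apply: le_Rintegral.
  - exact: measurable_itv.
  - by apply: intg_cont => x _; exact: cvg_cst.
  - exact: (@intg_bounded _ f c e 1 mf f1).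
  - by move=> x _; case/andP: (fm x).
rewrite /oint; case: (leP a b) => [ab|/ltW ab].
  rewrite (@ger0_norm _ (b - a)) ?subr_ge0//; apply: le_trans (K a b ab) _; exact: ler_norm.
rewrite normrN distrC (@ger0_norm _ (a - b)) ?subr_ge0//.
apply: le_trans (K b a ab) _; exact: ler_norm.
Qed.

(** The flux lives on [[T / 2, T]], where the mobility is at least [d / 4], so the square is
    completed there. The quadratic form on the earlier half is nonnegative and enters with a minus
    sign, so it may be dropped. *)
Lemma path_quad g (T eps L d : R) (G : R -> R -> R) : 0 < T -> 0 < L -> 0 < d -> M1 g ->
  (forall t x, T / 2 <= t <= T -> d <= heat t g x <= 1 - d) -> `|eps| / L <= d / 2 ->
  C12K G ->
  Rint `[T / 2, T] (fun t => Rint setT (fun x => flux T eps L t x * dx G t x)) -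
    2^-1 * Rint `[T / 2, T] (fun t => Rint setT (fun x =>
      path g T eps L t x * (1 - path g T eps L t x) * (dx G t x) ^+ 2)) <=
  T / d * ((8 / T ^+ 2 + 8 / L ^+ 4) * eps ^+ 2 * Num.sqrt (2 * pi * L ^+ 2)) /\
  Rint `[T / 2, T] (fun t => Rint setT (fun x =>
      path g T eps L t x * (1 - path g T eps L t x) * (dx G t x) ^+ 2)) <= quadfun T (path g T eps L) G
  /\ intg `[T / 2, T] (fun t => Rint setT (fun x => flux T eps L t x * dx G t x)).
Proof.
move=> T0 L0 d0 Mg hd eL CG.
have [p01 pd] := path_range T0 L0 Mg hd eL.
have [M' [C' [M'0 C'0 der zx bd]]] := C12K_data CG.
have [_ [_ [_ [cGx [_ _]]]]] := CG.
pose chi t x := path g T eps L t x * (1 - path g T eps L t x).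
have mp := measurable_path T eps L0 Mg.
have mchi : measurable_fun setT (fun q : R * R => chi q.1 q.2).
  apply: measurable_funM; first exact: mp.
  by apply: measurable_funB; [exact: measurable_cst|exact: mp].
have chi01 t x : 0 <= chi t x <= 1.
  have /andP[h1 h2] := p01 t x; rewrite /chi; apply/andP; split; first by rewrite mulr_ge0//; lra.
  nra.
have chi1 t x : `|chi t x| <= 1 by have /andP[? ?] := chi01 t x; rewrite ger0_norm.
have mG2 : measurable_fun setT (fun q : R * R => dx G q.1 q.2 ^+ 2).
  by apply: continuous_plane_measurable => q; apply: cvgM; exact: cGx.
have mGx : measurable_fun setT (fun q : R * R => dx G q.1 q.2) by exact: continuous_plane_measurable.
have GxC t x : `|dx G t x| <= C' * \1_(`[- M', M'] : set R) x.
  apply: box_of_supp => y; first by have [_ _ ? _] := bd t y.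
  by case/(zx t).
have G2C t x : `|dx G t x ^+ 2| <= C' ^+ 2 * \1_(`[- M', M'] : set R) x.
  apply: (@box_of_supp _ (fun y => dx G t y ^+ 2)) => y.
    have [_ _ h _] := bd t y.
    by rewrite normrX lerXn2r ?nnegrE.
  by case/(zx t) => _ _ -> _; rewrite expr0n.
have hT : T / 2 <= T by lra.
have [_ IQ _] := lfun_time_intg (a := 0) (b := T) M'0 (ltW T0) mchi (fun t x _ => chi1 t x) mG2 G2C.
have [_ IQ' _] := lfun_time_intg M'0 hT mchi (fun t x _ => chi1 t x) mG2 G2C.
have mfl : measurable_fun setT (fun q : R * R => flux T eps L q.1 q.2).
  apply: continuous_plane_measurable => q; apply: cvgD; apply: cvgM; try exact: cvg_cst.
    apply: (continuous_comp (f := snd) (g := phi0 eps L)); first exact: cvg_snd.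
    exact: phi0_cont.
  apply: cvgM; last first.
    apply: (continuous_comp (f := snd) (g := phi2 eps L)); first exact: cvg_snd.
    exact: phi2_cont.
  apply: cvgB; last exact: cvg_cst.
  by apply: cvgM; [apply: cvgM; [exact: cvg_cst|exact: cvg_fst]|exact: cvg_cst].
pose K := (8 / T ^+ 2 + 8 / L ^+ 4) * eps ^+ 2.
have K0 : 0 <= K.
  by rewrite mulr_ge0 ?sqr_ge0// addr_ge0// divr_ge0// exprn_ge0// ltW.
have flb t x : T / 2 <= t <= T -> `|flux T eps L t x| <= 1 + K.
  move=> tT; have h := flux_sq eps x T0 L0 tT; rewrite -/K in h.
  have /andP[E0 E1] := gE01 x L0.
  have h2 : flux T eps L t x ^+ 2 <= K.
    by apply: le_trans h _; rewrite -[leRHS]mulr1; apply: ler_wpM2l.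
  have h3 := real_normK (num_real (flux T eps L t x)).
  have := sqr_ge0 (`|flux T eps L t x| - 1); nra.
have [_ I1 _] := lfun_time_intg M'0 hT mfl flb mGx GxC.
pose Q t := Rint setT (fun x => chi t x * dx G t x ^+ 2).
have Q0 t : 0 <= Q t.
  apply: Rintegral_ge0 => x _; rewrite mulr_ge0 ?sqr_ge0//; by case/andP: (chi01 t x).
split; [|split]; last exact: I1.
(* [square_bound] with [m = d / 4], integrated over space by means of the mass [sqrt (2 pi L^2)] of
   [gE]; multiplied by the duration [T / 2] it gives the factor [T / d]. *)
- pose c0 := K * Num.sqrt (2 * pi * L ^+ 2) / (2 * (d / 4)).
  have mz : mset `[T / 2, T]%classic by exact: measurable_itv.
  rewrite -/(Q) -(RintZ 2^-1 mz IQ') -(RintB mz I1 (intgZ 2^-1 mz IQ')).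
  have ptw t : T / 2 <= t <= T ->
      Rint setT (fun x => flux T eps L t x * dx G t x) - 2^-1 * Q t <= c0.
    move=> tT.
    have mf : measurable_fun setT (flux T eps L t) by exact: (measurableT_comp mfl (pair1_measurable t)).
    have mgx : measurable_fun setT (dx G t) by exact: (measurableT_comp mGx (pair1_measurable t)).
    have mg2 : measurable_fun setT (fun x => dx G t x ^+ 2) by exact: (measurableT_comp mG2 (pair1_measurable t)).
    have mc : measurable_fun setT (chi t) by exact: (measurableT_comp mchi (pair1_measurable t)).
    have i1 : intg setT (fun x => flux T eps L t x * dx G t x).
      apply: (@intg_box _ _ (- M') M' ((1 + K) * C')); first exact: measurable_funM.
      by move=> x; rewrite normrM -mulrA; apply: ler_pM => //; exact: flb.
    have i2 : intg setT (fun x => chi t x * dx G t x ^+ 2).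
      apply: (@intg_box _ _ (- M') M' (C' ^+ 2)); first exact: measurable_funM.
      by move=> x; rewrite normrM -[leRHS]mul1r; apply: ler_pM => //; exact: chi1.
    have [iE RE] := gE_int L0.
    rewrite /Q -(RintZ 2^-1 measurableT i2) -(RintB measurableT i1 (intgZ 2^-1 measurableT i2)).
    have -> : c0 = Rint setT (fun x => (K / (2 * (d / 4))) * gE L x).
      by rewrite (RintZ _ measurableT iE) RE /c0 mulrAC.
    apply: le_Rintegral => //.
    + exact: intgB measurableT i1 (intgZ 2^-1 measurableT i2).
    + exact: intgZ.
    + move=> x _; have d4 : 0 < d / 4 by rewrite divr_gt0.
      have mc4 : d / 4 <= chi t x.
        have /andP[h1 h2] := pd t x tT; rewrite /chi.
        (* The product of the two margins gives [chi >= (d / 2) (1 - d / 2)], and [d <= 1] because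
           the interval [[d / 2, 1 - d / 2]] is nonempty. *)
        have := mulr_ge0 (_ : 0 <= path g T eps L t x - d / 2) (_ : 0 <= 1 - d / 2 - path g T eps L t x).
        move=> /(_ ltac:(by rewrite subr_ge0) ltac:(by rewrite subr_ge0)).
        move: (path g T eps L t x) h1 h2 d0 => p h1 h2 d0 {}; nra.
      apply: le_trans (square_bound (flux T eps L t x) (dx G t x) d4 mc4) _.
      rewrite [X in _ <= X]mulrAC; apply: ler_wpM2r; first by rewrite invr_ge0 mulr_ge0// ltW.
      exact: flux_sq.
  apply: (@le_trans _ _ (Rint `[T / 2, T] (cst c0))).
    apply: le_Rintegral => //.
    + exact: intgB mz I1 (intgZ 2^-1 mz IQ').
    + by apply: intg_cont => x _; exact: cvg_cst.
  rewrite /Defs.Rint Rintegral_cst//= lebesgue_measure_itv/= lte_fin.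
  have -> : T / 2 < T by lra.
  rewrite /= /c0 -/K; set s := Num.sqrt _.
  have -> : K * s / (2 * (d / 4)) * (T - T / 2) = T / d * (K * s) by field; rewrite gt_eqF.
  by [].
- rewrite /quadfun -/(Q).
  have := @Rintegral_itvB R Q (BLeft 0) (BRight T) (T / 2) IQ.
  rewrite !bnd_simp => /(_ ltac:(lra) ltac:(lra)) E.
  have i2 : intg `]T / 2, T] Q.
    by apply: integrableS IQ => //; apply: subset_itvr; rewrite bnd_simp; lra.
  have E2 := @Rintegral_itv_obnd_cbnd R (T / 2) (BRight T) Q i2.
  rewrite /Defs.Rint -E2 -E lerBlDr lerDl.
  by apply: Rintegral_ge0 => t _; exact: Q0.
Qed.

Lemma path_I0 g (T eps L d : R) : 0 < T -> 0 < L -> 0 < d -> M1 g -> piecewise_continuous g ->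
  (forall t x, T / 2 <= t <= T -> d <= heat t g x <= 1 - d) -> `|eps| / L <= d / 2 ->
  (I0 T (path g T eps L) <=
    (T / d * ((8 / T ^+ 2 + 8 / L ^+ 4) * eps ^+ 2 * Num.sqrt (2 * pi * L ^+ 2)))%:E)%E.
Proof.
move=> T0 L0 d0 Mg pg hd eL; apply: ge_ereal_sup => _ /= [G CG <-].
rewrite lee_fin.
have [h1 [h2 h3]] := path_quad T0 L0 d0 Mg hd eL CG.
have [_ ->] := path_lfun eps T0 L0 Mg pg CG.
apply: le_trans h1; rewrite lerB// ler_pM2l//.
Qed.

Lemma bern_ent_refl (m : R) : 0 < m < 1 -> bern_ent m m = 0.
Proof.
move=> /andP[m0 m1]; have n0 : m != 0 by rewrite gt_eqF.
have n1 : 1 - m != 0 by rewrite gt_eqF// subr_gt0.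
by rewrite /bern_ent (gt_eqF m0) (lt_eqF m1) !divff// ln1 !mulr0 addr0.
Qed.

Lemma hent_refl g : (forall x, 0 < g x < 1) -> hent g g = 0%E.
Proof.
move=> g01; rewrite /hent (eq_integral (cst 0%E)); first by rewrite integral0.
by move=> x _; rewrite bern_ent_refl.
Qed.

Lemma profile_M1 md (rl rr : R) g : profile md rl rr g -> M1rho rl rr g /\ piecewise_continuous g.
Proof. by case: md => [[? [? _]]|]. Qed.

(** The flux has one part of order [eps / T] and one of order [eps / L^2], both on a length of order
    [L]; their squares give the terms [L] and [L^-3]. The last two clauses are equalities, so that
    the constraints on the current and on the tagged particle can be met exactly. *)
Lemma upper_path md (T rl rr : R) g : 0 < T -> 0 < rl < 1 -> 0 < rr < 1 -> profile md rl rr g ->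
  exists d C : R, [/\ 0 < d, 0 <= C & forall eps L : R, 0 < L -> `|eps| / L <= d ->
    exists mu : R -> R -> R, [/\ density T mu, (Igam md T g mu <= (C * eps ^+ 2 * (L + L ^- 3))%:E)%E,
      int0inf_eq (fun x => mu T x - mu 0 x) (vT T g - eps) &
      forall a, oint (mu T) 0 a = oint (heat T g) 0 a + eps * (gE L a - 1)]].
Proof.
move=> T0 rl01 rr01 pr; have [Hg pg] := profile_M1 pr; have Mg := Hg.1.
have [d d0 hd] := heat_bounds T0 rl01 rr01 Hg.
exists (d / 2), (T / d * (8 / T ^+ 2 + 8) * Num.sqrt (2 * pi)).
have Td : 0 < T / d by rewrite divr_gt0.
have T2 : 0 <= 8 / T ^+ 2 by rewrite divr_ge0 ?sqr_ge0.
split; first lra.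
  by rewrite mulr_ge0 ?sqrtr_ge0// mulr_ge0 ?(ltW Td)//; lra.
move=> eps L L0 eL; exists (path g T eps L); split.
- exact: path_density pg hd eL.
- have I0b : (I0 T (path g T eps L) <= (T / d * (8 / T ^+ 2 + 8) * Num.sqrt (2 * pi) * eps ^+ 2 * (L + L ^- 3))%:E)%E.
    apply: le_trans (path_I0 T0 L0 d0 Mg pg hd eL) _; rewrite lee_fin.
    have -> : Num.sqrt (2 * pi * L ^+ 2) = Num.sqrt (2 * pi) * L.
      by rewrite sqrtrM ?mulr_ge0 ?pi_ge0// sqrtr_sqr gtr0_norm.
    have s0 : 0 <= Num.sqrt (2 * pi) :> R by exact: sqrtr_ge0.
    set s := Num.sqrt _ in s0 *.
    have Ln : L != 0 by rewrite gt_eqF.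
    have -> : T / d * ((8 / T ^+ 2 + 8 / L ^+ 4) * eps ^+ 2 * (s * L)) =
      (T / d * s * eps ^+ 2) * (8 / T ^+ 2 * L + 8 * L ^- 3) by field; rewrite ?Ln ?gt_eqF.
    have -> : T / d * (8 / T ^+ 2 + 8) * s * eps ^+ 2 * (L + L ^- 3) =
      (T / d * s * eps ^+ 2) * ((8 / T ^+ 2 + 8) * (L + L ^- 3)) by ring.
    apply: ler_wpM2l; first by rewrite mulr_ge0 ?sqr_ge0// mulr_ge0// ltW.
    have l3 : 0 <= L ^- 3 by rewrite invr_ge0 exprn_ge0// ltW.
    have := mulr_ge0 T2 l3; have := ltW L0; nra.
  (* Starting exactly from [g], the path satisfies the (DIC) constraint and has zero initial entropy
     under (LEM). *)
  have p0 : path g T eps L 0 = g by apply/funext => x; exact: path0.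
  case: md pr => pr /=; last first.
    have -> : `[< {ae leb, forall x, path g T eps L 0 x = g x} >] = true.
      by apply/asboolP; rewrite p0; exact: aeW.
    exact: I0b.
  by rewrite p0 hent_refl ?adde0//; case: pr => _ [].
- exact: path_current rr01 Hg.
- by move=> a; exact: oint_path.
Qed.

Lemma limf_esup_le (f : R -> \bar R) (F : set_system R) (V : set R) (c : R) :
  F V -> (forall a, V a -> (f a <= c%:E)%E) -> (limf_esup f F <= c%:E)%E.
Proof.
move=> FV fc; apply: (@le_trans _ _ (ereal_sup (f @` V))).
  by apply: ereal_inf_lbound; exists V.
by apply: ge_ereal_sup => _ [a Va <-]; exact: fc.
Qed.

Lemma Jrate_le md (T C : R) g mu (a : R) : density T mu -> (Igam md T g mu <= C%:E)%E ->
  int0inf_eq (fun x => mu T x - mu 0 x) a -> (Jrate md T g a <= C%:E)%E.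
Proof.
move=> dm Im cm; have Ioo : (Igam md T g mu < +oo)%E by exact: le_lt_trans Im (ltry _).
by apply: le_trans Im; apply: ereal_inf_lbound; exists mu.
Qed.

Lemma Irate_le md (T C : R) g mu (a : R) : density T mu -> (Igam md T g mu <= C%:E)%E ->
  int0inf_eq (fun x => mu T x - mu 0 x) (oint (mu T) 0 a) -> (Irate md T g a <= C%:E)%E.
Proof.
move=> dm Im cm; have Ioo : (Igam md T g mu < +oo)%E by exact: le_lt_trans Im (ltry _).
by apply: le_trans Im; apply: ereal_inf_lbound; exists mu.
Qed.

Lemma scaled_le (w C c : R) (x : \bar R) : 0 <= w -> (x <= C%:E)%E -> w * C <= c ->
  (w%:E * x <= c%:E)%E.
Proof.
move=> w0 xC wC; apply: (@le_trans _ _ (w%:E * C%:E)%E).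
  by apply: lee_wpmul2l => //; rewrite lee_fin.
by rewrite -EFinM lee_fin.
Qed.

End Upper_bounds.

(** * The four upper limits *)

Section Upper_limits.
Context {R : realType}.
Implicit Types f g : R -> R.

Lemma dnbhs_ball (v r : R) (V : set R) : 0 < r ->
  (forall a, a != v -> `|a - v| < r -> V a) -> (v^') V.
Proof.
move=> r0 rV; apply/nbhs_ballP; exists r => //= a; rewrite /ball/= distrC => va av.
exact: rV.
Qed.

Fact cost_small (C e L2 w : R) : 0 <= C -> e ^+ 2 <= L2 -> 0 < w -> 
  w * (C * e ^+ 2 * (1 + 1 ^- 3)) <= w * (C * L2 * 2).
Proof.
move=> C0 eL w0; rewrite expr1n invr1; have -> : 1 + 1 = 2 :> R by ring.
by rewrite ler_pM2l// ler_wpM2r// ler_wpM2l.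
Qed.

(** The width is [L = K a] and the mass at most [m a]. Since [(K a)^-3 <= 1 <= a], the sum
    [L + L^-3] is at most [(K + 1) a], which makes the whole cost cubic in [a]. *)
Fact cost_large (C e K a m T : R) : 0 <= C -> 0 < T -> 0 < K -> 1 <= a -> 1 <= K * a -> `|e| <= m * a -> 0 <= m ->
  T / a ^+ 3 * (C * e ^+ 2 * (K * a + (K * a) ^- 3)) <= T * (C * m ^+ 2 * (K + 1)).
Proof.
move=> C0 T0 K0 a1 Ka em m0; have a0 : 0 < a by lra.
have an : a != 0 by rewrite gt_eqF.
rewrite -mulrA ler_pM2l// ler_pdivrMl ?exprn_gt0//.
have h1 : (K * a) ^- 3 <= a.
  apply: le_trans a1; rewrite invf_le1 ?exprn_gt0//; last by lra.
  exact: exprn_ege1.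
have h2 : e ^+ 2 <= m ^+ 2 * a ^+ 2.
  rewrite -exprMn -[e ^+ 2]real_normK ?num_real// lerXn2r ?nnegrE//.
  by rewrite mulr_ge0// ltW.
have h3 : K * a + (K * a) ^- 3 <= (K + 1) * a by rewrite mulrDl mul1r lerD2l.
rewrite -mulrA; have -> : a ^+ 3 * (C * m ^+ 2 * (K + 1)) = C * ((m ^+ 2 * a ^+ 2) * ((K + 1) * a)) by ring.
apply: ler_wpM2l => //; apply: ler_pM => //; first exact: sqr_ge0.
by rewrite addr_ge0// ?mulr_ge0 ?(ltW K0) ?(ltW a0)// invr_ge0 exprn_ge0// mulr_ge0// ltW.
Qed.

Lemma J_upper_near md (T rl rr : R) g : 0 < T -> 0 < rl < 1 -> 0 < rr < 1 -> profile md rl rr g ->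
  exists2 c : R, 0 <= c &
    (limf_esup (fun a => ((Num.sqrt T / (a - vT T g) ^+ 2)%:E * Jrate md T g a)%E)
         (vT T g)^' <= c%:E)%E.
Proof.
move=> T0 rl01 rr01 pr; have [d [C [d0 C0 H]]] := upper_path T0 rl01 rr01 pr.
exists (2 * C * Num.sqrt T); first by rewrite !mulr_ge0 ?sqrtr_ge0.
apply: (limf_esup_le (V := [set a | a != vT T g /\ `|a - vT T g| < d])).
  by apply: (dnbhs_ball d0) => a h1 h2; split.
move=> a [av ad].
(* Width 1 is admissible because the mass to be moved is below [d]. *)
have [mu [dm Im cm _]] := H (vT T g - a) 1 ltr01 ltac:(by rewrite divr1 distrC ltW).
have -> : a = vT T g - (vT T g - a) by ring.
have q0 : 0 < (a - vT T g) ^+ 2.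
  by rewrite lt_neqAle sqr_ge0 andbT eq_sym expf_neq0// subr_eq0.
have e : vT T g - (vT T g - a) = a by ring.
apply: (scaled_le _ (Jrate_le dm Im cm)); rewrite e.
  by rewrite divr_ge0 ?sqrtr_ge0// ltW.
have w0 : 0 < Num.sqrt T / (a - vT T g) ^+ 2 by rewrite divr_gt0// sqrtr_gt0.
apply: (le_trans (cost_small (L2 := (a - vT T g) ^+ 2) C0 _ w0)).
  by rewrite -sqrrN opprB.
move: q0 => /lt0r_neq0; set q := (_ ^+ 2) => qn.
by rewrite le_eqVlt; apply/orP; left; apply/eqP; field.
Qed.

Lemma J_upper_far md (T rl rr : R) g : 0 < T -> 0 < rl < 1 -> 0 < rr < 1 -> profile md rl rr g ->
  exists2 c : R, 0 <= c &
    (limf_esup (fun a => ((T / `|a| ^+ 3)%:E * Jrate md T g a)%E) abs_infty <= c%:E)%E.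
Proof.
move=> T0 rl01 rr01 pr; have [d [C [d0 C0 H]]] := upper_path T0 rl01 rr01 pr.
(* The mass to be moved is at most [2 |a|], so the width [K |a|] keeps the ratio of mass to width at
   most [d]. *)
pose K := 2 / d; have K0 : 0 < K by rewrite divr_gt0.
exists (T * (C * 2 ^+ 2 * (K + 1))).
  by rewrite !mulr_ge0 ?(ltW T0)// ?sqr_ge0//; lra.
have Ki : 0 < K^-1 by rewrite invr_gt0.
apply: (limf_esup_le (V := [set a | `|vT T g| + 1 + K^-1 < `|a|])).
  by exists (`|vT T g| + 1 + K^-1).
move=> a /= aM; have v0 := normr_ge0 (vT T g).
have a1 : 1 <= `|a| by lra.
have Ka : 1 <= K * `|a| by rewrite mulrC -ler_pdivrMr// mul1r; lra.
have L0 : 0 < K * `|a| by lra.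
have eb : `|vT T g - a| <= 2 * `|a| by apply: (le_trans (ler_normB _ _)); lra.
have eL : `|vT T g - a| / (K * `|a|) <= d.
  rewrite ler_pdivrMr//; apply: (le_trans eb); rewrite mulrA.
  by have -> : d * K = 2 by rewrite /K; field; rewrite gt_eqF.
have [mu [dm Im cm _]] := H _ _ L0 eL.
have e : vT T g - (vT T g - a) = a by ring.
rewrite e in cm.
apply: (scaled_le _ (Jrate_le dm Im cm)).
  by rewrite divr_ge0 ?(ltW T0)// exprn_ge0.
exact: cost_large.
Qed.

Section Tagged.
Variables (md : init_cond) (T rl rr u : R) (g : R -> R).
Hypotheses (T0 : 0 < T) (rl01 : 0 < rl < 1) (rr01 : 0 < rr < 1).
Hypothesis pr : profile md rl rr g.
Hypothesis uE : oint (heat T g) 0 u = vT T g.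

Let Hh : M1 (heat T g).
Proof. by have [[Mg _] _] := profile_M1 pr; exact: M1_heat. Qed.

(** By the defining equation of [u] the left side is the mass of the flow between [a] and [u], and
    the flow is at most 1. *)
Let current_le a : `|vT T g - oint (heat T g) 0 a| <= `|a - u|.
Proof.
have h := oint_add a u 0 Hh.1 (M1_norm Hh).
have := oint_add 0 a u Hh.1 (M1_norm Hh); rewrite uE => <-.
rewrite addrAC subrr add0r distrC; exact: oint_le (M1_norm Hh).
Qed.

Let gE_le (L x y : R) : 0 < L -> `|x| <= `|y| -> gE L y <= gE L x.
Proof.
move=> L0 xy; rewrite /gE ler_expR !mulNr lerN2; apply: ler_wpM2r.
  by rewrite invr_ge0 mulr_ge0// sqr_ge0.
by rewrite -[x ^+ 2]real_normK ?num_real// -[y ^+ 2]real_normK ?num_real// lerXn2r ?nnegrE.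
Qed.

(** The current of the path is [vT - eps], and the mass between 0 and [a] is that of the flow plus
    [eps (gE L a - 1)]. Equating them gives a linear equation with coefficient [gE L a > 0], solved
    by this [eps]. *)
Let constraint a L (mu : R -> R -> R) (eps := (vT T g - oint (heat T g) 0 a) / gE L a) :
  0 < L -> oint (mu T) 0 a = oint (heat T g) 0 a + eps * (gE L a - 1) ->
  oint (mu T) 0 a = vT T g - eps.
Proof.
move=> L0 ->; have /andP[E0 _] := gE01 a L0.
by rewrite /eps; field; rewrite gt_eqF.
Qed.

Lemma I_upper_near : exists2 c : R, 0 <= c &
    (limf_esup (fun a => ((Num.sqrt T / (a - u) ^+ 2)%:E * Irate md T g a)%E) u^' <= c%:E)%E.
Proof.
have [d [C [d0 C0 H]]] := upper_path T0 rl01 rr01 pr.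
(* A lower bound for the denominator [gE 1 a] as long as [|a - u| < 1]; the radius [d * w] below
   then gives [|eps| <= d]. *)
pose w := gE 1 (`|u| + 1); have /andP[w0 w1] : 0 < w <= 1 by exact: gE01.
exists (2 * C * Num.sqrt T / w ^+ 2); first by rewrite divr_ge0 ?sqr_ge0// !mulr_ge0 ?sqrtr_ge0.
pose r := Num.min 1 (d * w).
have r0 : 0 < r by rewrite lt_min ltr01 mulr_gt0.
apply: (limf_esup_le (V := [set a | a != u /\ `|a - u| < r])).
  by apply: (dnbhs_ball r0) => a h1 h2; split.
move=> a [av]; rewrite lt_min => /andP[a1 ad].
have wa : w <= gE 1 a.
  apply: gE_le => //; rewrite [`|_ + 1|]ger0_norm ?addr_ge0//.
  have := ler_normD u (a - u); rewrite addrC subrK; lra.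
have E0 : 0 < gE 1 a by exact: lt_le_trans wa.
pose eps := (vT T g - oint (heat T g) 0 a) / gE 1 a.
have epsb : `|eps| <= `|a - u| / w.
  rewrite /eps normrM normfV (gtr0_norm E0); apply: ler_pM => //.
    by rewrite invr_ge0 ltW.
  by rewrite lef_pV2 ?posrE.
have eL : `|eps| / 1 <= d.
  by rewrite divr1; apply: (le_trans epsb); rewrite ler_pdivrMr// ltW.
have [mu [dm Im cm om]] := H _ _ ltr01 eL.
rewrite -(constraint ltr01 (om a)) in cm.
have q0 : 0 < (a - u) ^+ 2.
  by rewrite lt_neqAle sqr_ge0 andbT eq_sym expf_neq0// subr_eq0.
have wg : 0 < Num.sqrt T / (a - u) ^+ 2 by rewrite divr_gt0// sqrtr_gt0.
apply: (scaled_le (ltW wg) (Irate_le dm Im cm)).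
apply: (le_trans (cost_small (L2 := (a - u) ^+ 2 / w ^+ 2) C0 _ wg)).
  rewrite -expr_div_n -[eps ^+ 2]real_normK ?num_real// -[((a - u) / w) ^+ 2]real_normK ?num_real//.
  rewrite lerXn2r ?nnegrE//; apply: (le_trans epsb).
  by rewrite normrM normfV (gtr0_norm w0).
move: q0 => /lt0r_neq0; set q := ((a - u) ^+ 2) => qn.
rewrite le_eqVlt; apply/orP; left; apply/eqP; field.
by rewrite qn gt_eqF.
Qed.

Lemma I_upper_far : exists2 c : R, 0 <= c &
    (limf_esup (fun a => ((T / `|a| ^+ 3)%:E * Irate md T g a)%E) abs_infty <= c%:E)%E.
Proof.
have [d [C [d0 C0 H]]] := upper_path T0 rl01 rr01 pr.
pose w : R := gE 1 1; have /andP[w0 w1] : 0 < w <= 1 by exact: gE01.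
have w2 : 0 < 2 / w by rewrite divr_gt0.
(* [K >= 1] gives [gE (K |a|) a >= gE 1 1 = w], hence [|eps| <= (2 / w) |a|]; the second summand
   makes the ratio of [|eps|] to the width at most [d]. *)
pose K := 1 + 2 / w / d; have Kd : 0 < 2 / w / d by rewrite divr_gt0.
have K1 : 1 <= K by rewrite /K; lra.
have K0 : 0 < K by lra.
exists (T * (C * (2 / w) ^+ 2 * (K + 1))).
  by rewrite !mulr_ge0 ?(ltW T0)// ?sqr_ge0//; lra.
apply: (limf_esup_le (V := [set a | `|u| + 1 < `|a|])); first by exists (`|u| + 1).
move=> a /= aM; have v0 := normr_ge0 u.
have a1 : 1 <= `|a| by lra.
have a0 : 0 < `|a| by lra.
have Ka : 1 <= K * `|a| by rewrite -[leLHS]mulr1; apply: ler_pM.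
have L0 : 0 < K * `|a| by lra.
have wa : w <= gE (K * `|a|) a.
  rewrite /w /gE ler_expR !mulNr lerN2 expr1n mulr1 exprMn real_normK ?num_real//.
  have an : a ^+ 2 != 0 by rewrite expf_neq0// -normr_eq0 gt_eqF.
  have Kn : K != 0 by rewrite gt_eqF.
  have -> : a ^+ 2 / (2 * (K ^+ 2 * a ^+ 2)) = (2 * K ^+ 2)^-1.
    by field; rewrite ?Kn// -normr_eq0 gt_eqF.
  rewrite mul1r lef_pV2 ?posrE ?mulr_gt0// ?exprn_gt0//.
  by rewrite -[leLHS]mulr1; apply: ler_pM => //; exact: exprn_ege1.
have E0 : 0 < gE (K * `|a|) a by exact: lt_le_trans wa.
pose eps := (vT T g - oint (heat T g) 0 a) / gE (K * `|a|) a.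
have au : `|a - u| <= 2 * `|a| by apply: (le_trans (ler_normB _ _)); lra.
have epsb : `|eps| <= 2 / w * `|a|.
  apply: (@le_trans _ _ (`|a - u| / w)).
    rewrite /eps normrM normfV (gtr0_norm E0); apply: ler_pM => //.
      by rewrite invr_ge0 ltW.
    by rewrite lef_pV2 ?posrE.
  by rewrite mulrAC; apply: ler_wpM2r => //; rewrite invr_ge0 ltW.
have eL : `|eps| / (K * `|a|) <= d.
  rewrite ler_pdivrMr//; apply: (le_trans epsb); rewrite mulrA; apply: ler_wpM2r => //.
  rewrite /K mulrDr mulr1; have -> : d * (2 / w / d) = 2 / w by field; rewrite !gt_eqF.
  by rewrite lerDr ltW.
have [mu [dm Im cm om]] := H _ _ L0 eL.
rewrite -(constraint L0 (om a)) in cm.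
apply: (scaled_le _ (Irate_le dm Im cm)).
  by rewrite divr_ge0 ?(ltW T0)// exprn_ge0.
by apply: cost_large => //; exact: ltW.
Qed.

End Tagged.

End Upper_limits.

(** * Test functions *)

Section Test_functions.
Context {R : realType}.
Implicit Types f g : R -> R.

Definition pos (x : R) : R := Num.max x 0.

Lemma pos_cont : continuous pos.
Proof.
move=> x; have h1 : {for x, continuous (fun y : R => y)} by exact: cvg_id.
have h2 : {for x, continuous (fun _ : R => 0 : R)} by exact: cvg_cst.
by have := continuous_max h1 h2.
Qed.

Lemma pos_id (x : R) : 0 <= x -> pos x = x.
Proof. by move=> x0; rewrite /pos max_l. Qed.

Lemma pos_0 (x : R) : x <= 0 -> pos x = 0.
Proof. by move=> x0; rewrite /pos max_r. Qed.

Lemma is_derive_pow (n : nat) (x : R) :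
  is_derive x 1 (fun y : R => y ^+ n.+1) (n.+1%:R * x ^+ n).
Proof.
have hid : is_derive x 1 (fun y : R => y) 1 by exact: is_derive_id.
elim: n => [|n IH]; first by rewrite expr0 mulr1; exact: hid.
have -> : (fun y : R => y ^+ n.+2) = (fun y : R => y * y ^+ n.+1).
  by apply/funext => y; rewrite exprS.
apply: is_derive_eq (is_derive_mul hid IH) _.
by rewrite [n.+2%:R]mulrS exprS; ring.
Qed.

(** At the kink the difference quotient is itself a positive power of [pos], continuous and 0 at 0,
    so the Caratheodory form of the derivative applies. *)
Lemma is_derive_pos (n : nat) (x : R) :
  is_derive x 1 (fun y => pos y ^+ n.+2) (n.+2%:R * pos x ^+ n.+1).
Proof.
have [x0|x0|->] := ltgtP x 0.
- rewrite pos_0 ?ltW// expr0n/= mulr0.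
  have h : is_derive x 1 (cst 0 : R -> R) 0 by exact: is_derive_cst.
  apply: near_eq_is_derive h.
  have : \near x, x < 0 by exact: lt_nbhsl.
  by apply: filterS => y y0; rewrite /= pos_0 ?ltW// expr0n.
- rewrite pos_id ?ltW//.
  have h : is_derive x 1 (fun y : R => y ^+ n.+2) (n.+2%:R * x ^+ n.+1).
    exact: is_derive_pow.
  apply: near_eq_is_derive h.
  have : \near x, 0 < x by exact: lt_nbhsr.
  by apply: filterS => y y0; rewrite pos_id ?ltW.
- rewrite pos_0// expr0n/= mulr0.
  apply/is_derive1_caratheodory; exists (fun z => pos z ^+ n.+1); split.
  + move=> z; rewrite (pos_0 (lexx 0)) expr0n/= !subr0.
    have [z0|z0] := leP 0 z; first by rewrite pos_id// -exprSr.
    by rewrite pos_0 ?(ltW z0)// !expr0n/= mul0r.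
  + by apply: (continuous_comp (f := pos) (g := fun y => y ^+ n.+1)); [exact: pos_cont|exact: exprn_continuous].
  + by rewrite pos_0// expr0n.
Qed.

(* Integrated quadratic B-spline: a [C^2] step from [0] (for [x <= 0]) to [1] (for [3 <= x]). *)
Definition step (x : R) : R :=
  (pos x ^+ 3 - 3 * pos (x - 1) ^+ 3 + 3 * pos (x - 2) ^+ 3 - pos (x - 3) ^+ 3) / 6.
Definition step1 (x : R) : R :=
  (pos x ^+ 2 - 3 * pos (x - 1) ^+ 2 + 3 * pos (x - 2) ^+ 2 - pos (x - 3) ^+ 2) / 2.
Definition step2 (x : R) : R :=
  pos x - 3 * pos (x - 1) + 3 * pos (x - 2) - pos (x - 3).

Lemma is_derive_affine (f : R -> R) (a w x l : R) : w != 0 ->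
  is_derive ((x - a) / w) 1 f l -> is_derive x 1 (fun y => f ((y - a) / w)) (l / w).
Proof.
move=> w0 h; have h2 : is_derive x 1 (fun y => (y - a) / w) w^-1.
  by apply: is_derive_eq; rewrite /GRing.scale/=; ring.
exact: (@is_derive1_comp R f (fun y => (y - a) / w) x l _ h h2).
Qed.

Lemma is_derive_shiftf (f : R -> R) (a x l : R) :
  is_derive (x - a) 1 f l -> is_derive x 1 (fun y => f (y - a)) l.
Proof.
move=> h; have h2 : is_derive x 1 (fun y => y - a) 1 by apply: is_derive_eq; rewrite subr0.
by have := @is_derive1_comp R f (fun y => y - a) x l _ h h2; rewrite mulr1.
Qed.

Lemma is_derive_cmul (c : R) (f : R -> R) (x l : R) :
  is_derive x 1 f l -> is_derive x 1 (fun y => c * f y) (c * l).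
Proof.
move=> h; have hc : is_derive x 1 (fun _ : R => c) 0 by exact: is_derive_cst.
by have := is_derive_mul hc h; rewrite mul0r add0r.
Qed.

Lemma step_d (x : R) : is_derive x 1 step (step1 x).
Proof.
have h0 : is_derive x 1 (fun y => pos y ^+ 3) (3 * pos x ^+ 2) by exact: is_derive_pos.
have h (a : R) : is_derive x 1 (fun y => pos (y - a) ^+ 3) (3 * pos (x - a) ^+ 2).
  by apply: (@is_derive_shiftf (fun y => pos y ^+ 3)); exact: is_derive_pos.
have h1 := is_derive_cmul 3 (h 1); have h2 := is_derive_cmul 3 (h 2); have h3 := h 3.
have k := is_deriveB (is_deriveD (is_deriveB h0 h1) h2) h3.
have e := is_derive_cmul 6^-1 k.
have -> : step = (fun y => 6^-1 * ((fun y => pos y ^+ 3) - (fun y => 3 * pos (y - 1) ^+ 3)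
   + (fun y => 3 * pos (y - 2) ^+ 3) - (fun y => pos (y - 3) ^+ 3)) y).
  by apply/funext => y; rewrite /step mulrC.
by apply: is_derive_eq e _; rewrite /step1; field.
Qed.

Lemma step1_d (x : R) : is_derive x 1 step1 (step2 x).
Proof.
have h0 : is_derive x 1 (fun y => pos y ^+ 2) (2 * pos x ^+ 1) by exact: is_derive_pos.
have h (a : R) : is_derive x 1 (fun y => pos (y - a) ^+ 2) (2 * pos (x - a) ^+ 1).
  by apply: (@is_derive_shiftf (fun y => pos y ^+ 2)); exact: is_derive_pos.
have h1 := is_derive_cmul 3 (h 1); have h2 := is_derive_cmul 3 (h 2); have h3 := h 3.
have k := is_deriveB (is_deriveD (is_deriveB h0 h1) h2) h3.
have e := is_derive_cmul 2^-1 k.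
have -> : step1 = (fun y => 2^-1 * ((fun y => pos y ^+ 2) - (fun y => 3 * pos (y - 1) ^+ 2)
   + (fun y => 3 * pos (y - 2) ^+ 2) - (fun y => pos (y - 3) ^+ 2)) y).
  by apply/funext => y; rewrite /step1 mulrC.
by apply: is_derive_eq e _; rewrite /step2 !expr1; field.
Qed.

Lemma step2_cont : continuous step2.
Proof.
have h (a : R) : continuous (fun x => pos (x - a)).
  move=> x; apply: (continuous_comp (f := fun x => x - a) (g := pos)); last exact: pos_cont.
  by apply: cvgB; [exact: cvg_id|exact: cvg_cst].
move=> x; apply: cvgB; last exact: h.
apply: cvgD; last by apply: cvgM; [exact: cvg_cst|exact: h].
by apply: cvgB; [exact: pos_cont|apply: cvgM; [exact: cvg_cst|exact: h]].
Qed.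

Lemma step_lo (x : R) : x <= 0 -> [/\ step x = 0, step1 x = 0 & step2 x = 0].
Proof.
move=> x0; rewrite /step /step1 /step2 !pos_0; try lra.
by split; ring.
Qed.

Lemma step_hi (x : R) : 3 <= x -> [/\ step x = 1, step1 x = 0 & step2 x = 0].
Proof.
move=> x0; rewrite /step /step1 /step2 !pos_id; try lra.
by split; field.
Qed.

Lemma step_bounds (x : R) : [/\ 0 <= step x <= 1, 0 <= step1 x <= 1 & `|step2 x| <= 2].
Proof.
have [x0|x0] := leP x 0.
  by have [-> -> ->] := step_lo x0; rewrite normr0 !lexx ler01.
have [x3|x3] := leP 3 x.
  by have [-> -> ->] := step_hi x3; rewrite normr0 !lexx ler01.
have [x1|x1] := leP x 1.
  rewrite /step /step1 /step2 (pos_id (ltW x0)) !pos_0; try lra.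
  rewrite !expr0n/= !mulr0 !subr0 !addr0 ger0_norm ?(ltW x0)//.
  have h2 : 0 <= x ^+ 2 <= 1 by apply/andP; split; nra.
  have h3 : 0 <= x ^+ 3 <= 1 by rewrite exprn_ge0 ?(ltW x0)//= exprn_ile1// ltW.
  by move/andP: h2 => [? ?]; move/andP: h3 => [? ?]; split; first apply/andP; try split; try (apply/andP; split); lra.
have [x2|x2] := leP x 2.
  have [y xy] : exists y, x = 1 + y by exists (x - 1); ring.
  move: x0 x3 x1 x2; rewrite xy => x0 x3 x1 x2.
  have [y0 y1] : 0 <= 1 + y - 1 /\ 1 + y - 1 <= 1 by split; lra.
  rewrite /step /step1 /step2 (pos_id (_ : 0 <= 1 + y)) ?(pos_id y0) ?pos_0; try lra.
  have -> : 1 + y - 1 = y by ring.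
  move: y0 y1; have -> : 1 + y - 1 = y by ring.
  move=> y0 y1; clear x0 x3 x1 x2.
  have h2 : 0 <= y ^+ 2 <= y by apply/andP; split; nra.
  have h3 : 0 <= y ^+ 3 <= y ^+ 2.
    by rewrite exprn_ge0//= exprS ler_piMl// exprn_ge0.
  move/andP: h2 => [? ?]; move/andP: h3 => [? ?].
  rewrite !expr0n/= !mulr0 !subr0 !addr0.
  split; try (rewrite ler_norml); apply/andP; split; nra.
(* The last piece is the mirror image of the first: in the distance [y] from 3 the step is
   [1 - y^3 / 6]. *)
have [y xy] : exists y, x = 3 - y by exists (3 - x); ring.
move: x0 x3 x1 x2; rewrite xy => x0 x3 x1 x2.
have [y0 y1] : 0 <= y /\ y <= 1 by split; lra.
rewrite /step /step1 /step2 (pos_id (_ : 0 <= 3 - y)) ?(pos_id (_ : 0 <= 3 - y - 1)) ?(pos_id (_ : 0 <= 3 - y - 2)) ?pos_0; try lra.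
clear x0 x3 x1 x2.
have h2 : 0 <= y ^+ 2 <= y by apply/andP; split; nra.
have h3 : 0 <= y ^+ 3 <= y ^+ 2.
  by rewrite exprn_ge0//= exprS ler_piMl// exprn_ge0.
move/andP: h2 => [? ?]; move/andP: h3 => [? ?].
rewrite !expr0n/= !subr0.
have -> : ((3 - y) ^+ 3 - 3 * (3 - y - 1) ^+ 3 + 3 * (3 - y - 2) ^+ 3) / 6 = 1 - y ^+ 3 / 6 by field.
have -> : ((3 - y) ^+ 2 - 3 * (3 - y - 1) ^+ 2 + 3 * (3 - y - 2) ^+ 2) / 2 = y ^+ 2 / 2 by field.
have -> : 3 - y - 3 * (3 - y - 1) + 3 * (3 - y - 2) = - y by ring.
by split; try (rewrite normrN ger0_norm//); try (apply/andP; split); lra.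
Qed.

(** The factor 3 that accompanies [w] from here on is the length of the transition of [step]: the
    edges occupy [[al, al + 3 w]] and [[be, be + 3 w]]. *)
Definition plat (al be w x : R) : R := step ((x - al) / w) - step ((x - be) / w).
Definition plat1 (al be w x : R) : R := step1 ((x - al) / w) / w - step1 ((x - be) / w) / w.
Definition plat2 (al be w x : R) : R := step2 ((x - al) / w) / w / w - step2 ((x - be) / w) / w / w.

Lemma plat_d (al be w x : R) : w != 0 -> is_derive x 1 (plat al be w) (plat1 al be w x).
Proof.
by move=> w0; apply: is_deriveB; apply: is_derive_affine => //; exact: step_d.
Qed.

Lemma plat1_d (al be w x : R) : w != 0 -> is_derive x 1 (plat1 al be w) (plat2 al be w x).
Proof.
move=> w0.
have h (a : R) : is_derive x 1 (fun y => step1 ((y - a) / w) / w) (step2 ((x - a) / w) / w / w).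
  rewrite [X in is_derive _ _ _ X]mulrC.
  have -> : (fun y => step1 ((y - a) / w) / w) = (fun y => w^-1 * step1 ((y - a) / w)).
    by apply/funext => y; rewrite mulrC.
  by apply: is_derive_cmul; apply: is_derive_affine => //; exact: step1_d.
exact: (is_deriveB (h al) (h be)).
Qed.

Lemma plat2_cont (al be w : R) : w != 0 -> continuous (plat2 al be w).
Proof.
move=> w0.
have h (a : R) : continuous (fun x => step2 ((x - a) / w) / w / w).
  move=> x; apply: cvgM; last exact: cvg_cst.
  apply: cvgM; last exact: cvg_cst.
  apply: (continuous_comp (f := fun x => (x - a) / w) (g := step2)); last exact: step2_cont.
  by apply: cvgM; [apply: cvgB; [exact: cvg_id|exact: cvg_cst]|exact: cvg_cst].
by move=> x; apply: cvgB; exact: h.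
Qed.

Lemma plat_mid (al be w x : R) : 0 < w -> al + 3 * w <= x <= be ->
  [/\ plat al be w x = 1, plat1 al be w x = 0 & plat2 al be w x = 0].
Proof.
move=> w0 /andP[x1 x2].
have [h1 h2 h3] := @step_hi ((x - al) / w) ltac:(rewrite ler_pdivlMr//; lra).
have [k1 k2 k3] := @step_lo ((x - be) / w) ltac:(rewrite ler_pdivrMr//; lra).
by rewrite /plat /plat1 /plat2 h1 h2 h3 k1 k2 k3 !mul0r !subr0.
Qed.

Lemma plat_out (al be w x : R) : 0 < w -> al + 3 * w <= be -> ~~ (al <= x <= be + 3 * w) ->
  [/\ plat al be w x = 0, plat1 al be w x = 0 & plat2 al be w x = 0].
Proof.
move=> w0 ab; rewrite negb_and -!ltNge => /orP[xa|xb].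
  have [h1 h2 h3] := @step_lo ((x - al) / w) ltac:(rewrite ler_pdivrMr//; lra).
  have [k1 k2 k3] := @step_lo ((x - be) / w) ltac:(rewrite ler_pdivrMr//; lra).
  by rewrite /plat /plat1 /plat2 h1 h2 h3 k1 k2 k3 !mul0r !subr0.
have [h1 h2 h3] := @step_hi ((x - al) / w) ltac:(rewrite ler_pdivlMr//; lra).
have [k1 k2 k3] := @step_hi ((x - be) / w) ltac:(rewrite ler_pdivlMr//; lra).
by rewrite /plat /plat1 /plat2 h1 h2 h3 k1 k2 k3 !mul0r !subrr.
Qed.

Definition ends (al be w x : R) : R :=
  \1_(`[al, al + 3 * w] : set R) x + \1_(`[be, be + 3 * w] : set R) x.

Lemma plat_bounds (al be w x : R) : 0 < w -> al + 3 * w <= be ->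
  [/\ 0 <= plat al be w x <= 1, `|plat1 al be w x| <= w^-1 * ends al be w x &
    `|plat2 al be w x| <= (2 / w ^+ 2) * ends al be w x].
Proof.
move=> w0 ab; have wi : 0 < w^-1 by rewrite invr_gt0.
have en0 : 0 <= ends al be w x by rewrite /ends addr_ge0// indicE.
have w2 : 0 <= 2 / w ^+ 2 by rewrite divr_ge0// sqr_ge0.
have [xin|xout] := boolP (al <= x <= be + 3 * w); last first.
  have [-> -> ->] := plat_out w0 ab xout.
  by split; rewrite ?normr0 ?lexx ?ler01//; apply: mulr_ge0 => //; exact: ltW.
have [xm|xm] := boolP (al + 3 * w <= x <= be).
  have [-> -> ->] := plat_mid w0 xm.
  by split; rewrite ?normr0 ?lexx ?ler01//; apply: mulr_ge0 => //; exact: ltW.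
move: xm xin; rewrite negb_and -!ltNge => xm /andP[x1 x2].
case/orP: xm => xm.
  have [k1 k2 k3] := @step_lo ((x - be) / w) ltac:(rewrite ler_pdivrMr//; lra).
  have [b1 /andP[b2 b3] b4] := step_bounds ((x - al) / w).
  have en1 : 1 <= ends al be w x by rewrite /ends indic_itv x1 (ltW xm)/= lerDl indicE.
  rewrite /plat /plat1 /plat2 k1 k2 k3 !mul0r !subr0; split => //.
    rewrite normrM (gtr0_norm wi) (ger0_norm b2) mulrC; apply: ler_wpM2l; first exact: ltW.
    by lra.
  rewrite !normrM !(gtr0_norm wi) -mulrA.
  have -> : 2 / w ^+ 2 * ends al be w x = (2 * ends al be w x) * (w^-1 * w^-1) by rewrite -invfM -expr2 mulrAC.
  by apply: ler_wpM2r; [rewrite mulr_ge0// ltW|lra].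
have [k1 k2 k3] := @step_hi ((x - al) / w) ltac:(rewrite ler_pdivlMr//; lra).
have [/andP[b1 b1'] /andP[b2 b3] b4] := step_bounds ((x - be) / w).
have en1 : 1 <= ends al be w x by rewrite /ends [X in _ <= _ + X]indic_itv (ltW xm) x2/= lerDr indicE.
rewrite /plat /plat1 /plat2 k1 k2 k3 !mul0r !sub0r !normrN; split.
- by apply/andP; split; lra.
- rewrite normrM (gtr0_norm wi) (ger0_norm b2) mulrC; apply: ler_wpM2l; first exact: ltW.
  by lra.
- rewrite !normrM !(gtr0_norm wi) -mulrA.
  have -> : 2 / w ^+ 2 * ends al be w x = (2 * ends al be w x) * (w^-1 * w^-1) by rewrite -invfM -expr2 mulrAC.
  by apply: ler_wpM2r; [rewrite mulr_ge0// ltW|lra].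
Qed.

Lemma C12K_intro (G Gt Gx Gxx : R -> R -> R) (M : R) :
  (forall t x : R, is_derive t 1 (G ^~ x) (Gt t x)) ->
  (forall t x : R, is_derive x 1 (G t) (Gx t x)) ->
  (forall t x : R, is_derive x 1 (Gx t) (Gxx t x)) ->
  continuous (fun q : R * R => G q.1 q.2) -> continuous (fun q : R * R => Gt q.1 q.2) ->
  continuous (fun q : R * R => Gx q.1 q.2) -> continuous (fun q : R * R => Gxx q.1 q.2) ->
  (forall t x, M < `|t| \/ M < `|x| -> G t x = 0) ->
  [/\ C12K G, dt G = Gt, dx G = Gx & dx (dx G) = Gxx].
Proof.
move=> d1 d2 d3 c0 ct cx cxx supp.
have e1 : dt G = Gt.
  by apply/funext => t; apply/funext => x; rewrite /dt derive1E; case: (d1 t x).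
have e2 : dx G = Gx.
  by apply/funext => t; apply/funext => x; rewrite /dx derive1E; case: (d2 t x).
have e3 : dx (dx G) = Gxx.
  by apply/funext => t; apply/funext => x; rewrite e2 /dx derive1E; case: (d3 t x).
split => //; split; last first.
  rewrite e3 e1 e2; split; first exact: c0.
  split; first exact: ct.
  split; first exact: cx.
  split; first exact: cxx.
  by exists M.
move=> t x; rewrite e2; split; first by case: (d1 t x).
by split; [case: (d2 t x)|case: (d3 t x)].
Qed.

(** The time factor is a plateau with edges of scale 1, equal to 1 on [[0, T]]; it only provides
    compact support in time. *)
Definition testG (lam T al be w : R) (E : R -> R -> R) (t x : R) : R :=
  lam * plat (-3) T 1 t * (plat al be w x * E t x).

(** If [E] solves the backward heat equation on [[0, T]], then in [hh] only terms with a derivative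
    of the space cutoff survive. It is applied with [E = 1] for large excess mass and with the flow
    of a half line for small excess mass. *)
Lemma testG_data (lam T al be w : R) (E Et Ex Exx : R -> R -> R) :
  0 <= T -> 0 < w -> al + 3 * w <= be ->
  (forall t x : R, is_derive t 1 (E ^~ x) (Et t x)) ->
  (forall t x : R, is_derive x 1 (E t) (Ex t x)) ->
  (forall t x : R, is_derive x 1 (Ex t) (Exx t x)) ->
  continuous (fun q : R * R => E q.1 q.2) -> continuous (fun q : R * R => Et q.1 q.2) ->
  continuous (fun q : R * R => Ex q.1 q.2) -> continuous (fun q : R * R => Exx q.1 q.2) ->
  (forall t x, 0 <= t <= T -> Et t x + 2^-1 * Exx t x = 0) ->
  C12K (testG lam T al be w E) /\
  (forall t x, 0 <= t <= T ->
    [/\ testG lam T al be w E t x = lam * (plat al be w x * E t x),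
        dx (testG lam T al be w E) t x =
          lam * (plat1 al be w x * E t x + plat al be w x * Ex t x) &
        hh (testG lam T al be w E) t x =
          lam * (plat1 al be w x * Ex t x + 2^-1 * (plat2 al be w x * E t x))]).
Proof.
move=> T0 w0 ab d1 d2 d3 c0 ct cx cxx pde.
have wn : w != 0 by rewrite gt_eqF.
pose c := plat al be w; pose c1 := plat1 al be w; pose c2 := plat2 al be w.
pose h := plat (-3) T 1; pose h1 := plat1 (-3) T 1.
have dc (x : R) : is_derive x 1 c (c1 x) by exact: plat_d.
have dc1 (x : R) : is_derive x 1 c1 (c2 x) by exact: plat1_d.
have dh (t : R) : is_derive t 1 h (h1 t) by apply: plat_d; rewrite oner_eq0.
have dh1 (t : R) : is_derive t 1 h1 (plat2 (-3) T 1 t) by apply: plat1_d; rewrite oner_eq0.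
pose Gt t x := lam * h1 t * (c x * E t x) + lam * h t * (c x * Et t x).
pose Gx t x := lam * h t * (c1 x * E t x + c x * Ex t x).
pose Gxx t x := lam * h t * (c2 x * E t x + c1 x * Ex t x + (c1 x * Ex t x + c x * Exx t x)).
have k1 (t x : R) : is_derive t 1 (testG lam T al be w E ^~ x) (Gt t x).
  exact: (is_derive_mul (is_derive_cmul lam (dh t)) (is_derive_cmul (c x) (d1 t x))).
have k2 (t x : R) : is_derive x 1 (testG lam T al be w E t) (Gx t x).
  exact: (is_derive_cmul (lam * h t) (is_derive_mul (dc x) (d2 t x))).
have k3 (t x : R) : is_derive x 1 (Gx t) (Gxx t x).
  exact: (is_derive_cmul (lam * h t)
    (is_deriveD (is_derive_mul (dc1 x) (d2 t x)) (is_derive_mul (dc x) (d3 t x)))).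
have p1 (f : R -> R) : continuous f -> continuous (fun q : R * R => f q.1).
  by move=> cf q; apply: (continuous_comp (f := fst) (g := f)); [exact: cvg_fst|exact: cf].
have p2 (f : R -> R) : continuous f -> continuous (fun q : R * R => f q.2).
  by move=> cf q; apply: (continuous_comp (f := snd) (g := f)); [exact: cvg_snd|exact: cf].
have ch := p1 h (fun t => is_derive_cont (dh t)).
have ch1 := p1 h1 (fun t => is_derive_cont (dh1 t)).
have cc := p2 c (fun t => is_derive_cont (dc t)).
have cc1 := p2 c1 (fun t => is_derive_cont (dc1 t)).
have cc2 := p2 c2 (@plat2_cont al be w wn).
have cM (f k : R * R -> R) : continuous f -> continuous k -> continuous (fun q => f q * k q).
  by move=> cf ck q; apply: cvgM; [exact: cf|exact: ck].
have cD (f k : R * R -> R) : continuous f -> continuous k -> continuous (fun q => f q + k q).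
  by move=> cf ck q; apply: cvgD; [exact: cf|exact: ck].
have cl : continuous (fun q : R * R => lam) by move=> q; exact: cvg_cst.
have clh := cM _ _ cl ch.
have q0 : continuous (fun q : R * R => testG lam T al be w E q.1 q.2).
  exact: (cM _ _ clh (cM _ _ cc c0)).
have qt : continuous (fun q : R * R => Gt q.1 q.2).
  exact: (cD _ _ (cM _ _ (cM _ _ cl ch1) (cM _ _ cc c0)) (cM _ _ clh (cM _ _ cc ct))).
have qx : continuous (fun q : R * R => Gx q.1 q.2).
  exact: (cM _ _ clh (cD _ _ (cM _ _ cc1 c0) (cM _ _ cc cx))).
have qxx : continuous (fun q : R * R => Gxx q.1 q.2).
  exact: (cM _ _ clh (cD _ _ (cD _ _ (cM _ _ cc2 c0) (cM _ _ cc1 cx)) (cD _ _ (cM _ _ cc1 cx) (cM _ _ cc cxx)))).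
pose M := 3 + T + `|al| + `|be| + 3 * w.
have supp t x : M < `|t| \/ M < `|x| -> testG lam T al be w E t x = 0.
  have na := ler_norm (- al); have nb := ler_norm be; rewrite normrN in na.
  have a0 := normr_ge0 al; have b0 := normr_ge0 be.
  case=> h2; rewrite /testG.
    have [-> _ _] : [/\ plat (-3) T 1 t = 0, plat1 (-3) T 1 t = 0 & plat2 (-3) T 1 t = 0].
      apply: plat_out => //; first lra.
      apply/negP => /andP[t1 t2]; move: h2; rewrite ltNge; apply/negP/negPn.
      by rewrite ler_norml /M; apply/andP; split; lra.
    by rewrite mulr0 mul0r.
  have [-> _ _] : [/\ plat al be w x = 0, plat1 al be w x = 0 & plat2 al be w x = 0].
    apply: plat_out => //.
    apply/negP => /andP[t1 t2]; move: h2; rewrite ltNge; apply/negP/negPn.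
    by rewrite ler_norml /M; apply/andP; split; lra.
  by rewrite mul0r mulr0.
have [CG e1 e2 e3] := C12K_intro k1 k2 k3 q0 qt qx qxx supp.
split => // t x tT.
have [H H1 _] : [/\ plat (-3) T 1 t = 1, plat1 (-3) T 1 t = 0 & plat2 (-3) T 1 t = 0].
  by apply: plat_mid => //; move/andP: tT => [? ?]; apply/andP; split; lra.
rewrite /hh e3 e2 e1 /Gt /Gx /Gxx /testG /h /h1 H H1 -/c -/c1 -/c2; split.
- by rewrite mulr1.
- by rewrite mulr1.
- have := pde t x tT; move: (E t x) (Et t x) (Ex t x) (Exx t x) (c x) (c1 x) (c2 x).
  clear => e et ex exx a a1 a2 h.
  have -> : et = - (2^-1 * exx) by lra.
  by field.
Qed.

End Test_functions.

(** * Lower bounds *)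

Section Lower_far.
Context {R : realType}.
Implicit Types f g : R -> R.
Local Notation leb := (@lebesgue_measure R).
Local Notation intg D f := (leb.-integrable D (EFin \o f)).
Local Notation mset D := ((measurable : set (set (measurableTypeR R))) D).

Lemma I0_ge (T : R) mu (G : R -> R -> R) : C12K G ->
  ((lfun T mu G - 2^-1 * quadfun T mu G)%:E <= I0 T mu)%E.
Proof. by move=> CG; apply: ereal_sup_ubound; exists G. Qed.

Lemma ends_int (al be w c : R) : 0 < w ->
  intg setT (fun x => c * ends al be w x) /\ Rint setT (fun x => c * ends al be w x) = c * (6 * w).
Proof.
move=> w0.
have i1 : intg setT (fun x => c * \1_(`[al, al + 3 * w] : set R) x) by exact: intg_indic.
have i2 : intg setT (fun x => c * \1_(`[be, be + 3 * w] : set R) x) by exact: intg_indic.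
have -> : (fun x => c * ends al be w x) = (fun x => c * \1_(`[al, al + 3 * w] : set R) x +
    c * \1_(`[be, be + 3 * w] : set R) x) by apply/funext => x; rewrite /ends mulrDr.
split; first exact: intgD.
by rewrite (RintD measurableT i1 i2) !Rint_indic; lra.
Qed.

(** The two edges may meet in a point, where [ends] is 2; the factor 2 makes the bound hold
    everywhere. *)
Lemma ends_sq (al be w x : R) : ends al be w x ^+ 2 <= 2 * ends al be w x.
Proof. by rewrite /ends !indicE; case: (_ \in _); case: (_ \in _); rewrite /=; lra. Qed.

Lemma density_sec (T : R) mu t : density T mu ->
  measurable_fun setT (mu t) /\ forall x, `|mu t x| <= 1.
Proof.
move=> [m01 [mm _]]; split; first exact: (measurableT_comp mm (pair1_measurable t)).
by move=> x; have /andP[? ?] := m01 t x; rewrite ger0_norm.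
Qed.

Lemma mobility_le (T : R) mu t x : density T mu -> 0 <= mu t x * (1 - mu t x) <= 1.
Proof.
move=> [m01 _]; have /andP[? ?] := m01 t x.
by apply/andP; split; [rewrite mulr_ge0//; lra|nra].
Qed.

Fact sign_choice (q l : R) : 0 <= l -> exists lam, `|lam| = l /\ lam * q = l * `|q|.
Proof.
move=> l0; have [q0|q0] := leP 0 q.
  by exists l; rewrite !ger0_norm.
by exists (- l); rewrite normrN ger0_norm// ltr0_norm// mulrN mulNr.
Qed.

Fact near_arith (q qN lam : R) : `|q - qN| <= `|q| / 8 -> lam * q = `|lam| * `|q| ->
  `|lam| * (7 / 8 * `|q|) <= lam * qN.
Proof.
move=> h lq; have -> : lam * qN = lam * q - lam * (q - qN) by ring.
have : lam * (q - qN) <= `|lam| * (`|q| / 8).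
  by apply: (le_trans (ler_norm _)); rewrite normrM; apply: ler_wpM2l.
rewrite lq; lra.
Qed.

Lemma density_diff (T : R) mu s t x : density T mu -> `|mu s x - mu t x| <= 1.
Proof.
move=> [m01 _]; have /andP[? ?] := m01 s x; have /andP[? ?] := m01 t x.
by rewrite ler_norml; apply/andP; split; lra.
Qed.

(** In units of [|lam| q]: the boundary term is at least [7/8 - 1/8], the drift at most [1/8], half
    the quadratic form at most [1/2], and [1/8] remains. With [|lam| = q^2 / (576 T)] this is
    [q^3 / (4608 T)]. *)
Fact far_arith (T q lam qN A H Q k : R) : k = 2304 -> 0 < T -> 0 < q -> k * T <= q ^+ 2 ->
  `|lam| = q ^+ 2 / (k / 4 * T) -> lam * qN >= `|lam| * (7 / 8 * q) -> `|A - lam * qN| <= `|lam| * (q / 8) ->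
  `|H| <= 6 * `|lam| / (q / 48) * T -> Q <= 12 * `|lam| ^+ 2 / (q / 48) * T ->
  q ^+ 3 / (2 * k * T) <= A - H - 2^-1 * Q.
Proof.
move=> kE T0 q0 qT; set l := `|lam| => lE h1 h2 h3 h4.
have Tn : T != 0 by rewrite gt_eqF. have qn : q != 0 by rewrite gt_eqF.
have k0 : 0 < k by rewrite kE ltr0n. have kn : k != 0 by rewrite gt_eqF.
have l0 : 0 <= l by rewrite /l normr_ge0.
have h3' : `|H| <= l * (q / 8).
  apply: (le_trans h3); have -> : 6 * l / (q / 48) * T = l * (288 * T / q) by field.
  apply: ler_wpM2l => //; rewrite ler_pdivrMr//.
  by rewrite mulrAC -expr2 ler_pdivlMr//; move: qT; rewrite kE; lra.
have h4' : Q <= l * q.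
  apply: (le_trans h4); have -> : 12 * l ^+ 2 / (q / 48) * T = l * (l * (k / 4 * T / q)).
    by rewrite kE; field.
  apply: ler_wpM2l => //; rewrite lE le_eqVlt; apply/orP; left; apply/eqP; field.
  by rewrite Tn qn kn.
have E : q ^+ 3 / (2 * k * T) = l * q / 8 by rewrite lE; field; rewrite Tn kn.
rewrite E; move: h2 h3'; rewrite !ler_norml => /andP[h2 _] /andP[_ h3'].
lra.
Qed.

Lemma pinfty_pick (P : R -> Prop) (b : R) : (\forall x \near +oo, P x) -> exists2 N, b <= N & forall x, N <= x -> P x.
Proof.
move=> [A [_ HA]]; exists (Num.max b (A + 1)); first by rewrite le_max lexx.
by move=> x; rewrite ge_max => /andP[_ h]; apply: HA; lra.
Qed.

(* The cutoffs have width [|q| / 48], so that every error term is at most [|lam| |q| / 8] once [2304 T <= q ^ 2].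
   [k] is a variable because large unary numerals are expensive to compare. *)
Lemma lower_far (k T b q : R) mu : k = 2304 -> 0 < T -> density T mu ->
  (fun N => Rint `[b, N] (fun x => mu T x - mu 0 x)) @ +oo --> q ->
  k * T <= q ^+ 2 -> ((`|q| ^+ 3 / (2 * k * T))%:E <= I0 T mu)%E.
Proof.
move=> kE T0 dm cq qT; have k0 : 0 < k by rewrite kE ltr0n.
have q0 : 0 < `|q|.
  by rewrite normr_gt0; apply/eqP => h; move: qT; rewrite h expr0n/= leNgt mulr_gt0.
pose w := `|q| / 48; have w0 : 0 < w by rewrite divr_gt0.
(* The excess mass is only a limit; it is replaced by the mass up to a finite [N], where the far
   edge begins. *)
have [N bN HN] : exists2 N, b <= N & forall x, N <= x -> `|q - Rint `[b, x] (fun x => mu T x - mu 0 x)| <= `|q| / 8.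
  by apply: pinfty_pick; move/cvgrPdist_le : cq; apply; rewrite divr_gt0.
have {HN} := HN N (lexx N).
have [qN qNE] : exists r, r = Rint `[b, N] (fun x => mu T x - mu 0 x) by eexists.
rewrite -qNE => qNq.
have [mT mT1] := density_sec T dm; have [m0 m01] := density_sec 0 dm.
have D1 x : `|mu T x - mu 0 x| <= 1 by exact: density_diff dm.
have mD : measurable_fun setT (fun x => mu T x - mu 0 x) by exact: measurable_funB.
have l0 : 0 <= q ^+ 2 / (k / 4 * T).
  by apply: divr_ge0; [exact: sqr_ge0|apply: mulr_ge0; [apply: divr_ge0 => //|]; exact: ltW].
have [lam [lamE lamq]] := sign_choice q l0.
have ab : b - 3 * w + 3 * w <= N by rewrite subrK.
have der0 (x : R) : is_derive x 1 (fun _ : R => 1 : R) 0 by exact: is_derive_cst.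
have der00 (x : R) : is_derive x 1 (fun _ : R => 0 : R) 0 by exact: is_derive_cst.
have cc (c : R) : continuous (fun q : R * R => c) by move=> ?; exact: cvg_cst.
(* With [E = 1] the drift and the gradient live on the two edges alone, and starting the near edge
   at [b - 3 w] makes the cutoff equal to 1 from [b] on. *)
have [CG data] := @testG_data R lam T (b - 3 * w) N w (fun _ _ => 1) (fun _ _ => 0) (fun _ _ => 0) (fun _ _ => 0)
  (ltW T0) w0 ab (fun t x => der0 t) (fun t x => der0 x) (fun t x => der00 x) (cc 1) (cc 0) (cc 0) (cc 0)
  ltac:(by move=> t x _; rewrite mulr0 addr0).
set G := testG _ _ _ _ _ _ in CG data.
set c := plat (b - 3 * w) N w in data; set c1 := plat1 (b - 3 * w) N w in data; set c2 := plat2 (b - 3 * w) N w in data.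
set en := ends (b - 3 * w) N w.
have pb x : [/\ 0 <= c x <= 1, `|c1 x| <= w^-1 * en x & `|c2 x| <= (2 / w ^+ 2) * en x].
  exact: plat_bounds.
apply: le_trans (I0_ge T mu CG); rewrite lee_fin /lfun.
have po x : ~~ (b - 3 * w <= x <= N + 3 * w) -> c x = 0 by move=> h; have [] := plat_out w0 ab h.
have pm x : b <= x <= N -> c x = 1.
  move=> h; have h' : b - 3 * w + 3 * w <= x <= N by rewrite subrK.
  by have [] := plat_mid w0 h'.
have mc : measurable_fun setT c.
  by apply: continuous_Rmeas => x; apply: is_derive_cont (plat_d _ _ _ _); rewrite gt_eqF.
have cbox x : `|c x| <= 1 * \1_(`[b - 3 * w, N + 3 * w] : set R) x.
  rewrite indic_itv; case: ifPn => h.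
    by have [/andP[? ?] _ _] := pb x; rewrite mulr1 ger0_norm.
  by rewrite po// normr0 mulr0.
have ic t : intg setT (fun x => mu t x * c x).
  have [mm m1] := density_sec t dm.
  apply: (@intg_box _ _ (b - 3 * w) (N + 3 * w) 1); first exact: measurable_funM.
  by move=> x; rewrite normrM -[leRHS]mul1r; apply: ler_pM.
have RG t : 0 <= t <= T -> Rint setT (fun x => G t x * mu t x) = lam * Rint setT (fun x => mu t x * c x).
  move=> tT; rewrite -(RintZ _ measurableT (ic t)); apply: Rint_eq => x _.
  by have [-> _ _] := data t x tT; rewrite mulr1; ring.
have tT0 : 0 <= (0 : R) <= T by rewrite lexx ltW.
have tTT : 0 <= T <= T by rewrite lexx ltW.
rewrite (RG T tTT) (RG 0 tT0).
set H := Rint `[0, T] _.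
have Hb : `|H| <= 6 * `|lam| / w * T.
  apply: Rint_time; first exact: ltW.
  move=> t tT.
  have [ie RE] := ends_int (b - 3 * w) N (`|lam| / w ^+ 2) w0.
  have -> : 6 * `|lam| / w = Rint setT (fun x => `|lam| / w ^+ 2 * en x).
    by rewrite RE; field; rewrite gt_eqF.
  apply: Rint_le_dom => // x _.
  have [_ _ hE] := data t x tT; rewrite -[_ + _ * dx _ _ _]/(hh G t x) hE mulr0 add0r mulr1.
  have [_ m1] := density_sec t dm; have [_ _ h2] := pb x.
  rewrite normrM -[leRHS]mul1r; apply: ler_pM => //.
  rewrite !normrM (@ger0_norm _ (2^-1 : R))//.
  have -> : `|lam| / w ^+ 2 * en x = `|lam| * (2^-1 * (2 / w ^+ 2 * en x)) by field; rewrite gt_eqF.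
  by rewrite ler_wpM2l// ler_pM2l.
have Qb : quadfun T mu G <= 12 * `|lam| ^+ 2 / w * T.
  apply: le_trans (ler_norm _) _; apply: Rint_time; first exact: ltW.
  move=> t tT.
  have [ie RE] := ends_int (b - 3 * w) N (2 * `|lam| ^+ 2 / w ^+ 2) w0.
  have -> : 12 * `|lam| ^+ 2 / w = Rint setT (fun x => 2 * `|lam| ^+ 2 / w ^+ 2 * en x).
    by rewrite RE; field; rewrite gt_eqF.
  apply: Rint_le_dom => // x _.
  have [_ -> _] := data t x tT; rewrite mulr1 mulr0 addr0.
  have [_ h1 _] := pb x; have /andP[q1 q2] := mobility_le t x dm.
  rewrite normrM (ger0_norm q1) -[leRHS]mul1r; apply: ler_pM => //.
  rewrite normrX normrM exprMn.
  have -> : 2 * `|lam| ^+ 2 / w ^+ 2 * en x = `|lam| ^+ 2 * (w ^- 2 * (2 * en x)) by ring.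
  apply: ler_wpM2l; first exact: sqr_ge0.
  apply: (@le_trans _ _ ((w^-1 * en x) ^+ 2)).
    by rewrite lerXn2r ?nnegrE//; exact: le_trans h1.
  rewrite exprMn exprVn; apply: ler_wpM2l; first by rewrite invr_ge0 sqr_ge0.
  exact: ends_sq.
have -> : lam * Rint setT (fun x => mu T x * c x) - lam * Rint setT (fun x => mu 0 x * c x) =
    lam * Rint setT (fun x => (mu T x - mu 0 x) * c x).
  rewrite -mulrBr -(RintB measurableT (ic T) (ic 0)); congr (_ * _).
  by apply: Rint_eq => x _; ring.
have Ab : `|lam * Rint setT (fun x => (mu T x - mu 0 x) * c x) - lam * qN| <= `|lam| * (`|q| / 8).
  rewrite -mulrBr normrM; apply: ler_wpM2l => //.
  have i1 : intg setT (fun x => (mu T x - mu 0 x) * c x).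
    apply: (@intg_box _ _ (b - 3 * w) (N + 3 * w) 1); first exact: measurable_funM.
    by move=> x; rewrite normrM -[leRHS]mul1r; apply: ler_pM.
  have i2 : intg setT (fun x => (mu T x - mu 0 x) * \1_(`[b, N] : set R) x).
    apply: (@intg_box _ _ b N 1).
      by apply: measurable_funM => //; exact: measurable_indic.
    move=> x; rewrite normrM; apply: ler_pM => //.
    by rewrite ger0_norm// indicE.
  have -> : qN = Rint setT (fun x => (mu T x - mu 0 x) * \1_(`[b, N] : set R) x) by rewrite qNE Rint_mkind.
  rewrite -(RintB measurableT i1 i2).
  have [ie RE] := ends_int (b - 3 * w) N 1 w0.
  (* The cutoff and the indicator of [[b, N]] differ only on the edges, by at most 1; the total edge
     length [6 w] is [|q| / 8], whence the 48 in [w]. *)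
  have -> : `|q| / 8 = Rint setT (fun x => 1 * en x).
    by rewrite RE /w; field.
  apply: Rint_le_dom => // x _; rewrite -mulrBr normrM; apply: ler_pM => //.
  rewrite indic_itv; case: ifPn => h.
    by rewrite pm// subrr normr0 /en /ends addr_ge0// indicE.
  rewrite subr0; have [xin|xout] := boolP (b - 3 * w <= x <= N + 3 * w); last first.
    by rewrite po// normr0 /en /ends addr_ge0// indicE.
  have [/andP[c0 c01] _ _] := pb x; rewrite ger0_norm//; apply: (le_trans c01).
  move: h xin; rewrite negb_and -!ltNge => h /andP[x1 x2].
  rewrite /en /ends !indic_itv x1 x2 andbT/=.
  case/orP: h => h.
    have -> : x <= b - 3 * w + 3 * w by rewrite subrK ltW.
    by rewrite lerDl; case: ifP.
  by rewrite (ltW h)/= lerDr; case: ifP.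
have lq : `|lam| * (7 / 8 * `|q|) <= lam * qN by apply: near_arith qNq _; rewrite lamE.
apply: (far_arith kE T0 q0 _ _ lq Ab Hb Qb).
  by rewrite real_normK ?num_real.
by rewrite lamE real_normK ?num_real.
Qed.

End Lower_far.

(** * The backward heat flow of a half line *)

Section Backward_heat.
Context {R : realType}.
Implicit Types f g : R -> R.
Local Notation leb := (@lebesgue_measure R).
Local Notation intg D f := (leb.-integrable D (EFin \o f)).
Local Notation mset D := ((measurable : set (set (measurableTypeR R))) D).

Definition ncdf (z : R) : R := Rint `]-oo, z] (sigma 1).

Lemma sigma0 (t y : R) : sigma t (0 - y) = sigma t y.
Proof. by rewrite sigma_sym subr0. Qed.

Lemma intg_sigma1 : intg setT (sigma 1 : R -> R) /\ Rint setT (sigma 1 : R -> R) = 1.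
Proof.
have E : (sigma 1 : R -> R) = (fun y => sigma 1 (0 - y)) by apply/funext => y; rewrite sigma0.
by rewrite E; split; [exact: intg_sigma|exact: Rint_sigma].
Qed.

Lemma sigma1_cont : continuous (sigma 1 : R -> R).
Proof. by move=> x; exact: is_derive_cont (sigma_dx x ltr01). Qed.

Lemma ncdf_d (z : R) : is_derive z 1 ncdf (sigma 1 z).
Proof.
have i1 : intg `]-oo, z + 1] (sigma 1) by apply: integrableS intg_sigma1.1.
have zz : z < z + 1 by rewrite ltrDl.
have [d e] := @continuous_FTC1 R (sigma 1) -oo%O z (z + 1) zz i1 ltac:(by rewrite ltNyr) (@sigma1_cont z).
by split; [exact: d|rewrite -derive1E; exact: e].
Qed.

Lemma ncdf_split (z : R) : ncdf z = Rint setT (fun y => sigma 1 y * \1_(`]-oo, z] : set R) y) /\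
  1 - ncdf z = Rint setT (fun y => sigma 1 y * (1 - \1_(`]-oo, z] : set R) y)).
Proof.
have E : ncdf z = Rint setT (fun y => sigma 1 y * \1_(`]-oo, z] : set R) y) by rewrite /ncdf Rint_mkind.
split => //; have [i1 e1] := intg_sigma1.
have i2 : intg setT (fun y => sigma 1 y * \1_(`]-oo, z] : set R) y).
  apply: (intg_dom measurableT _ i1).
    apply: measurable_funM; last exact: measurable_indic.
    by apply: continuous_Rmeas; exact: sigma1_cont.
  move=> y _; rewrite normrM (ger0_norm (sigma_ge0 _ _)) -[leRHS]mulr1.
  by apply: ler_wpM2l; [exact: sigma_ge0|rewrite ger0_norm indicE//; case: (_ \in _)].
by rewrite E -{1}e1 -(RintB measurableT i1 i2); apply: Rint_eq => y _; rewrite mulrBr mulr1.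
Qed.

Lemma ncdf01 (z : R) : 0 <= ncdf z <= 1.
Proof.
have [E1 E2] := ncdf_split z.
have i01 (y : R) : 0 <= (\1_(`]-oo, z] : set R) y : R) <= 1.
  by rewrite indicE; case: (_ \in _); rewrite /= ?lexx ?ler01.
apply/andP; split.
  by rewrite E1; apply: Rintegral_ge0 => y _; rewrite mulr_ge0 ?sigma_ge0//; case/andP: (i01 y).
rewrite -subr_ge0 E2; apply: Rintegral_ge0 => y _; rewrite mulr_ge0 ?sigma_ge0// subr_ge0.
Qed.

(** The difference is the Gaussian mass on the far side of [z], which separates 0 from the variable
    of integration as [sigma_tail] requires. *)
Lemma ncdf_tail (z : R) : `|ncdf z - (if 0 <= z then 1 else 0)| <= expR (- (z ^+ 2) / 2).
Proof.
have [E1 E2] := ncdf_split z; have [i1 e1] := intg_sigma1.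
have iz : intg setT (fun y => expR (- (z ^+ 2) / 2) * sigma 1 (z - y)).
  by apply: intgZ => //; exact: intg_sigma.
have rz : expR (- (z ^+ 2) / 2) = Rint setT (fun y => expR (- (z ^+ 2) / 2) * sigma 1 (z - y)).
  by rewrite (RintZ _ measurableT (intg_sigma z ltr01)) Rint_sigma// mulr1.
have tail (y : R) : 0 <= (0 - z) * (z - y) -> sigma 1 y <= expR (- (z ^+ 2) / 2) * sigma 1 (z - y).
  by move=> h; have := sigma_tail ltr01 h; rewrite sigma0 sub0r sqrrN mulr1.
have nn (y : R) : 0 <= expR (- (z ^+ 2) / 2) * sigma 1 (z - y).
  by rewrite mulr_ge0 ?expR_ge0 ?sigma_ge0.
case: ifPn => [z0|]; last rewrite -ltNge => z0.
  rewrite distrC E2 rz; apply: Rint_le_dom => // y _.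
  rewrite indicE; case: (boolP (y \in _)) => yz /=; first by rewrite subrr mulr0 normr0.
  rewrite subr0 mulr1 ger0_norm ?sigma_ge0//; apply: tail.
  move: yz; rewrite notin_setE/= in_itv/= => /negP; rewrite -ltNge => yz.
  by rewrite sub0r mulNr -mulrN mulr_ge0//; lra.
rewrite subr0 E1 rz; apply: Rint_le_dom => // y _.
rewrite indicE; case: (boolP (y \in _)) => yz /=; last by rewrite mulr0 normr0.
rewrite mulr1 ger0_norm ?sigma_ge0//; apply: tail.
move: yz; rewrite inE/= in_itv/= => yz.
by rewrite mulr_ge0//; lra.
Qed.

(* A positive [C^1] extension of [T + d - t] beyond [T]. *)
Definition clock (T d t : R) : R := T + d - t + d^-1 * pos (t - T) ^+ 2.
Definition clock1 (T d t : R) : R := - 1 + d^-1 * (2 * pos (t - T)).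

Lemma clock_gt0 (T d t : R) : 0 < d -> 0 < clock T d t.
Proof.
move=> d0; rewrite /clock; have [tT|tT] := leP t T.
  rewrite pos_0 ?subr_le0// expr0n/= mulr0 addr0; lra.
rewrite pos_id ?subr_ge0 ?(ltW tT)//.
have [y yE] : exists y, y = t - T by eexists.
rewrite -yE; have -> : T + d - t + d^-1 * y ^+ 2 = d^-1 * (d ^+ 2 - d * y + y ^+ 2).
  by rewrite yE; field; rewrite gt_eqF.
rewrite mulr_gt0 ?invr_gt0//.
have := sqr_ge0 (d - 2 * y); have : 0 < d ^+ 2 by rewrite exprn_gt0.
nra.
Qed.

Lemma clock_d (T d t : R) : is_derive t 1 (clock T d) (clock1 T d t).
Proof.
have h1 : is_derive t 1 (fun t => T + d - t) (- 1).
  by apply: is_derive_eq; rewrite ?add0r ?addr0 ?sub0r; ring.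
have h2 : is_derive t 1 (fun t => pos (t - T) ^+ 2) (2 * pos (t - T)).
  have := @is_derive_shiftf R (fun y => pos y ^+ 2) T t _ (is_derive_pos 0 (t - T)).
  by rewrite expr1.
exact: (is_deriveD h1 (is_derive_cmul d^-1 h2)).
Qed.

Lemma clock1_cont (T d : R) : continuous (clock1 T d).
Proof.
move=> t; apply: cvgD; first exact: cvg_cst.
apply: cvgM; first exact: cvg_cst.
apply: cvgM; first exact: cvg_cst.
apply: (continuous_comp (f := fun t => t - T) (g := pos)); last exact: pos_cont.
by apply: cvgB; [exact: cvg_id|exact: cvg_cst].
Qed.

Lemma clock_in (T d t : R) : t <= T -> clock T d t = T + d - t /\ clock1 T d t = - 1.
Proof.
by move=> tT; rewrite /clock /clock1 pos_0 ?subr_le0// expr0n/= !mulr0 !addr0.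
Qed.

Definition rad (T d t : R) : R := Num.sqrt (clock T d t).
(** Up to time [T] this solves the backward heat equation whose terminal value at [T + d] is the
    indicator of the half line from [b]. The delay [d > 0] keeps it smooth at [T], at the price of a
    small error there. *)
Definition bE (T d b t x : R) : R := ncdf ((x - b) / rad T d t).
Definition bEt (T d b t x : R) : R :=
  - (clock1 T d t * (2 * rad T d t ^+ 3)^-1 * ((x - b) * sigma 1 ((x - b) / rad T d t))).
Definition bEx (T d b t x : R) : R := sigma 1 ((x - b) / rad T d t) / rad T d t.
Definition bExx (T d b t x : R) : R :=
  - ((rad T d t ^+ 3)^-1 * ((x - b) * sigma 1 ((x - b) / rad T d t))).

Lemma rad_gt0 (T d t : R) : 0 < d -> 0 < rad T d t.
Proof. by move=> d0; rewrite sqrtr_gt0 clock_gt0. Qed.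

Lemma rad_d (T d t : R) : 0 < d -> is_derive t 1 (rad T d) (clock1 T d t / (2 * rad T d t)).
Proof.
move=> d0; rewrite mulrC.
exact: (is_derive1_comp (is_derive1_sqrt (clock_gt0 T t d0)) (clock_d T d t)).
Qed.

Lemma bE_dt (T d b t x : R) : 0 < d -> is_derive t 1 (fun s => bE T d b s x) (bEt T d b t x).
Proof.
move=> d0; have r0 := rad_gt0 T t d0; have rn : rad T d t != 0 by rewrite gt_eqF.
have h1 := @is_deriveV R (rad T d) t _ 1 rn (rad_d T t d0).
have h2 := is_derive_cmul (x - b) h1.
have h3 := @is_derive1_comp R ncdf (fun s => (x - b) * (rad T d s)^-1) t _ _ (ncdf_d _) h2.
apply: is_derive_eq h3 _; rewrite /bEt /GRing.scale/=; field; exact: rn.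
Qed.

Lemma bE_dx (T d b t x : R) : 0 < d -> is_derive x 1 (bE T d b t) (bEx T d b t x).
Proof.
move=> d0; have rn : rad T d t != 0 by rewrite gt_eqF// rad_gt0.
exact: (is_derive_affine rn (ncdf_d _)).
Qed.

Lemma bE_dxx (T d b t x : R) : 0 < d -> is_derive x 1 (bEx T d b t) (bExx T d b t x).
Proof.
move=> d0; have rn : rad T d t != 0 by rewrite gt_eqF// rad_gt0.
have h1 := is_derive_cmul (rad T d t)^-1 (@is_derive_affine R (sigma 1) b (rad T d t) x _ rn (sigma_dx _ ltr01)).
have -> : bEx T d b t = (fun y => (rad T d t)^-1 * sigma 1 ((y - b) / rad T d t)).
  by apply/funext => y; rewrite /bEx mulrC.
apply: is_derive_eq h1 _; rewrite /bExx; field; exact: rn.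
Qed.

Lemma bE_cont (T d b : R) : 0 < d ->
  [/\ continuous (fun q : R * R => bE T d b q.1 q.2), continuous (fun q : R * R => bEt T d b q.1 q.2),
      continuous (fun q : R * R => bEx T d b q.1 q.2) & continuous (fun q : R * R => bExx T d b q.1 q.2)].
Proof.
move=> d0.
have cM (f k : R * R -> R) : continuous f -> continuous k -> continuous (fun q => f q * k q).
  by move=> cf ck q; apply: cvgM; [exact: cf|exact: ck].
have cN (f : R * R -> R) : continuous f -> continuous (fun q => - f q).
  by move=> cf q; apply: cvgN; exact: cf.
have p1 (f : R -> R) : continuous f -> continuous (fun q : R * R => f q.1).
  by move=> cf q; apply: (continuous_comp (f := fst) (g := f)); [exact: cvg_fst|exact: cf].
have cr : continuous (rad T d) by move=> t; exact: is_derive_cont (rad_d T t d0).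
have crV : continuous (fun t => (rad T d t)^-1).
  by move=> t; apply: cvgV; [rewrite gt_eqF// rad_gt0|exact: cr].
have cr3 : continuous (fun t => (rad T d t ^+ 3)^-1).
  move=> t; apply: cvgV; first by rewrite gt_eqF// exprn_gt0// rad_gt0.
  by apply: (continuous_comp (f := rad T d) (g := fun y => y ^+ 3)); [exact: cr|exact: exprn_continuous].
have cr32 : continuous (fun t => (2 * rad T d t ^+ 3)^-1).
  move=> t; apply: cvgV; first by rewrite gt_eqF// mulr_gt0// exprn_gt0// rad_gt0.
  apply: cvgM; first exact: cvg_cst.
  by apply: (continuous_comp (f := rad T d) (g := fun y => y ^+ 3)); [exact: cr|exact: exprn_continuous].
have cx : continuous (fun q : R * R => q.2 - b) by move=> q; apply: cvgB; [exact: cvg_snd|exact: cvg_cst].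
have cz := cM _ _ cx (p1 _ crV).
have cs : continuous (fun q : R * R => sigma 1 ((q.2 - b) / rad T d q.1)).
  move=> q; apply: (continuous_comp (f := fun q : R * R => (q.2 - b) / rad T d q.1) (g := sigma 1)); first exact: cz.
  exact: sigma1_cont.
split.
- move=> q; apply: (continuous_comp (f := fun q : R * R => (q.2 - b) / rad T d q.1) (g := ncdf)); first exact: cz.
  exact: is_derive_cont (ncdf_d _).
- exact: (cN _ (cM _ _ (cM _ _ (p1 _ (@clock1_cont T d)) (p1 _ cr32)) (cM _ _ cx cs))).
- exact: (cM _ _ cs (p1 _ crV)).
- exact: (cN _ (cM _ _ (p1 _ cr3) (cM _ _ cx cs))).
Qed.

Lemma bE_pde (T d b t x : R) : 0 < d -> t <= T -> bEt T d b t x + 2^-1 * bExx T d b t x = 0.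
Proof.
move=> d0 tT; have rn : rad T d t != 0 by rewrite gt_eqF// rad_gt0.
have [_ E] := clock_in d tT.
rewrite /bEt /bExx E; field; exact: rn.
Qed.

Lemma bEx_sigma (T d b t x : R) : 0 < d -> bEx T d b t x = sigma (clock T d t) (x - b).
Proof.
move=> d0; have c0 := clock_gt0 T t d0; have rn : rad T d t != 0 by rewrite gt_eqF// rad_gt0.
have Es : Num.sqrt (2 * pi * clock T d t) = Num.sqrt (2 * pi) * rad T d t by rewrite sqrtrM// mulr_ge0// pi_ge0.
have Er : rad T d t ^+ 2 = clock T d t by rewrite sqr_sqrtr// ltW.
rewrite /bEx /sigma Es (mulr1 (2 * pi)) (mulr1 2) invfM mulrAC; congr (_ * expR _).
by rewrite -Er; field.
Qed.

(* Summation by parts against the step: the cutoff sees only averages of [Rint `[b, z] D] over [[N, N + 3 w]]. *)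
Lemma abel_step (D : R -> R) (b N w q e : R) : measurable_fun setT D -> (forall x, `|D x| <= 1) ->
  0 < w -> b <= N -> (forall z, N <= z -> `|q - Rint `[b, z] D| <= e) ->
  `|Rint setT (fun x => D x * ((1 - step ((x - N) / w)) * \1_(`[b, N + 3 * w] : set R) x)) - q| <= e.
Proof.
move=> mD D1 w0 bN He; have wn : w != 0 by rewrite gt_eqF.
pose ka z := step1 ((z - N) / w) / w.
have dst (z : R) : is_derive z 1 (fun y => step ((y - N) / w)) (ka z).
  by apply: is_derive_affine => //; exact: step_d.
have cka : continuous ka.
  move=> z; apply: cvgM; last exact: cvg_cst.
  apply: (continuous_comp (f := fun z => (z - N) / w) (g := step1)); last exact: is_derive_cont (step1_d _).
  by apply: cvgM; [apply: cvgB; [exact: cvg_id|exact: cvg_cst]|exact: cvg_cst].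
have ka0 z : 0 <= ka z <= w^-1.
  have [_ /andP[h1 h2] _] := step_bounds ((z - N) / w).
  rewrite /ka divr_ge0 ?(ltW w0)//= -[leRHS]mul1r; apply: ler_wpM2r => //.
  by rewrite invr_ge0 ltW.
have kan z : `|ka z| <= w^-1 by have /andP[? ?] := ka0 z; rewrite ger0_norm.
have s3 : step ((N + 3 * w - N) / w) = 1.
  by have [-> _ _] := @step_hi R ((N + 3 * w - N) / w) ltac:(rewrite ler_pdivlMr//; lra).
have ika (x : R) : x <= N + 3 * w -> Rint `[x, N + 3 * w] ka = 1 - step ((x - N) / w).
  move=> xN; rewrite (@Rint_FTC R ka (fun y => step ((y - N) / w)) x (N + 3 * w) xN) ?s3//.
  by move=> z _; exact: cka.
have NN : N <= N + 3 * w by lra.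
have bNN : b <= N + 3 * w by lra.
pose I x : R := \1_(`[b, N + 3 * w] : set R) x.
pose J z : R := \1_(`[N, N + 3 * w] : set R) z.
pose Le (x z : R) : R := if x <= z then 1 else 0.
(* Fubini for [D x * ka z] over [b <= x <= z] with [z] in the edge: integrating [z] first gives the
   cutoff [1 - step], integrating [x] first gives the partial masses, weighted by [ka], whose
   integral over the edge is 1. *)
pose F x z := (D x * I x) * (ka z * J z * Le x z).
have mLe : measurable_fun setT (fun q : R * R => Le q.1 q.2).
  apply: measurable_fun_ifT; try exact: measurable_cst.
  by apply: measurable_fun_ler; [exact: measurable_fst|exact: measurable_snd].
have mI : measurable_fun setT I by exact: measurable_indic.
have mJ : measurable_fun setT J by exact: measurable_indic.
have mka : measurable_fun setT ka by exact: continuous_Rmeas.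
have mF : measurable_fun setT (fun q : R * R => F q.1 q.2).
  apply: measurable_funM.
    by apply: measurable_funM; [exact: (measurableT_comp mD measurable_fst)|exact: (measurableT_comp mI measurable_fst)].
  apply: measurable_funM => //.
  by apply: measurable_funM; [exact: (measurableT_comp mka measurable_snd)|exact: (measurableT_comp mJ measurable_snd)].
have Le1 x z : `|Le x z| <= 1 by rewrite /Le; case: ifP; rewrite ?normr1 ?normr0.
have I1 x : `|I x| = I x by rewrite ger0_norm// /I indicE.
have J1 x : `|J x| = J x by rewrite ger0_norm// /J indicE.
have I0' x : 0 <= I x by rewrite /I indicE.
have J0' x : 0 <= J x by rewrite /J indicE.
have FB x z : `|F x z| <= (1 * I x) * (w^-1 * J z).
  rewrite /F normrM; apply: ler_pM => //.
    by rewrite normrM I1; apply: ler_wpM2r.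
  rewrite normrM -[leRHS]mulr1; apply: ler_pM => //.
  by rewrite normrM J1; apply: ler_wpM2r.
have i1 x : intg setT (fun z => (1 * I x) * (w^-1 * J z)).
  by apply: intgZ => //; exact: intg_indic.
have e1 x : Rint setT (fun z => (1 * I x) * (w^-1 * J z)) <= 3 * I x.
  rewrite (RintZ _ measurableT (intg_indic _ _ _ measurableT)) Rint_indic//.
  rewrite le_eqVlt; apply/orP; left; apply/eqP; field; exact: wn.
have i2 : intg setT (fun x => 3 * I x) by exact: intg_indic.
have i3 z : intg setT (F ^~ z).
  apply: (@intg_box _ _ b (N + 3 * w) w^-1).
    exact: (measurableT_comp mF (pair2_measurable z)).
  move=> x; apply: le_trans (FB x z) _; rewrite mul1r mulrC; apply: ler_wpM2r => //.
  rewrite -[leRHS]mulr1; apply: ler_wpM2l; first by rewrite invr_ge0 ltW.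
  by rewrite /J indicE; case: (_ \in _).
have [_ E] := Rint_swap mF FB i1 e1 i2 i3.
have EL x : Rint setT (F x) = D x * ((1 - step ((x - N) / w)) * I x).
  have ikJ : intg setT (fun z => ka z * J z * Le x z).
    apply: (@intg_box _ _ N (N + 3 * w) w^-1).
      apply: measurable_funM; first by apply: measurable_funM.
      exact: (measurableT_comp mLe (pair1_measurable x)).
    move=> z; rewrite normrM -[leRHS]mulr1; apply: ler_pM => //.
    by rewrite normrM J1; apply: ler_wpM2r.
  rewrite /F (RintZ _ measurableT ikJ) -mulrA; congr (_ * _); rewrite mulrC.
  rewrite /I indic_itv; case: ifPn => [/andP[bx xN]|_]; last by rewrite !mulr0.
  rewrite !mulr1; have [xN'|xN'] := leP N x.
    rewrite -(ika x xN) [RHS]Rint_mkind; apply: Rint_eq => z _.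
    rewrite -mulrA; congr (_ * _); rewrite /J /Le !indic_itv.
    by have [xz|xz] := leP x z; [rewrite (le_trans xN' xz) mulr1|rewrite mulr0].
  have [-> _ _] := @step_lo R ((x - N) / w) ltac:(rewrite ler_pdivrMr// mul0r subr_le0 ltW//).
  have [s0 _ _] := @step_lo R ((N - N) / w) ltac:(rewrite subrr mul0r//).
  have -> : 1 - 0 = Rint `[N, N + 3 * w] ka by rewrite (ika N NN) s0.
  rewrite [RHS]Rint_mkind; apply: Rint_eq => z _.
  rewrite -mulrA; congr (_ * _); rewrite /J /Le !indic_itv.
  by case: ifPn => [/andP[Nz _]|_]; [rewrite (le_trans (ltW xN') Nz) mulr1|rewrite mul0r].
have ER z : Rint setT (F ^~ z) = (ka z * J z) * Rint `[b, z] D.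
  rewrite /J indic_itv; case: ifPn => [/andP[Nz zN]|nz]; last first.
    rewrite mulr0 mul0r (@Rint_eq _ _ _ (cst 0)); first by rewrite /Defs.Rint Rintegral_cst// mul0r.
    by move=> x _; rewrite /F /J indic_itv (negbTE nz) mulr0 mul0r mulr0.
  rewrite mulr1 (Rint_mkind `[b, z]%classic).
  have iD : intg setT (fun x => D x * \1_(`[b, z] : set R) x).
    apply: (@intg_box _ _ b z 1); first by apply: measurable_funM => //; exact: measurable_indic.
    move=> x; rewrite normrM; apply: ler_pM => //.
    by rewrite ger0_norm// indicE.
  rewrite -(RintZ _ measurableT iD); apply: Rint_eq => x _.
  rewrite /F /J /I /Le !indic_itv Nz zN/=.
  have [xz|xz] := leP x z; last by rewrite andbF !mulr0.
  by rewrite (le_trans xz zN); case: ifP => _; rewrite ?mulr1 ?mulr0 ?mul0r// mulrC.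
have ikJ : intg setT (fun z => ka z * J z).
  apply: (@intg_box _ _ N (N + 3 * w) w^-1); first exact: measurable_funM.
  by move=> z; rewrite normrM J1; apply: ler_wpM2r.
have iR : intg setT (fun z => (ka z * J z) * Rint `[b, z] D).
  by have := Rint_swap_intg mF FB i1 e1 i2 i3; rewrite (funext ER).
have tot : Rint setT (fun z => ka z * J z) = 1.
  rewrite -Rint_mkind ika//.
  by have [-> _ _] := @step_lo R ((N - N) / w) ltac:(rewrite subrr mul0r//); rewrite subr0.
rewrite -(funext EL) E (funext ER).
have -> : q = Rint setT (fun z => q * (ka z * J z)) by rewrite (RintZ _ measurableT ikJ) tot mulr1.
have -> : e = Rint setT (fun z => e * (ka z * J z)) by rewrite (RintZ _ measurableT ikJ) tot mulr1.
rewrite -(RintB measurableT iR (intgZ q measurableT ikJ)).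
apply: Rint_le_dom => //; first exact: intgZ.
move=> z _; have -> : ka z * J z * Rint `[b, z] D - q * (ka z * J z) = (Rint `[b, z] D - q) * (ka z * J z) by ring.
have kJ0 : 0 <= ka z * J z by rewrite mulr_ge0//; case/andP: (ka0 z).
rewrite normrM (ger0_norm kJ0) /J indic_itv; case: ifPn => [/andP[Nz _]|_].
  by apply: ler_wpM2r; [rewrite mulr1; case/andP: (ka0 z)|rewrite distrC; exact: He].
by rewrite !mulr0.
Qed.

End Backward_heat.

(** * Estimates for the truncated backward flow *)

Section Lower_near.
Context {R : realType}.
Implicit Types f g : R -> R.
Local Notation leb := (@lebesgue_measure R).
Local Notation intg D f := (leb.-integrable D (EFin \o f)).
Local Notation mset D := ((measurable : set (set (measurableTypeR R))) D).

Lemma Rint_ae (D : set R) f1 f2 : mset D -> measurable_fun D f1 -> measurable_fun D f2 ->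
  {ae leb, forall x, f1 x = f2 x} -> Rint D f1 = Rint D f2.
Proof.
move=> mD m1 m2 h; rewrite /Defs.Rint /Rintegral; congr (fine _).
apply: ae_eq_integral => //; try exact/measurable_EFinP.
by apply: (filterS (F := almost_everywhere leb) _ h) => x hx _; rewrite /= hx.
Qed.

Fact sub_arith (p q r s z : R) : p - z - r - (q - z - s) = p - q - (r - s).
Proof. ring. Qed.

(** Subtracting [lfun] of the heat flow, which is 0, cancels the terms at time 0, because both start
    from [g] almost everywhere. *)
Lemma lfun_diff (T : R) g mu (G : R -> R -> R) : 0 < T -> M1 g -> piecewise_continuous g ->
  density T mu -> {ae leb, forall x, mu 0 x = g x} -> C12K G ->
  lfun T mu G = Rint setT (fun x => G T x * (mu T x - rho g T x)) -
    Rint `[0, T] (fun t => Rint setT (fun x => (mu t x - rho g t x) * hh G t x)).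
Proof.
move=> T0 Mg pg dm ae0 CG; rewrite -[LHS]subr0 -{1}(lfun_rho T0 Mg pg CG).
have [M [C [M0 C0 mh hB GB]]] := hh_data CG.
have mrho := measurable_rho Mg; have mmu := dm.2.1.
have mrs t : measurable_fun setT (rho g t) by exact: (measurableT_comp mrho (pair1_measurable t)).
have r1 t x : `|rho g t x| <= 1 by have /andP[? ?] := rho01 t x Mg; rewrite ger0_norm.
have m1 t x : `|mu t x| <= 1 by have [_ ->] := density_sec t dm.
have ms t : measurable_fun setT (mu t) by have [] := density_sec t dm.
have mG t : measurable_fun setT (G t) by apply: continuous_Rmeas; exact: C12K_sec.
have mhs t : measurable_fun setT (hh G t) by exact: (measurableT_comp mh (pair1_measurable t)).
have iG t f : measurable_fun setT f -> (forall x, `|f x| <= 1) -> intg setT (fun x => G t x * f x).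
  move=> mf f1; apply: (@intg_box _ _ (- M) M C); first exact: measurable_funM.
  by move=> x; rewrite normrM -[leRHS]mulr1; apply: ler_pM.
have ih t f : measurable_fun setT f -> (forall x, `|f x| <= 1) -> intg setT (fun x => f x * hh G t x).
  move=> mf f1; apply: (@intg_box _ _ (- M) M C); first exact: measurable_funM.
  by move=> x; rewrite normrM -[leRHS]mul1r; apply: ler_pM.
have [_ imu _] := lfun_time_intg M0 (ltW T0) mmu (fun t x _ => m1 t x) mh hB.
have irho := measurable_hh_rho Mg CG (ltW T0).
have mz : mset `[0, T]%classic by exact: measurable_itv.
have E0 : Rint setT (fun x => G 0 x * mu 0 x) = Rint setT (fun x => G 0 x * rho g 0 x).
  have ea : {ae leb, forall x, G 0 x * mu 0 x = G 0 x * rho g 0 x}.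
    by apply: (filterS (F := almost_everywhere leb) _ ae0) => x hx; rewrite /rho lexx hx.
  exact: (Rint_ae measurableT (measurable_funM (mG 0) (ms 0)) (measurable_funM (mG 0) (mrs 0)) ea).
have ET : Rint setT (fun x => G T x * (mu T x - rho g T x)) =
    Rint setT (fun x => G T x * mu T x) - Rint setT (fun x => G T x * rho g T x).
  rewrite -(RintB measurableT (iG T _ (ms T) (m1 T)) (iG T _ (mrs T) (r1 T))).
  by apply: Rint_eq => x _; rewrite mulrBr.
have EH : Rint `[0, T] (fun t => Rint setT (fun x => (mu t x - rho g t x) * hh G t x)) =
    Rint `[0, T] (fun t => Rint setT (fun x => mu t x * hh G t x)) -
    Rint `[0, T] (fun t => Rint setT (fun x => rho g t x * hh G t x)).
  rewrite -(RintB mz imu irho); apply: Rint_eq => t _.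
  rewrite -(RintB measurableT (ih t _ (ms t) (m1 t)) (ih t _ (mrs t) (r1 t))).
  by apply: Rint_eq => x _; rewrite mulrBl.
rewrite ET EH /lfun E0; exact: sub_arith.
Qed.

Lemma bE01 (T d b t x : R) : 0 <= bE T d b t x <= 1.
Proof. exact: ncdf01. Qed.

Lemma bEx_int (T d b t : R) : 0 < d ->
  intg setT (bEx T d b t) /\ Rint setT (bEx T d b t) = 1.
Proof.
move=> d0; have c0 := clock_gt0 T t d0.
have -> : bEx T d b t = (fun x => sigma (clock T d t) (b - x)).
  by apply/funext => x; rewrite bEx_sigma// sigma_sym.
by split; [exact: intg_sigma|exact: Rint_sigma].
Qed.

(** Together with the unit mass of [bEx], the height bound controls the integral of its square by
    [1 / rad], which is integrable in time uniformly in [d]. *)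
Lemma bEx_bounds (T d b t x : R) : 0 < d -> 0 <= bEx T d b t x <= (rad T d t)^-1.
Proof.
move=> d0; have r0 := rad_gt0 T t d0; have c0 := clock_gt0 T t d0.
apply/andP; split; first by rewrite divr_ge0 ?sigma_ge0 ?(ltW r0).
rewrite /bEx -[leRHS]mul1r; apply: ler_wpM2r; first by rewrite invr_ge0 ltW.
rewrite /sigma mulr1 -[leRHS]mulr1; apply: ler_pM; rewrite ?invr_ge0 ?sqrtr_ge0 ?expR_ge0//.
  have pi2 : 1 <= Num.sqrt (2 * pi : R).
    by rewrite -[leLHS]sqrtr1; apply: ler_wsqrtr; have := pi_ge2 R; lra.
  by rewrite invf_le1// (lt_le_trans ltr01).
rewrite -expR0 ler_expR mulNr oppr_le0 divr_ge0// ?sqr_ge0//; lra.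
Qed.

(** On [[0, T]] the clock runs at speed -1, so [- 2 rad] is a primitive of [1 / rad]. *)
Lemma rad_int (T d k1 k2 : R) : 0 <= T -> 0 < d ->
  intg `[0, T] (fun t => k1 + k2 / rad T d t) /\
  Rint `[0, T] (fun t => k1 + k2 / rad T d t) = k1 * T + 2 * k2 * (rad T d 0 - rad T d T).
Proof.
move=> T0 d0.
have cr t : {for t, continuous (rad T d)} by exact: is_derive_cont (rad_d T t d0).
have cc : continuous (fun t => k1 + k2 / rad T d t).
  move=> t; apply: cvgD; first exact: cvg_cst.
  apply: cvgM; first exact: cvg_cst.
  by apply: cvgV; [rewrite gt_eqF// rad_gt0|exact: cr].
split; first by apply: intg_cont => x _; exact: cc.
have dF (t : R) : 0 <= t <= T -> is_derive t 1 (fun t => k1 * t + (- (2 * k2)) * rad T d t) (k1 + k2 / rad T d t).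
  move=> /andP[_ tT]; have [_ c1] := clock_in d tT; have rn : rad T d t != 0 by rewrite gt_eqF// rad_gt0.
  have h := is_deriveD (is_derive_cmul k1 (is_derive_id t 1)) (is_derive_cmul (- (2 * k2)) (rad_d T t d0)).
  apply: is_derive_eq h _; rewrite c1; field; exact: rn.
by rewrite (Rint_FTC T0 (fun x _ => cc x) dF); ring.
Qed.

Section Cutoff.
Variables (T d b N w : R).
Hypotheses (d0 : 0 < d) (w0 : 0 < w) (bN : b <= N).
Let al := b - 3 * w.
Let c := plat al N w.
Let c1 := plat1 al N w.
Let c2 := plat2 al N w.
Let en := ends al N w.

Fact cutoff_ab : al + 3 * w <= N. Proof. by rewrite /al subrK. Qed.

Fact cutoff_pb x : [/\ 0 <= c x <= 1, `|c1 x| <= w^-1 * en x & `|c2 x| <= (2 / w ^+ 2) * en x].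
Proof. exact: plat_bounds cutoff_ab. Qed.

Fact cutoff_meas : measurable_fun setT c.
Proof. by apply: continuous_Rmeas => x; apply: is_derive_cont (plat_d _ _ _ _); rewrite gt_eqF. Qed.

Fact cutoff_box x : `|c x| <= 1 * \1_(`[al, N + 3 * w] : set R) x.
Proof.
rewrite indic_itv; case: ifPn => h.
  by have [/andP[? ?] _ _] := cutoff_pb x; rewrite mulr1 ger0_norm.
by have [E _ _] := plat_out w0 cutoff_ab h; rewrite /c E normr0 mulr0.
Qed.

Lemma near_first_intg (D : R -> R) : measurable_fun setT D -> (forall x, `|D x| <= 1) ->
  intg setT (fun x => (c x * bE T d b T x) * D x).
Proof.
move=> mD D1.
have mE : measurable_fun setT (bE T d b T).
  by apply: continuous_Rmeas => x; exact: is_derive_cont (bE_dx T b T x d0).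
apply: (@intg_box _ _ al (N + 3 * w) 1).
  by apply: measurable_funM => //; apply: measurable_funM => //; exact: cutoff_meas.
move=> x; have := cutoff_box x; rewrite mul1r => h; have /andP[e0 e1] := bE01 T d b T x.
rewrite normrM -[leRHS]mulr1; apply: ler_pM => //.
by rewrite normrM -[leRHS]mulr1; apply: ler_pM => //; rewrite ger0_norm.
Qed.

(** Two errors add up. Replacing the smoothed half line by the sharp one costs the integral of
    [exp (- (x - b)^2 / (2 d))], which is [sqrt (2 pi d)]; the far edge costs [e] by [abel_step]. *)
Lemma near_first (D : R -> R) (q e : R) : measurable_fun setT D -> (forall x, `|D x| <= 1) ->
  (forall z, N <= z -> `|q - Rint `[b, z] D| <= e) ->
  `|Rint setT (fun x => (c x * bE T d b T x) * D x) - q| <= Num.sqrt (2 * pi * d) + e.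
Proof.
move=> mD D1 He; have i1 := near_first_intg mD D1.
(* On the half line from [b] the near edge of the cutoff is complete, so only the far edge is left,
   in the form required by [abel_step]. *)
pose I x : R := (1 - step ((x - N) / w)) * \1_(`[b, N + 3 * w] : set R) x.
have cI x : c x * (if b <= x then 1 else 0) = I x.
  rewrite /I indic_itv; have [bx|bx] := leP b x; last by rewrite !mulr0.
  have [xN|xN] := leP x (N + 3 * w).
    rewrite !mulr1 /c /plat.
    by have [-> _ _] := @step_hi R ((x - al) / w) ltac:(rewrite ler_pdivlMr// /al; lra).
  have xo : ~~ (al <= x <= N + 3 * w) by rewrite negb_and -!ltNge xN orbT.
  by have [E _ _] := plat_out w0 cutoff_ab xo; rewrite /c E mul0r mulr0.
have mI : measurable_fun setT I.
  apply: measurable_funM; last exact: measurable_indic.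
  apply: continuous_Rmeas => x; apply: cvgB; first exact: cvg_cst.
  have h : is_derive x 1 (fun y => step ((y - N) / w)) (step1 ((x - N) / w) / w).
    by apply: is_derive_affine; [rewrite gt_eqF|exact: step_d].
  exact: is_derive_cont h.
have i2 : intg setT (fun x => D x * I x).
  apply: (@intg_box _ _ al (N + 3 * w) 1); first exact: measurable_funM.
  move=> x; have h := cutoff_box x; rewrite normrM; apply: ler_pM => //; move: h; rewrite mul1r; apply: le_trans.
  by rewrite -cI normrM -[leRHS]mulr1; apply: ler_wpM2l => //; case: ifP; rewrite ?normr1 ?normr0.
have ab := abel_step mD D1 w0 bN He.
have -> : Rint setT (fun x => (c x * bE T d b T x) * D x) - q =
  (Rint setT (fun x => (c x * bE T d b T x) * D x) - Rint setT (fun x => D x * I x)) +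
  (Rint setT (fun x => D x * I x) - q) by rewrite addrA subrK.
apply: (le_trans (ler_normD _ _)); apply: lerD; last exact: ab.
rewrite -(RintB measurableT i1 i2).
have k0 := intgZ (Num.sqrt (2 * pi * d)) measurableT (intg_sigma b d0).
have -> : Num.sqrt (2 * pi * d) = Rint setT (fun x => Num.sqrt (2 * pi * d) * sigma d (b - x)).
  by rewrite (RintZ _ measurableT (intg_sigma b d0)) Rint_sigma// mulr1.
apply: Rint_le_dom => // x _.
have -> : c x * bE T d b T x * D x - D x * I x = (c x * D x) * (bE T d b T x - (if b <= x then 1 else 0)).
  by rewrite -cI mulrBr; congr (_ - _); [rewrite mulrAC|rewrite mulrA (mulrC (D x))].
rewrite sigma_sym -sigma_expR// normrM -[leRHS]mul1r; apply: ler_pM => //.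
  by rewrite normrM -[leRHS]mulr1; apply: ler_pM => //; have [/andP[? ?] _ _] := cutoff_pb x; rewrite ger0_norm.
have [cT _] := clock_in d (lexx T).
have rT : rad T d T = Num.sqrt d by rewrite /rad cT; congr Num.sqrt; ring.
have sd : 0 < Num.sqrt d by rewrite sqrtr_gt0.
have -> : (b <= x) = (0 <= (x - b) / rad T d T) by rewrite rT pmulr_lge0 ?invr_gt0// subr_ge0.
apply: le_trans (ncdf_tail _) _; rewrite rT ler_expR le_eqVlt; apply/orP; left; apply/eqP.
have [s [s0 sE]] : exists s, 0 < s /\ s = Num.sqrt d by exists (Num.sqrt d).
have -> : d = s ^+ 2 by rewrite sE sqr_sqrtr// ltW.
rewrite [Num.sqrt (s ^+ 2)]sqrtr_sqr gtr0_norm//; field; by rewrite gt_eqF.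
Qed.

(** The surviving terms contain a derivative of the cutoff: the one with [bEx] has unit mass and
    contributes [2 / w], the one with the second derivative lives on edges of length [6 w] and
    contributes [6 / w]. *)
Lemma near_second (lam t : R) (m : R -> R) : (forall x, `|m x| <= 1) ->
  `|Rint setT (fun x => m x * (lam * (c1 x * bEx T d b t x + 2^-1 * (c2 x * bE T d b t x))))| <= 8 * `|lam| / w.
Proof.
move=> m1; have wn : w != 0 by rewrite gt_eqF.
have [i1 e1] := bEx_int T b t d0.
have [i2 e2] := ends_int al N (`|lam| / w ^+ 2) w0.
have i1' := intgZ (2 * `|lam| / w) measurableT i1.
have -> : 8 * `|lam| / w = Rint setT (fun x => 2 * `|lam| / w * bEx T d b t x + `|lam| / w ^+ 2 * en x).
  by rewrite (RintD measurableT i1' i2) (RintZ _ measurableT i1) e1 e2; field.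
apply: Rint_le_dom => //; first exact: intgD.
move=> x _; have [_ h1 h2] := cutoff_pb x.
have /andP[e0 e01] := bE01 T d b t x; have /andP[x0 _] := bEx_bounds T b t x d0.
have en0 : 0 <= en x <= 2 by rewrite /en /ends !indicE; case: (_ \in _); case: (_ \in _); rewrite /=; lra.
rewrite normrM -[leRHS]mul1r; apply: ler_pM => //; rewrite normrM.
have -> : 2 * `|lam| / w * bEx T d b t x + `|lam| / w ^+ 2 * en x =
  `|lam| * (w^-1 * 2 * bEx T d b t x + 2^-1 * (2 / w ^+ 2 * en x * 1)) by field.
apply: ler_wpM2l => //; apply: (le_trans (ler_normD _ _)); apply: lerD.
  rewrite normrM (ger0_norm x0); apply: ler_wpM2r => //; apply: (le_trans h1).
  by apply: ler_wpM2l; [rewrite invr_ge0 ltW|case/andP: en0].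
rewrite !normrM (@ger0_norm _ (2^-1 : R))// ler_pM2l//; apply: ler_pM => //.
by rewrite ger0_norm.
Qed.

(** By [(u + v)^2 <= 2 u^2 + 2 v^2] the edges contribute [24 / w], at most 24 as [w >= 1], and the
    bulk contributes twice the integral of [bEx^2], at most [2 / rad]. *)
Lemma near_quad_sec (lam t : R) (m : R -> R) : 1 <= w -> (forall x, `|m x| <= 1) ->
  `|Rint setT (fun x => m x * (lam * (c1 x * bE T d b t x + c x * bEx T d b t x)) ^+ 2)| <=
  24 * lam ^+ 2 + 2 * lam ^+ 2 / rad T d t.
Proof.
move=> w1 m1; have wn : w != 0 by rewrite gt_eqF.
have [i1 e1] := bEx_int T b t d0.
have [i2 e2] := ends_int al N (4 * lam ^+ 2 / w ^+ 2) w0.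
have i1' := intgZ (2 * lam ^+ 2 / rad T d t) measurableT i1.
apply: (@le_trans _ _ (24 * lam ^+ 2 / w + 2 * lam ^+ 2 / rad T d t)).
  have -> : 24 * lam ^+ 2 / w + 2 * lam ^+ 2 / rad T d t = Rint setT (fun x =>
      4 * lam ^+ 2 / w ^+ 2 * en x + 2 * lam ^+ 2 / rad T d t * bEx T d b t x).
    by rewrite (RintD measurableT i2 i1') (RintZ _ measurableT i1) e1 e2 mulr1; congr (_ + _); field.
  apply: Rint_le_dom => //; first exact: intgD.
  move=> x _; have [/andP[cx0 cx1] h1 _] := cutoff_pb x.
  have /andP[e0 e01] := bE01 T d b t x; have /andP[x0 xr] := bEx_bounds T b t x d0.
  have r0 := rad_gt0 T t d0.
  rewrite normrM -[leRHS]mul1r; apply: ler_pM => //; rewrite normrX normrM exprMn real_normK ?num_real//.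
  have -> : 4 * lam ^+ 2 / w ^+ 2 * en x + 2 * lam ^+ 2 / rad T d t * bEx T d b t x =
    lam ^+ 2 * (2 * (w ^- 2 * (2 * en x)) + 2 * ((rad T d t)^-1 * bEx T d b t x)) by ring.
  apply: ler_wpM2l; first exact: sqr_ge0.
  rewrite real_normK ?num_real//.
  apply: (@le_trans _ _ (2 * (c1 x * bE T d b t x) ^+ 2 + 2 * (c x * bEx T d b t x) ^+ 2)).
    have := sqr_ge0 (c1 x * bE T d b t x - c x * bEx T d b t x).
    move: (c1 x * _) (c x * _) => u v; nra.
  apply: lerD; apply: ler_wpM2l => //.
    apply: (@le_trans _ _ ((w^-1 * en x) ^+ 2)).
      rewrite -real_normK ?num_real// lerXn2r ?nnegrE//; first exact: le_trans h1.
      by rewrite normrM -[leRHS]mulr1; apply: ler_pM => //; rewrite ger0_norm.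
    rewrite exprMn exprVn; apply: ler_wpM2l; first by rewrite invr_ge0 sqr_ge0.
    exact: ends_sq.
  apply: (@le_trans _ _ (bEx T d b t x ^+ 2)).
    by rewrite exprMn -[leRHS]mul1r; apply: ler_wpM2r; [exact: sqr_ge0|rewrite expr_le1].
  by rewrite expr2; apply: ler_wpM2r.
rewrite lerD2r ler_pdivrMr//; apply: ler_peMr => //.
by rewrite mulr_ge0// sqr_ge0.
Qed.

End Cutoff.
End Lower_near.

(** * The quadratic lower bound *)

Section Lower_near_bound.
Context {R : realType}.
Implicit Types f g : R -> R.
Local Notation leb := (@lebesgue_measure R).
Local Notation intg D f := (leb.-integrable D (EFin \o f)).
Local Notation mset D := ((measurable : set (set (measurableTypeR R))) D).

(* The quadratic cost of the test function per [lam ^ 2]: [24 T] from the two cutoffs and [4 sqrt (T + 1)] from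
   the time integral of [2 / sqrt (T + d - t)]. *)
Definition near_cst (T : R) : R := 24 * T + 4 * Num.sqrt (T + 1).

Lemma near_cst_gt0 (T : R) : 0 < T -> 0 < near_cst T.
Proof. by move=> T0; rewrite /near_cst ltr_pwDl// ?mulr_gt0// mulr_ge0// sqrtr_ge0. Qed.

(** Since [|q| = 2 K |lam|], all terms are multiples of [z = K lam^2]: the boundary term is at least
    [2 z - z / 2], the drift at most [z / 4], half the quadratic form at most [z / 2]. This leaves
    more than the claimed [z / 2]. *)
Fact lower_arith (q lam A H Q K : R) : 0 < K -> `|lam| = `|q| / (2 * K) -> lam * q = `|lam| * `|q| ->
  `|A - lam * q| <= `|lam| * (`|q| / 4) -> `|H| <= `|lam| * (`|q| / 8) -> Q <= K * `|lam| ^+ 2 ->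
  q ^+ 2 / (8 * K) <= A - H - 2^-1 * Q.
Proof.
move=> K0 lE lq h1 h2 h3; rewrite -(real_normK (num_real q)).
have qE : `|q| = 2 * K * `|lam| by rewrite lE; field; rewrite gt_eqF.
have l0 : 0 <= `|lam| by [].
move: h1; rewrite lq; move: h2 h3; rewrite qE; move: (`|lam|) l0 => l l0 h2 h3 h1.
have -> : (2 * K * l) ^+ 2 / (8 * K) = 2^-1 * (K * l ^+ 2) by field; rewrite gt_eqF.
have e1 : l * (2 * K * l) = 2 * (K * l ^+ 2) by ring.
have e2 : l * (2 * K * l / 4) = 2^-1 * (K * l ^+ 2) by field.
have e3 : l * (2 * K * l / 8) = 4^-1 * (K * l ^+ 2) by field.
have z0 : 0 <= K * l ^+ 2 by rewrite mulr_ge0 ?sqr_ge0 ?ltW.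
move: h1 h2 h3; rewrite e1 e2 e3 !ler_norml => /andP[h1 _] /andP[_ h2] h3.
move: (K * l ^+ 2) z0 h1 h2 h3 => z z0 h1 h2 h3; lra.
Qed.

(** The delay may shrink with [q] because the cost [near_cst] depends on it only through
    [d <= 1]. *)
Lemma near_width (q : R) : q != 0 -> exists d : R, [/\ 0 < d, d <= 1 & Num.sqrt (2 * pi * d) <= `|q| / 8].
Proof.
move=> q0; have l0 : 0 < `|q| by rewrite normr_gt0.
have p0 := pi_gt0 R.
have P0 : 0 < 2 * (pi : R) by rewrite mulr_gt0.
exists (Num.min 1 ((`|q| / 8) ^+ 2 / (2 * pi))); split.
- by rewrite lt_min ltr01 divr_gt0// exprn_gt0// divr_gt0.
- by rewrite ge_min lexx.
have E : Num.sqrt ((`|q| / 8) ^+ 2) = `|q| / 8.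
  by rewrite sqrtr_sqr (@ger0_norm _ (`|q| / 8))// divr_ge0.
rewrite -[leRHS]E; apply: ler_wsqrtr; rewrite mulrC -ler_pdivlMr//.
by rewrite ge_min lexx orbT.
Qed.

(** There is no smallness condition on [q], so the limits at the typical values can use the whole
    punctured line as neighbourhood. *)
Lemma lower_near (T b q : R) g mu : 0 < T -> M1 g -> piecewise_continuous g ->
  density T mu -> {ae leb, forall x, mu 0 x = g x} ->
  (fun N => Rint `[b, N] (fun x => mu T x - rho g T x)) @ +oo --> q -> q != 0 ->
  ((q ^+ 2 / (8 * near_cst T))%:E <= I0 T mu)%E.
Proof.
move=> T0 Mg pg dm ae0 cq qn; have K0 := near_cst_gt0 T0.
have l0 : 0 < `|q| by rewrite normr_gt0.
have [d [d0 d1 sd]] := near_width qn.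
have [N bN HN] : exists2 N, b <= N & forall x, N <= x -> `|q - Rint `[b, x] (fun x => mu T x - rho g T x)| <= `|q| / 8.
  by apply: pinfty_pick; move/cvgrPdist_le : cq; apply; rewrite divr_gt0.
(* The second summand brings the drift [8 |lam| T / w] below [|lam| |q| / 8]; the 1 ensures
   [w >= 1], as needed for the quadratic form. *)
pose w := 1 + 64 * T / `|q|.
have w1 : 1 <= w by rewrite lerDl divr_ge0// mulr_ge0// ltW.
have w0 : 0 < w by exact: lt_le_trans w1.
have [lam [lamE lamq]] := @sign_choice R q (`|q| / (2 * near_cst T)) ltac:(by rewrite divr_ge0// mulr_ge0// ltW).
have ab : b - 3 * w + 3 * w <= N by rewrite subrK.
have [c0 c1 c2 c3] := bE_cont T b d0.
have pde t x : 0 <= t <= T -> bEt T d b t x + 2^-1 * bExx T d b t x = 0.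
  by move=> /andP[_ tT]; exact: bE_pde.
have [CG data] := @testG_data R lam T (b - 3 * w) N w (bE T d b) (bEt T d b) (bEx T d b) (bExx T d b)
  (ltW T0) w0 ab (fun t x => bE_dt T b t x d0) (fun t x => bE_dx T b t x d0) (fun t x => bE_dxx T b t x d0)
  c0 c1 c2 c3 pde.
set G := testG _ _ _ _ _ _ in CG data.
apply: le_trans (I0_ge T mu CG); rewrite lee_fin (lfun_diff T0 Mg pg dm ae0 CG).
have m01 := dm.1.
have D1 t x : `|mu t x - rho g t x| <= 1.
  by have /andP[? ?] := m01 t x; have /andP[? ?] := rho01 t x Mg; rewrite ler_norml; apply/andP; split; lra.
have mD : measurable_fun setT (fun x => mu T x - rho g T x).
  apply: measurable_funB; first by have [] := density_sec T dm.
  exact: (measurableT_comp (measurable_rho Mg) (pair1_measurable T)).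
apply: (lower_arith K0 lamE).
- by rewrite lamq lamE.
- have tT : 0 <= T <= T by rewrite lexx ltW.
  have -> : Rint setT (fun x => G T x * (mu T x - rho g T x)) =
      lam * Rint setT (fun x => (plat (b - 3 * w) N w x * bE T d b T x) * (mu T x - rho g T x)).
    rewrite -(RintZ _ measurableT (@near_first_intg R T d b N w d0 w0 bN _ mD (D1 T))).
    by apply: Rint_eq => x _; have [-> _ _] := data T x tT; rewrite -mulrA.
  rewrite -mulrBr normrM; apply: ler_wpM2l => //.
  apply: le_trans (@near_first R T d b N w d0 w0 bN _ q (`|q| / 8) mD (D1 T) HN) _.
  lra.
- apply: (@le_trans _ _ (8 * `|lam| / w * T)).
    apply: Rint_time; first exact: ltW.
    move=> t tT; have := @near_second R T d b N w d0 w0 bN lam t (fun x => mu t x - rho g t x) (D1 t).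
    apply: le_trans; rewrite le_eqVlt; apply/orP; left; apply/eqP; congr (`|_|).
    by apply: Rint_eq => x _; have [_ _ ->] := data t x tT.
  have -> : 8 * `|lam| / w * T = `|lam| * (8 * T / w) by ring.
  apply: ler_wpM2l => //; rewrite ler_pdivrMr// /w mulrDr mulr1.
  have -> : `|q| / 8 * (64 * T / `|q|) = 8 * T by field; rewrite gt_eqF.
  by rewrite lerDr divr_ge0.
apply: (le_trans (ler_norm _)).
have [ir er] := rad_int (24 * lam ^+ 2) (2 * lam ^+ 2) (ltW T0) d0.
apply: (@le_trans _ _ (24 * lam ^+ 2 * T + 2 * (2 * lam ^+ 2) * (rad T d 0 - rad T d T))); last first.
  have r0 := ltW (rad_gt0 T T d0).
  have rT : rad T d 0 <= Num.sqrt (T + 1).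
    by apply: ler_wsqrtr; have [-> _] := clock_in d (ltW T0); rewrite subr0 lerD2l.
  rewrite real_normK ?num_real// /near_cst.
  have s0 := sqr_ge0 lam; move: (lam ^+ 2) s0 => s s0.
  have : s * (rad T d 0 - rad T d T) <= s * Num.sqrt (T + 1) by apply: ler_wpM2l => //; lra.
  move: (rad T d 0 - rad T d T) (Num.sqrt (T + 1)) => y z h.
  have -> : 2 * (2 * s) * y = 4 * (s * y) by ring.
  have -> : (24 * T + 4 * z) * s = 24 * s * T + 4 * (s * z) by ring.
  lra.
have mz : mset `[0, T]%classic by exact: measurable_itv.
rewrite -er /quadfun; apply: (Rint_le_dom mz ir).
move=> t; rewrite /= in_itv/= => tT.
have mb x : `|mu t x * (1 - mu t x)| <= 1.
  by have /andP[? ?] := mobility_le t x dm; rewrite ger0_norm.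
have := @near_quad_sec R T d b N w d0 w0 bN lam t _ w1 mb.
apply: le_trans; rewrite le_eqVlt; apply/orP; left; apply/eqP; congr (`|_|).
by apply: Rint_eq => x _; have [_ -> _] := data t x tT.
Qed.

End Lower_near_bound.

(** * Lower limits at the typical values *)

Section Lower_bounds.
Context {R : realType}.
Implicit Types f g : R -> R.
Local Notation leb := (@lebesgue_measure R).
Local Notation intg D f := (leb.-integrable D (EFin \o f)).
Local Notation mset D := ((measurable : set (set (measurableTypeR R))) D).

Lemma limf_einf_ge (f : R -> \bar R) (F : set_system R) (V : set R) (c : R) :
  F V -> (forall a, V a -> (c%:E <= f a)%E) -> (c%:E <= limf_einf f F)%E.
Proof.
move=> FV fc; rewrite limf_einfE; apply: (@le_trans _ _ (ereal_inf (f @` V))).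
  by apply/ereal_infP => _ [a Va <-]; exact: fc.
by apply: ereal_sup_ubound; exists V.
Qed.

Lemma Igam_DIC (T : R) g mu (r : R) : (Igam DIC T g mu < +oo)%E ->
  ({ae leb, forall x, mu 0 x = g x} -> (r%:E <= I0 T mu)%E) -> (r%:E <= Igam DIC T g mu)%E.
Proof. by rewrite /Igam; case: ifPn => // /asboolP h _; apply. Qed.

Lemma Jrate_ge (T : R) g (a r : R) :
  (forall mu, density T mu -> {ae leb, forall x, mu 0 x = g x} ->
    int0inf_eq (fun x => mu T x - mu 0 x) a -> (r%:E <= I0 T mu)%E) ->
  (r%:E <= Jrate DIC T g a)%E.
Proof.
move=> H; apply/ereal_infP => _ [mu [dm [Ioo cm]] <-].
by apply: Igam_DIC => // h; exact: H.
Qed.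

Lemma Irate_ge (T : R) g (a r : R) :
  (forall mu, density T mu -> {ae leb, forall x, mu 0 x = g x} ->
    int0inf_eq (fun x => mu T x - mu 0 x) (oint (mu T) 0 a) -> (r%:E <= I0 T mu)%E) ->
  (r%:E <= Irate DIC T g a)%E.
Proof.
move=> H; apply/ereal_infP => _ [mu [dm [Ioo cm]] <-].
by apply: Igam_DIC => // h; exact: H.
Qed.

Lemma scaled_ge (k r c : R) (X : \bar R) : 0 <= k -> c <= k * r -> (r%:E <= X)%E -> (c%:E <= k%:E * X)%E.
Proof.
move=> k0 ck rX; apply: (@le_trans _ _ (k%:E * r%:E)%E); first by rewrite -EFinM lee_fin.
by apply: lee_wpmul2l => //; rewrite lee_fin.
Qed.

Lemma Rint_shift_cvg f (b q C : R) : measurable_fun setT f -> (forall x, `|f x| <= C) ->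
  (fun N => Rint `[0, N] f) @ +oo --> q -> (fun N => Rint `[b, N] f) @ +oo --> q - oint f 0 b.
Proof.
move=> mf fC cq.
have cq' : (fun N => Rint `[0, N] f - oint f 0 b) @ +oo --> q - oint f 0 b.
  by apply: cvgB => //; exact: cvg_cst.
apply: cvg_trans cq'; apply: near_eq_cvg; near=> N.
have N0 : 0 <= N by near: N; exact: nbhs_pinfty_ge.
have bN : b <= N by near: N; apply: nbhs_pinfty_ge; exact: num_real.
have := oint_add 0 b N mf fC; rewrite {2 3}/oint bN N0 => <-.
by rewrite addrC addKr.
Unshelve. all: by end_near. Qed.

Lemma oint_B f1 f2 (a b C : R) : measurable_fun setT f1 -> measurable_fun setT f2 ->
  (forall x, `|f1 x| <= C) -> (forall x, `|f2 x| <= C) ->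
  oint (fun x => f1 x - f2 x) a b = oint f1 a b - oint f2 a b.
Proof.
move=> m1 m2 h1 h2.
have E (x y : R) : Rint `[x, y] (fun x => f1 x - f2 x) = Rint `[x, y] f1 - Rint `[x, y] f2.
  have mz : mset `[x, y]%classic by exact: measurable_itv.
  by rewrite (RintB mz (intg_bounded x y m1 h1) (intg_bounded x y m2 h2)).
by rewrite /oint !E; case: ifP => _ //; rewrite opprD.
Qed.

Lemma Rint_ae_itv f1 f2 (a b : R) : measurable_fun setT f1 -> measurable_fun setT f2 ->
  {ae leb, forall x, f1 x = f2 x} -> Rint `[a, b] f1 = Rint `[a, b] f2.
Proof.
move=> m1 m2 h; have mz : mset `[a, b]%classic by exact: measurable_itv.
by apply: Rint_ae => //; [exact: measurable_funTS m1|exact: measurable_funTS m2].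
Qed.

Fact swap_arith (p q r : R) : p - q - (r - q) = p - r.
Proof. ring. Qed.

Lemma heat_norm g (T x : R) : 0 < T -> M1 g -> `|heat T g x| <= 1.
Proof. by move=> T0 Mg; have [_ /(_ x) /andP[? ?]] := M1_heat T0 Mg; rewrite ger0_norm. Qed.

(* The heat flow [rho] and [mu] start from the same profile, so their masses can be compared at time [T]. *)
Lemma excess_cvg (T rl rr b p : R) g mu : 0 < T -> 0 < rr < 1 -> M1rho rl rr g -> density T mu ->
  {ae leb, forall x, mu 0 x = g x} -> int0inf_eq (fun x => mu T x - mu 0 x) p ->
  (fun N => Rint `[b, N] (fun x => mu T x - rho g T x)) @ +oo -->
    p - vT T g - (oint (mu T) 0 b - oint (heat T g) 0 b).
Proof.
move=> T0 rr01 Mg dm ae0 cp; have M1g := Mg.1; have [mg g01] := M1g.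
have [mT T1] := density_sec T dm; have [m0 m01] := density_sec 0 dm.
have [mh _] := M1_heat T0 M1g; have h1 x := heat_norm x T0 M1g.
have g1 x : `|g x| <= 1 by have /andP[? ?] := g01 x; rewrite ger0_norm.
have -> : rho g T = heat T g by apply/funext => x; rewrite /rho leNgt T0.
rewrite -(oint_B 0 b mT mh T1 h1); apply: (@Rint_shift_cvg _ b _ 2).
- exact: measurable_funB.
- by move=> x; apply: (le_trans (ler_normB _ _)); have := T1 x; have := h1 x; lra.
have cB : (fun L => Rint `[0, L] (fun x => mu T x - mu 0 x) - Rint `[0, L] (fun x => heat T g x - g x)) @ +oo
    --> p - vT T g by exact: (cvgB cp (vT_cvg T0 rr01 Mg)).
apply: cvg_trans cB; apply: near_eq_cvg.
apply: nearW => L.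
have mz : mset `[0, L]%classic by exact: measurable_itv.
have i1 := intg_bounded 0 L mT T1; have i2 := intg_bounded 0 L m0 m01.
have i3 := intg_bounded 0 L mh h1; have i4 := intg_bounded 0 L mg g1.
rewrite /= (RintB mz i1 i2) (RintB mz i3 i4) (RintB mz i1 i3) (Rint_ae_itv 0 L m0 mg ae0).
exact: swap_arith.
Qed.

Lemma J_lower_near (T rl rr : R) g : 0 < T -> 0 < rr < 1 -> profile DIC rl rr g ->
  exists2 c : R, 0 < c &
    (c%:E <= limf_einf (fun a => ((Num.sqrt T / (a - vT T g) ^+ 2)%:E * Jrate DIC T g a)%E) (vT T g)^')%E.
Proof.
move=> T0 rr01 [Mg pg]; have K0 := near_cst_gt0 T0; have sT : 0 < Num.sqrt T by rewrite sqrtr_gt0.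
exists (Num.sqrt T / (8 * near_cst T)); first by rewrite divr_gt0// mulr_gt0.
apply: (limf_einf_ge (V := [set a | a != vT T g])); first exact: (dnbhs_ball ltr01).
move=> a /= av; have qn : a - vT T g != 0 by rewrite subr_eq0.
have q0 : 0 < (a - vT T g) ^+ 2 by rewrite lt_neqAle sqr_ge0 andbT eq_sym expf_neq0.
apply: (@scaled_ge _ ((a - vT T g) ^+ 2 / (8 * near_cst T))).
- by rewrite divr_ge0 ?sqrtr_ge0 ?sqr_ge0.
- by rewrite le_eqVlt; apply/orP; left; apply/eqP; field; rewrite qn gt_eqF.
apply: Jrate_ge => mu dm ae0 cp.
have := excess_cvg (b := 0) T0 rr01 Mg dm ae0 cp.
have -> : a - vT T g - (oint (mu T) 0 0 - oint (heat T g) 0 0) = a - vT T g.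
  have o0 f : oint f 0 0 = 0 :> R.
    by rewrite /oint lexx set_itv1 /Defs.Rint Rintegral_set1.
  by rewrite !o0 !subr0.
by move=> cq; exact: (lower_near T0 Mg.1 pg dm ae0 cq qn).
Qed.

(** Beyond [a] the constraint and the equation of [u] leave as excess mass exactly the mass of the
    heat flow between [u] and [a]. Since the flow is at least [d] at time [T], this mass is at least
    [d |a - u|] in absolute value. *)
Lemma I_lower_near (T rl rr u : R) g : 0 < T -> 0 < rl < 1 -> 0 < rr < 1 -> profile DIC rl rr g ->
  oint (heat T g) 0 u = vT T g ->
  exists2 c : R, 0 < c &
    (c%:E <= limf_einf (fun a => ((Num.sqrt T / (a - u) ^+ 2)%:E * Irate DIC T g a)%E) u^')%E.
Proof.
move=> T0 rl01 rr01 [Mg pg] uE; have K0 := near_cst_gt0 T0; have sT : 0 < Num.sqrt T by rewrite sqrtr_gt0.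
have [d d0 hb] := heat_bounds T0 rl01 rr01 Mg.
have hT x : d <= heat T g x <= 1.
  by have /andP[h1 h2] := hb T x ltac:(apply/andP; split; lra); rewrite h1/=; lra.
exists (Num.sqrt T * d ^+ 2 / (8 * near_cst T)).
  by rewrite divr_gt0 ?mulr_gt0// exprn_gt0.
apply: (limf_einf_ge (V := [set a | a != u])); first exact: (dnbhs_ball ltr01).
move=> a /= av; have qn : a - u != 0 by rewrite subr_eq0.
have q0 : 0 < (a - u) ^+ 2 by rewrite lt_neqAle sqr_ge0 andbT eq_sym expf_neq0.
have [mh _] := M1_heat T0 Mg.1; have h1 x := heat_norm x T0 Mg.1.
have qb := oint_norm u a mh hT (ltW d0).
have qz : oint (heat T g) u a != 0.
  by rewrite -normr_gt0; apply: lt_le_trans qb; rewrite mulr_gt0// normr_gt0.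
apply: (@scaled_ge _ (oint (heat T g) u a ^+ 2 / (8 * near_cst T))).
- by rewrite divr_ge0 ?sqrtr_ge0 ?sqr_ge0.
- have -> : Num.sqrt T / (a - u) ^+ 2 * (oint (heat T g) u a ^+ 2 / (8 * near_cst T)) =
     Num.sqrt T * (oint (heat T g) u a ^+ 2 / (a - u) ^+ 2) / (8 * near_cst T).
    by field; rewrite qn gt_eqF.
  apply: ler_wpM2r; first by rewrite invr_ge0 mulr_ge0// ltW.
  apply: ler_wpM2l; first exact: ltW.
  rewrite ler_pdivlMr// -exprMn -[leRHS]real_normK ?num_real//.
  rewrite -[leLHS]real_normK ?num_real// lerXn2r ?nnegrE//.
  by rewrite normrM (ger0_norm (ltW d0)).
apply: Irate_ge => mu dm ae0 cp.
have := excess_cvg (b := a) T0 rr01 Mg dm ae0 cp.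
have -> : oint (mu T) 0 a - vT T g - (oint (mu T) 0 a - oint (heat T g) 0 a) = oint (heat T g) u a.
  by rewrite -uE -(oint_add 0 u a mh h1); ring.
by move=> cq; exact: (lower_near T0 Mg.1 pg dm ae0 cq qz).
Qed.

End Lower_bounds.

(** * Lower limits at infinity *)

Section Lower_far_bounds.
Context {R : realType}.
Implicit Types f g : R -> R.
Local Notation leb := (@lebesgue_measure R).
Local Notation intg D f := (leb.-integrable D (EFin \o f)).
Local Notation mset D := ((measurable : set (set (measurableTypeR R))) D).

Lemma Rint_ge_itv g (a b c d r C : R) : measurable_fun setT g -> (forall x, 0 <= g x <= C) ->
  a <= c -> c <= d -> d <= b -> 0 <= r -> (forall x, c <= x <= d -> r <= g x) ->
  r * (d - c) <= Rint `[a, b] g.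
Proof.
move=> mg g0 ac cd db r0 gr.
have gC x : `|g x| <= C by have /andP[? ?] := g0 x; rewrite ger0_norm.
have E : Rint setT (fun x => r * \1_(`[c, d] : set R) x) = r * (d - c) by rewrite Rint_indic.
rewrite -E (Rint_mkind `[a, b]%classic); apply: le_trans (ler_norm _) _.
have ib : intg setT (fun x => g x * \1_(`[a, b] : set R) x).
  apply: (@intg_box _ _ a b C); first by apply: measurable_funM => //; exact: measurable_indic.
  move=> x; rewrite normrM; apply: ler_pM => //.
  by rewrite ger0_norm// indicE.
apply: (Rint_le_dom measurableT ib) => x _; rewrite !indic_itv.
have /andP[gx0 _] := g0 x.
case: ifPn => [/andP[h1 h2]|_]; last by rewrite mulr0 normr0 mulr_ge0//; case: ifP.
by rewrite (le_trans ac h1) (le_trans h2 db)/= !mulr1 ger0_norm// gr// h1.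
Qed.

(** Outside [[- X, X]] the profile is at least [r], the smaller of its two limits. The witness [2 X]
    leaves at least half of the way to [a] outside that interval, hence the rate [r / 2]. *)
Lemma oint_far g (rl rr : R) : 0 < rl -> 0 < rr -> M1rho rl rr g ->
  exists r X : R, [/\ 0 < r, 0 <= X & forall a, X < `|a| -> r * `|a| <= `|oint g 0 a|].
Proof.
move=> rl0 rr0 [[mg g01] [xl [xr [_ [gl gr]]]]].
pose X := Num.max `|xl| `|xr|; pose r := Num.min rl rr.
have X0 : 0 <= X by rewrite le_max normr_ge0.
have r0 : 0 < r by rewrite lt_min rl0.
exists (r / 2), (2 * X); split; [by rewrite divr_gt0|by rewrite mulr_ge0|].
move=> a aX; have [a0|a0] := leP 0 a.
  rewrite /oint a0; move: aX; rewrite (ger0_norm a0) => aX.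
  apply: (le_trans _ (ler_norm _)).
  apply: (@le_trans _ _ (r * (a - X))); first by rewrite -mulrA ler_pM2l//; lra.
  apply: (@Rint_ge_itv _ _ _ _ _ _ 1 mg g01 X0 _ (lexx a) (ltW r0)); first by lra.
  move=> x /andP[x1 _]; rewrite gr ?ge_min ?lexx ?orbT//; apply: le_trans x1.
  by apply: (le_trans (ler_norm _)); rewrite le_max lexx orbT.
have a0' : (0 <= a) = false by rewrite leNgt a0.
rewrite /oint a0' normrN; move: aX; rewrite (ltr0_norm a0) => aX.
apply: (le_trans _ (ler_norm _)).
apply: (@le_trans _ _ (r * (- X - a))); first by rewrite -mulrA ler_pM2l//; lra.
apply: (@Rint_ge_itv _ _ _ _ _ _ 1 mg g01 (lexx a) _ _ (ltW r0)); [by lra|by lra|].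
move=> x /andP[_ x1]; rewrite gl ?ge_min ?lexx//; apply: (le_trans x1).
have h : `|xl| <= X by rewrite le_max lexx.
by have := ler_norm (- xl); rewrite normrN; lra.
Qed.

Fact large_sq (k T r a q : R) : 0 < k * T -> 0 < r -> (k * T + 1) / r <= a -> r * a <= q -> k * T <= q ^+ 2.
Proof.
move=> kT0 r0 ar raq; have h : k * T + 1 <= q by apply: le_trans raq; move: ar; rewrite ler_pdivrMr// (mulrC a).
have q1 : 1 <= q by lra.
apply: (@le_trans _ _ q); first by lra.
by rewrite expr2; apply: ler_peMr => //; lra.
Qed.

Lemma J_lower_far (T : R) g : 0 < T ->
  exists2 c : R, 0 < c &
    (c%:E <= limf_einf (fun a => ((T / `|a| ^+ 3)%:E * Jrate DIC T g a)%E) abs_infty)%E.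
Proof.
move=> T0; have [k kE] : exists k : R, k = 2304 by eexists.
have k0 : 0 < k by rewrite kE ltr0n.
have kT0 : 0 < k * T by rewrite mulr_gt0.
exists (1 / (2 * k)); first by rewrite divr_gt0// mulr_gt0.
apply: (limf_einf_ge (V := [set a | k * T + 1 < `|a|])); first by exists (k * T + 1).
move=> a /= aM; have a0 : 0 < `|a| by apply: lt_trans aM; lra.
apply: (@scaled_ge _ _ (`|a| ^+ 3 / (2 * k * T))).
- by rewrite divr_ge0 ?exprn_ge0// ltW.
- rewrite le_eqVlt; apply/orP; left; apply/eqP; field.
  by rewrite !gt_eqF//.
apply: Jrate_ge => mu dm ae0 cp; apply: (lower_far kE T0 dm cp).
rewrite -real_normK ?num_real//; apply: (@large_sq _ _ 1 `|a|) => //; rewrite ?mul1r//.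
by rewrite divr1 ltW.
Qed.

(** When the tagged particle ends at [a], the mass gained beyond [a] is the mass initially between 0
    and [a], up to sign: in the constraint [mu T] cancels and [oint g 0 a] remains. It grows
    linearly in [a] by [oint_far]. *)
Lemma I_lower_far (T rl rr : R) g : 0 < T -> 0 < rl -> 0 < rr -> profile DIC rl rr g ->
  exists2 c : R, 0 < c &
    (c%:E <= limf_einf (fun a => ((T / `|a| ^+ 3)%:E * Irate DIC T g a)%E) abs_infty)%E.
Proof.
move=> T0 rl0 rr0 [Mg pg]; have [k kE] : exists k : R, k = 2304 by eexists.
have k0 : 0 < k by rewrite kE ltr0n.
have kT0 : 0 < k * T by rewrite mulr_gt0.
have [r [X [r0 X0 rX]]] := oint_far rl0 rr0 Mg.
have mg := Mg.1.1.
exists (r ^+ 3 / (2 * k)); first by rewrite divr_gt0 ?exprn_gt0// mulr_gt0.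
have s0 : 0 < (k * T + 1) / r by rewrite divr_gt0//; lra.
apply: (limf_einf_ge (V := [set a | X + (k * T + 1) / r < `|a|])); first by exists (X + (k * T + 1) / r).
move=> a /= aM; have a0 : 0 < `|a| by apply: lt_trans aM; lra.
have ra : r * `|a| <= `|oint g 0 a| by apply: rX; lra.
apply: (@scaled_ge _ _ (`|oint g 0 a| ^+ 3 / (2 * k * T))).
- by rewrite divr_ge0 ?exprn_ge0// ltW.
- have -> : T / `|a| ^+ 3 * (`|oint g 0 a| ^+ 3 / (2 * k * T)) = `|oint g 0 a| ^+ 3 / `|a| ^+ 3 / (2 * k).
    by field; rewrite !gt_eqF.
  apply: ler_wpM2r; first by rewrite invr_ge0 mulr_ge0// ltW.
  rewrite ler_pdivlMr ?exprn_gt0// -exprMn lerXn2r ?nnegrE//.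
  by rewrite mulr_ge0// ltW.
apply: Irate_ge => mu dm ae0 cp.
have [mT T1] := density_sec T dm; have [m0 m01] := density_sec 0 dm.
have D1 x : `|mu T x - mu 0 x| <= 1 by exact: density_diff dm.
have mD : measurable_fun setT (fun x => mu T x - mu 0 x) by exact: measurable_funB.
have cq := Rint_shift_cvg (b := a) mD D1 cp.
have E : oint (mu T) 0 a - oint (fun x => mu T x - mu 0 x) 0 a = oint g 0 a.
  rewrite (oint_B 0 a mT m0 T1 m01) subKr /oint.
  by rewrite (Rint_ae_itv 0 a m0 mg ae0) (Rint_ae_itv a 0 m0 mg ae0).
rewrite E in cq; apply: (lower_far kE T0 dm cq).
rewrite -real_normK ?num_real//; apply: (@large_sq _ _ r `|a|) => //; lra.
Qed.

End Lower_far_bounds.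

Unset Implicit Arguments. Set Strict Implicit. Set Printing Implicit Defensive.

Theorem theorem1p2 (R : realType) (T rl rr u : R) (g : R -> R) :
  0 < T -> 0 < rl < 1 -> 0 < rr < 1 ->
  oint (heat T g) 0 u = vT T g ->
  (forall md : init_cond, profile md rl rr g ->
    exists c1 : R,
      (limf_esup (fun a => ((Num.sqrt T / (a - vT T g) ^+ 2)%:E * Jrate md T g a)%E)
         (vT T g)^' <= c1%:E)%E /\
      (limf_esup (fun a => ((T / `|a| ^+ 3)%:E * Jrate md T g a)%E)
         abs_infty <= c1%:E)%E /\
      (limf_esup (fun a => ((Num.sqrt T / (a - u) ^+ 2)%:E * Irate md T g a)%E)
         u^' <= c1%:E)%E /\
      (limf_esup (fun a => ((T / `|a| ^+ 3)%:E * Irate md T g a)%E)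
         abs_infty <= c1%:E)%E) /\
  (profile DIC rl rr g ->
    exists c2 : R, 0 < c2 /\
      (c2%:E <= limf_einf (fun a => ((Num.sqrt T / (a - vT T g) ^+ 2)%:E * Jrate DIC T g a)%E)
         (vT T g)^')%E /\
      (c2%:E <= limf_einf (fun a => ((T / `|a| ^+ 3)%:E * Jrate DIC T g a)%E)
         abs_infty)%E /\
      (c2%:E <= limf_einf (fun a => ((Num.sqrt T / (a - u) ^+ 2)%:E * Irate DIC T g a)%E)
         u^')%E /\
      (c2%:E <= limf_einf (fun a => ((T / `|a| ^+ 3)%:E * Irate DIC T g a)%E)
         abs_infty)%E).
Proof.
move=> T0 rl01 rr01 uE; split.
  move=> md pr.
  have [k1 p1 h1] := J_upper_near T0 rl01 rr01 pr.
  have [k2 p2 h2] := J_upper_far T0 rl01 rr01 pr.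
  have [k3 p3 h3] := I_upper_near T0 rl01 rr01 pr uE.
  have [k4 p4 h4] := I_upper_far T0 rl01 rr01 pr uE.
  exists (k1 + k2 + k3 + k4).
  by do !split; [apply: (le_trans h1)|apply: (le_trans h2)|apply: (le_trans h3)|apply: (le_trans h4)];
    rewrite lee_fin; lra.
move=> pr; have /andP[rl0 _] := rl01; have /andP[rr0 _] := rr01.
have [k1 p1 h1] := J_lower_near T0 rr01 pr.
have [k2 p2 h2] := J_lower_far g T0.
have [k3 p3 h3] := I_lower_near T0 rl01 rr01 pr uE.
have [k4 p4 h4] := I_lower_far T0 rl0 rr0 pr.
exists (Num.min (Num.min k1 k2) (Num.min k3 k4)); split; first by rewrite !lt_min p1 p2 p3 p4.
by do !split; [apply: (le_trans _ h1)|apply: (le_trans _ h2)|apply: (le_trans _ h3)|apply: (le_trans _ h4)];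
  rewrite lee_fin !ge_min lexx ?orbT.
Qed.
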